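(* Let $E$ be a real or complex infinite-dimensional separable Banach space of stable type $\alpha \in (0,2]$. Let $T$ be a bounded linear operator on $E$ and suppose that there exists a sequence $(u_n)_{n \in \mathbb{Z}}$ of vectors in $E$ with $\sum_{n \in \mathbb{Z}} \lVert u_n \rVert^\alpha < \infty$ such that $T u_n = u_{n-1}$ for every $n \in \mathbb{Z}$. Let $M$ be either a real symmetric $\alpha$-stable random measure on $(\mathbb{Z},\mathcal{P}(\mathbb{Z}))$ if $E$ is real, or a complex isotropic $\alpha$-stable random measure on $(\mathbb{Z},\mathcal{P}(\mathbb{Z}))$ if $E$ is complex, with the counting measure as control measure. Suppose that $\operatorname{span}\{ u_n : n \in \mathbb{Z} \}$ is dense in $E$. Then the distribution of the random vector $$v:= \sum_{n \in \mathbb{Z}} u_n X_n,$$ where $X_n := M(\{n \})$ for every $n \in \mathbb{Z}$, is invariant and strongly mixing with full support under $T$, and $v$ is a symmetric $\alpha$-stable random vector in $E$.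
   Context: All random variables are defined on a suitable probability space $(\Omega,\mathcal{F},\mathbb{P})$. Random measures. Let $(J,\Sigma,m)$ be a $\sigma$-finite measure space and $\Sigma_0=\{A\in\Sigma: m(A)<\infty\}$. A real (complex) random measure on it is a map $M$ from $\Sigma_0$ to real (complex) random variables such that $M(A_1),\dots,M(A_n)$ are independent for pairwise disjoint $A_1,\dots,A_n\in\Sigma_0$, and for pairwise disjoint $(A_k)_{k\ge1}\subset\Sigma_0$ with $\bigcup_k A_k\in\Sigma_0$ the series $\sum_k M(A_k)$ converges in probability and equals $M(\bigcup_k A_k)$ a.s. It is real symmetric $\alpha$-stable with control measure $m$ if it is real and $\mathbb{E}(e^{itM(A)})=\exp(-m(A)|t|^\alpha)$ for all $A\in\Sigma_0$, $t\in\mathbb{R}$. It is complex isotropic $\alpha$-stable with control measure $m$ if it is complex and $\mathbb{E}(e^{i(\theta_1\operatorname{Re}M(A)+\theta_2\operatorname{Im}M(A))})=\exp\left(-m(A)\int_{\mathbb{S}_2}|\theta_1 s_1+\theta_2 s_2|^\alpha\gamma(ds)\right)$ for all $A\in\Sigma_0$, $\theta_1,\theta_2\in\mathbb{R}$, where $\gamma$ is the uniform probability measure on the unit circle $\mathbb{S}_2\subset \mathbb{R}^2$. (Here $J=\mathbb{Z}$ with counting measure, so the $X_n$ are i.i.d., with $\mathbb{E}(e^{itX_n})=\exp(-|t|^\alpha)$ for all $t\in\mathbb{R}$ in the real case, and with $\mathbb{E}(e^{i(\theta_1\operatorname{Re}X_n+\theta_2\operatorname{Im}X_n)})=\exp\left(-\int_{\mathbb{S}_2}|\theta_1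 s_1+\theta_2 s_2|^\alpha\gamma(ds)\right)$ for all $\theta_1,\theta_2\in\mathbb{R}$ in the complex case.) Stable type. $E$ is of stable type $\alpha\in(0,2]$ if for every sequence $(x_n)_{n\ge1}$ in $E$ with $\sum_n\|x_n\|^\alpha<\infty$ the series $\sum_n\theta_n x_n$ converges a.s. in $E$, where $(\theta_n)$ are i.i.d. real random variables with $\mathbb{E}(e^{it\theta_n})=\exp(-|t|^\alpha)$. Stable vectors. An $E$-valued random vector $X$ is $\alpha$-stable if for all $a,b>0$ there is $z\in E$ such that $aX^{(1)}+bX^{(2)}$ has the same distribution as $z+(a^\alpha+b^\alpha)^{1/\alpha}X$, with $X^{(1)},X^{(2)}$ independent copies of $X$; it is symmetric $\alpha$-stable if moreover $X$ and $-X$ have the same distribution. Dynamics. A Borel probability measure $\mu$ on $E$ is invariant under $T$ if $\mu(T^{-1}(A))=\mu(A)$ for all Borel $A$; an invariant $\mu$ is strongly mixing if $\lim_{n\to\infty}\mu(A\cap T^{-n}(B))=\mu(A)\mu(B)$ for all Borel $A,B$; $\mu$ has full support if $\mu(U)>0$ for every nonempty open $U\subset E$. *)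

(* Defs.v *)
From HB Require Import structures.
From mathcomp Require Import all_boot all_order all_algebra.
From mathcomp Require Import all_classical all_reals all_analysis.
From mathcomp Require Import measurable_realfun complex.

Set Implicit Arguments.
Unset Strict Implicit.
Unset Printing Implicit Defensive.

Import Order.TTheory GRing.Theory Num.Theory.
Import numFieldNormedType.Exports.

Local Open Scope classical_set_scope.
Local Open Scope ring_scope.

Variant scalar_kind := RealScalars | ComplexScalars.

Definition scalars (R : realType) (k : scalar_kind) : numFieldType :=
  match k with RealScalars => R | ComplexScalars => R[i] end.

Definition of_real (R : realType) (k : scalar_kind) : R -> scalars R k :=
  match k return R -> scalars R k with
  | RealScalars => fun x => x
  | ComplexScalars => fun x => Complex x 0
  end.

Definition re_part (R : realType) (k : scalar_kind) : scalars R k -> R :=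
  match k return scalars R k -> R with
  | RealScalars => fun x => x
  | ComplexScalars => @complex.Re R
  end.

(* The norm of the library takes its values in the scalar field, hence in
   [R[i]] for a complex space; [rnorm] is the same norm read in [R]. *)
Definition rnorm (R : realType) (k : scalar_kind)
    (E : normedModType (scalars R k)) (x : E) : R :=
  re_part `|x|.

Definition lspan (K : numFieldType) (E : lmodType K) (A : set E) : set E :=
  [set x | exists n (c : 'I_n -> K) (y : 'I_n -> E),
    (forall i, A (y i)) /\ x = \sum_(i < n) c i *: y i].

Definition infinite_dimensional (K : numFieldType) (E : lmodType K) : Prop :=
  forall n (b : 'I_n -> E), lspan (range b) <> [set: E].

Definition separable (T : topologicalType) : Prop :=
  exists2 D : set T, countable D & dense D.

Definition bounded_operator (R : realType) (k : scalar_kind)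
    (E : normedModType (scalars R k)) (T : E -> E) : Prop :=
  exists C : R, forall x, rnorm (T x) <= C * rnorm x.

Definition bilateral_psum (V : zmodType) (f : int -> V) (N : nat * nat) : V :=
  \sum_(0 <= i < N.1) f i%:Z + \sum_(0 <= i < N.2) f (- i.+1%:Z).

(* Both truncation levels of the series over Z go to infinity, with no relation
   between them. *)
Definition bilateral_series_to (K : numFieldType) (E : normedModType K)
    (f : int -> E) (l : E) : Prop :=
  bilateral_psum f @ filter_prod \oo \oo --> l.

Notation borel T := (g_sigma_algebraType (@open T)).


Section random_elements.
Context {R : realType} {d : measure_display} {Omega : measurableType d}.
Variable P : probability Omega R.

Definition mutually_independent {d'} {T : measurableType d'} {I : choiceType}
    (X : I -> Omega -> T) : Prop :=
  forall (s : seq I) (B : I -> set T), uniq s -> (forall i, measurable (B i)) ->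
    P (\bigcap_(i in [set` s]) (X i @^-1` B i))
    = (\prod_(i <- s) P (X i @^-1` B i))%E.

Definition independent_pair {d'} {T : measurableType d'}
    (X Y : Omega -> T) : Prop :=
  forall A B : set T, measurable A -> measurable B ->
    P (X @^-1` A `&` Y @^-1` B) = (P (X @^-1` A) * P (Y @^-1` B))%E.

(* E(e^{iZ}) for a real random variable Z; the library has no integral of
   complex-valued functions. *)
Definition expect_expi (Z : Omega -> R) : R[i] :=
  Complex (\int[P]_w cos (Z w)) (\int[P]_w sin (Z w)).

(* When [K] is [R[i]], [0 < e] forces [e] to be real. *)
Definition cvg_in_probability (K : numFieldType)
    (Y : nat -> Omega -> K) (Z : Omega -> K) : Prop :=
  forall e : K, 0 < e ->
    P [set w | e <= `|Y n w - Z w|] @[n --> \oo] --> (0 : \bar R).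

End random_elements.

Definition same_law {R : realType} {d1 d2 d'} {Omega1 : measurableType d1}
    {Omega2 : measurableType d2} {T : measurableType d'}
    (P1 : probability Omega1 R) (X1 : Omega1 -> T)
    (P2 : probability Omega2 R) (X2 : Omega2 -> T) : Prop :=
  forall A : set T, measurable A -> P1 (X1 @^-1` A) = P2 (X2 @^-1` A).

Section random_measure.
Context {R : realType} {dJ d : measure_display} {J : measurableType dJ}
  {Omega : measurableType d}.
Variables (m : {measure set J -> \bar R}) (P : probability Omega R).

Definition finite_measure_set (A : set J) : Prop :=
  measurable A /\ (m A < +oo)%E.

(* [M] is a total function of sets; only its values on the measurable sets of
   finite measure matter. *)
Definition random_measure (K : numFieldType) (M : set J -> Omega -> K) : Prop :=
  [/\ forall A, finite_measure_set A ->
        measurable_fun [set: Omega] (M A : Omega -> borel K),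
      forall n (A : 'I_n -> set J), (forall i, finite_measure_set (A i)) ->
        trivIset setT A ->
        mutually_independent P (fun i => (M (A i) : Omega -> borel K))
    & forall A : nat -> set J, (forall i, finite_measure_set (A i)) ->
        trivIset setT A -> finite_measure_set (\bigcup_i A i) ->
        cvg_in_probability P (fun n w => \sum_(0 <= i < n) M (A i) w)
          (M (\bigcup_i A i))].

Definition real_sas_measure (alpha : R) (M : set J -> Omega -> R) : Prop :=
  random_measure M /\
  forall A, finite_measure_set A -> forall t : R,
    expect_expi P (fun w => t * M A w)
    = Complex (expR (- (fine (m A) * `|t| `^ alpha))) 0.

End random_measure.

Lemma twopi_gt0 (R : realType) : 0 < (pi : R) *+ 2.
Proof. by rewrite mulrn_wgt0 // pi_gt0. Qed.

Definition unit_circle (R : realType) : set (R * R) :=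
  [set s | s.1 ^+ 2 + s.2 ^+ 2 = 1].

Definition circle_param (R : realType) (t : measurableTypeR R) : R * R :=
  (cos (t : R), sin (t : R)).

Lemma measurable_circle_param (R : realType) :
  @measurable_fun _ _ (measurableTypeR R) (R * R)%type setT (@circle_param R).
Proof.
by apply: measurable_fun_pair; apply: continuous_measurable_fun;
  [exact: continuous_cos|exact: continuous_sin].
Qed.

HB.instance Definition _ (R : realType) :=
  @isMeasurableFun.Build _ _ (measurableTypeR R) (R * R)%type (@circle_param R)
    (@measurable_circle_param R).

(* The uniform probability measure on the unit circle, as the image of the
   uniform law on [0, 2 pi]. *)
Definition circle_uniform (R : realType) : probability (R * R)%type R :=
  distribution (uniform_prob (twopi_gt0 R)) (@circle_param R).

Definition complex_isotropic_measure {R : realType} {dJ d : measure_display}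
    {J : measurableType dJ} {Omega : measurableType d}
    (m : {measure set J -> \bar R}) (P : probability Omega R)
    (alpha : R) (M : set J -> Omega -> R[i]) : Prop :=
  random_measure m P M /\
  forall A, finite_measure_set m A -> forall t1 t2 : R,
    expect_expi P
      (fun w => t1 * complex.Re (M A w) + t2 * complex.Im (M A w))
    = Complex (expR (- (fine (m A) *
        \int[@circle_uniform R]_(s in @unit_circle R)
          `|t1 * s.1 + t2 * s.2| `^ alpha))) 0.

Definition stable_random_measure {R : realType} {dJ d : measure_display}
    {J : measurableType dJ} {Omega : measurableType d} (k : scalar_kind)
    (m : {measure set J -> \bar R}) (P : probability Omega R) (alpha : R) :
    (set J -> Omega -> scalars R k) -> Prop :=
  match k return (set J -> Omega -> scalars R k) -> Prop with
  | RealScalars => real_sas_measure m P alpha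
  | ComplexScalars => complex_isotropic_measure m P alpha
  end.

Definition stable_type (R : realType) (k : scalar_kind)
    (E : normedModType (scalars R k)) (alpha : R) : Prop :=
  forall x : nat -> E,
    (\sum_(0 <= n <oo) (rnorm (x n) `^ alpha)%:E < +oo)%E ->
  forall d (Omega : measurableType d) (P : probability Omega R)
    (theta : nat -> {RV P >-> R}),
    mutually_independent P (fun n => (theta n : Omega -> R)) ->
    (forall n, same_law P (theta n) P (theta 0%N)) ->
    (forall n (t : R), expect_expi P (fun w => t * theta n w)
       = Complex (expR (- (`|t| `^ alpha))) 0) ->
    {ae P, forall w, cvgn (series (fun n => of_real k (theta n w) *: x n))}.

Section stable_vectors.
Context {R : realType} {k : scalar_kind} {E : normedModType (scalars R k)}
  {d : measure_display} {Omega : measurableType d} {P : probability Omega R}.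

(* The independent copies may live on another probability space, since [Omega]
   need not carry any. *)
Definition stable_vector (alpha : R) (X : {RV P >-> borel E}) : Prop :=
  forall a b : R, 0 < a -> 0 < b -> exists z : E,
    forall d' (Omega' : measurableType d') (P' : probability Omega' R)
      (X1 X2 : {RV P' >-> borel E}),
      same_law P' X1 P X -> same_law P' X2 P X -> independent_pair P' X1 X2 ->
      same_law P' (fun w => of_real k a *: (X1 w : E)
                            + of_real k b *: (X2 w : E) : borel E)
        P (fun w => z + of_real k ((a `^ alpha + b `^ alpha) `^ alpha^-1)
                        *: (X w : E) : borel E).

Definition symmetric_stable_vector (alpha : R) (X : {RV P >-> borel E}) : Prop :=
  stable_vector alpha X /\ same_law P X P (fun w => - (X w : E) : borel E).

End stable_vectors.

Section dynamics.
Context {R : realType} {E : ptopologicalType}.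
Variables (mu : probability (borel E) R) (T : E -> E).

Definition invariant_measure : Prop :=
  forall A : set (borel E), measurable A -> mu (T @^-1` A) = mu A.

Definition strongly_mixing : Prop :=
  forall A B : set (borel E), measurable A -> measurable B ->
    mu (A `&` iter n T @^-1` B) @[n --> \oo] --> (mu A * mu B)%E.

Definition full_support : Prop :=
  forall U : set E, open U -> U !=set0 -> (0 < mu U)%E.

End dynamics.

(* int carries the sigma-algebra of all its subsets, as nat does. *)
HB.instance Definition _ := isPointed.Build int 0.
HB.instance Definition _ := @isMeasurable.Build default_measure_display
  int discrete_measurable discrete_measurable0
  discrete_measurableC discrete_measurableU.

(* Main.v *)
(* The vector v is the image of the i.i.d. path (X_n) under the almost surely
   defined map x |-> sum x_n u_n, which conjugates the shift on paths to T, so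
   invariance and mixing are inherited from the Bernoulli shift. Stable type
   gives almost sure convergence, by applying it to the real and imaginary
   parts of the X_n. Stability of v amounts to two sums with independent
   coefficients: the laws of a X_0 + b X_1 and (a^alpha + b^alpha)^(1/alpha) X_0
   coincide because their characteristic functions do. For full support, X_0
   has full support in the scalars, and a small ball around a finite
   combination of the u_n is charged by keeping finitely many coefficients
   close to the given ones and the independent tail small. *)
From HB Require Import structures.
Require Import Defs.
From mathcomp Require Import all_boot all_order all_algebra.
From mathcomp Require Import all_classical all_reals all_analysis.
From mathcomp Require Import measurable_realfun complex ring lra zify.
Set Implicit Arguments.
Unset Strict Implicit.
Unset Printing Implicit Defensive.
Import Order.TTheory GRing.Theory Num.Theory.
Import numFieldNormedType.Exports.
Local Open Scope classical_set_scope.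
Local Open Scope ring_scope.

(** * Scalars and norms *)

(** A stable law is given only by its characteristic function, and two facts have to be extracted
    from it. Uniqueness: products of sines and cosines are combinations of sines and cosines, so the
    factors that preserve equality of all Fourier integrals form an algebra closed under bounded
    limits; a cubic map whose iterates converge to the sign brings indicators of half-planes into
    that algebra. Support: instead of a density, the proof uses that [c1 X + c2 Y] has the law of
    [X] whenever [|c1| ^ alpha + |c2| ^ alpha = 1], so the support is stable under such
    combinations; it contains 0, it is unbounded, and shrinking a far point reaches every scalar.
    Real and complex coefficients are treated at once by writing both characteristic functions as
    [exp (- kappa |t + i s| ^ alpha)], with [i] replaced by 0 over the reals. Identities for the
    series hold only on the set of convergent paths, which has probability one. The series map is
    therefore extended by 0 to all paths, and each identity passes to laws through [eq_prob_on]. *)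

Section scalar_parts.
Context (R : realType) (k : scalar_kind).
Local Notation K := (scalars R k).

Definition im_part : K -> R :=
  match k return scalars R k -> R with
  | RealScalars => fun=> 0
  | ComplexScalars => @complex.Im R
  end.

(* 0 over R, so that [re_im_decomp] holds for both kinds of scalars. *)
Definition imag_unit : K :=
  match k return scalars R k with
  | RealScalars => 0
  | ComplexScalars => Complex 0 1
  end.

(** The modulus with values in [R], as [rnorm] is for vectors: the norm of [K] lies in [K], where
    order and arithmetic depend on the kind of scalars. *)
Definition kabs (x : K) : R := re_part `|x|.

Lemma re_partD (x y : K) : re_part (x + y) = re_part x + re_part y.
Proof. by rewrite /re_part; move: x y; case: k => //= -[? ?] [? ?]. Qed.

Lemma re_partN (x : K) : re_part (- x) = - re_part x.
Proof. by rewrite /re_part; move: x; case: k => //= -[? ?]. Qed.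

Lemma im_partD (x y : K) : im_part (x + y) = im_part x + im_part y.
Proof. by rewrite /im_part; move: x y; case: k => /= [? ?|[? ?] [? ?]//]; rewrite addr0. Qed.

Lemma im_partN (x : K) : im_part (- x) = - im_part x.
Proof. by rewrite /im_part; move: x; case: k => /= [?|[? ?]//]; rewrite oppr0. Qed.

Lemma re_part_realM (a : R) (x : K) : re_part (of_real k a * x) = a * re_part x.
Proof. by rewrite /re_part /of_real; move: x; case: k => //= -[? ?] /=; rewrite mul0r subr0. Qed.

Lemma of_realD (a b : R) : of_real k (a + b) = of_real k a + of_real k b.
Proof. by rewrite /of_real; case: k => //=; apply/eqP; rewrite eq_complex /= addr0 !eqxx. Qed.

Lemma of_realM (a b : R) : of_real k (a * b) = of_real k a * of_real k b.
Proof. by rewrite /of_real; case: k => //=; apply/eqP; rewrite eq_complex /= !mulr0 mul0r subr0 addr0 !eqxx. Qed.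

Lemma of_real1 : of_real k (1 : R) = 1.
Proof. by rewrite /of_real; case: k. Qed.

Lemma of_real0 : of_real k (0 : R) = 0.
Proof. by rewrite /of_real; case: k. Qed.

Lemma of_realN (a : R) : of_real k (- a) = - of_real k a.
Proof. by rewrite /of_real; case: k => //=; apply/eqP; rewrite eq_complex /= oppr0 !eqxx. Qed.

Lemma of_real_inj : injective (@of_real R k).
Proof. by rewrite /of_real; case: k => //= x y []. Qed.

Lemma ler_of_real (a b : R) : (of_real k a <= of_real k b) = (a <= b).
Proof. by rewrite /of_real; case: k => //=; rewrite lecE /= eqxx. Qed.

Lemma ltr_of_real (a b : R) : (of_real k a < of_real k b) = (a < b).
Proof. by rewrite /of_real; case: k => //=; rewrite ltcE /= eqxx. Qed.

Lemma ge0_of_real (x : K) : 0 <= x -> x = of_real k (re_part x).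
Proof.
by rewrite /of_real /re_part; move: x; case: k => //= -[a b]; rewrite lecE /= => /andP[/eqP <- _].
Qed.

Lemma re_im_decomp (x : K) : x = of_real k (re_part x) + imag_unit * of_real k (im_part x).
Proof.
rewrite /of_real /re_part /im_part /imag_unit; move: x; case: k => [x|[a b]] /=.
  by rewrite mulr0 addr0.
suff : Complex a b = Complex a 0 + Complex 0 1 * Complex b 0 :> R[i] by [].
by apply/eqP; rewrite eq_complex /= !mul0r !mulr0 !mul1r subr0 !addr0 !add0r !eqxx.
Qed.
End scalar_parts.

Section scalar_modulus.
Context (R : realType) (k : scalar_kind).
Local Notation K := (scalars R k).
Implicit Types x y : K.

Lemma kabsE x : `|x| = of_real k (kabs x).
Proof. by rewrite /kabs; exact/ge0_of_real/normr_ge0. Qed.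

Lemma kabs_ge0 x : 0 <= kabs x.
Proof. by rewrite -(ler_of_real k) -kabsE of_real0. Qed.

Lemma kabs_of_real (a : R) : kabs (of_real k a) = `|a|.
Proof.
rewrite /kabs /re_part /of_real; case: k => //=.
by rewrite expr0n addr0 sqrtr_sqr.
Qed.

Lemma kabsM x y : kabs (x * y) = kabs x * kabs y.
Proof. by apply: (@of_real_inj _ k); rewrite of_realM -!kabsE normrM. Qed.

Lemma re_part_le x : `|re_part x| <= kabs x.
Proof.
rewrite /kabs /re_part; move: x; case: k => //= -[a b] /=.
by rewrite -sqrtr_sqr ler_wsqrtr // lerDl sqr_ge0.
Qed.

Lemma im_part_le x : `|im_part x| <= kabs x.
Proof.
rewrite /kabs /im_part /re_part; move: x; case: k => [x|[a b]] /=.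
  by rewrite normr0.
by rewrite -sqrtr_sqr ler_wsqrtr // lerDr sqr_ge0.
Qed.

(** An inequality because [imag_unit] is 0 over the reals and has modulus 1 over the complex
    numbers. *)
Lemma kabs_imag_unit : kabs (imag_unit R k) <= 1.
Proof.
rewrite /kabs /imag_unit /re_part; case: k => /=; first by rewrite normr0.
by rewrite expr0n /= add0r expr1n sqrtr1.
Qed.

Lemma kabsD x y : kabs (x + y) <= kabs x + kabs y.
Proof. by rewrite -(ler_of_real k) of_realD -!kabsE ler_normD. Qed.
End scalar_modulus.

Section norm.
Context (R : realType) (k : scalar_kind) (E : normedModType (scalars R k)).
Local Notation K := (scalars R k).
Implicit Types x y z : E.

Lemma rnormE x : `|x| = of_real k (rnorm x).
Proof. by rewrite /rnorm; exact/ge0_of_real/normr_ge0. Qed.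

Lemma rnorm_ge0 x : 0 <= rnorm x.
Proof. by rewrite -(ler_of_real k) -rnormE of_real0. Qed.

Lemma rnormD x y : rnorm (x + y) <= rnorm x + rnorm y.
Proof. by rewrite -(ler_of_real k) of_realD -!rnormE ler_normD. Qed.

Lemma rnormN x : rnorm (- x) = rnorm x.
Proof. by rewrite /rnorm normrN. Qed.

Lemma rnormB x y : rnorm (x - y) = rnorm (y - x).
Proof. by rewrite -rnormN opprB. Qed.

Lemma rnormZ (c : K) x : rnorm (c *: x) = kabs c * rnorm x.
Proof. by apply: (@of_real_inj _ k); rewrite of_realM -!rnormE -kabsE normrZ. Qed.

Lemma rnorm0 : rnorm (0 : E) = 0.
Proof. by apply: (@of_real_inj _ k); rewrite -rnormE normr0 of_real0. Qed.

Lemma rnorm_sum (I : Type) (r : seq I) (F : I -> E) :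
  rnorm (\sum_(i <- r) F i) <= \sum_(i <- r) rnorm (F i).
Proof.
elim/big_ind2 : _ => //[|? ? ? ? h1 h2]; first by rewrite rnorm0.
by rewrite (le_trans (rnormD _ _))// lerD.
Qed.

Lemma ler_rnormB x y : `|rnorm x - rnorm y| <= rnorm (x - y).
Proof.
have h (a b : E) : rnorm a - rnorm b <= rnorm (a - b).
  by rewrite lerBlDr -{1}(subrK b a) rnormD.
by rewrite ler_norml h andbT lerNl opprB rnormB h.
Qed.

(** Radii of balls are positive elements of [K]. Over the complex numbers positivity forces a zero
    imaginary part, so each radius is [of_real] of its real part and real radii suffice. *)
Lemma nbhs_rnormP (x : E) (U : set E) :
  nbhs x U <-> exists2 e : R, 0 < e & forall y, rnorm (x - y) < e -> U y.
Proof.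
rewrite -nbhs_ballE; split => [[e /= e0 eU]|[e e0 eU]].
  have ee : e = of_real k (re_part e) by apply/ge0_of_real/ltW.
  exists (re_part e); first by rewrite -(ltr_of_real k) -ee of_real0.
  by move=> y xye; apply: eU; rewrite -ball_normE /= rnormE ee ltr_of_real.
exists (of_real k e) => /=; first by rewrite -of_real0 ltr_of_real.
by move=> y; rewrite -ball_normE /= rnormE ltr_of_real; exact: eU.
Qed.

Lemma cvg_rnormP {T : Type} (F : set_system T) {FF : Filter F} (f : T -> E) (l : E) :
  f @ F --> l <-> forall e : R, 0 < e -> \forall t \near F, rnorm (l - f t) < e.
Proof.
split => [fl e e0|H].
  by apply: (fl [set y | rnorm (l - y) < e]); apply/nbhs_rnormP; exists e.
move=> U /nbhs_rnormP[e e0 eU]; apply: filterS (H _ e0) => t; exact: eU.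
Qed.
End norm.

(** * Characteristic functions determine laws *)

Section bounded_measurable.
Context {R : realType} {d : measure_display} {T : measurableType d}.
Implicit Types f g : T -> R.

(** Boundedness gives integrability under every probability and, unlike integrability, is preserved
    by products. *)
Definition bounded_measurable f :=
  measurable_fun setT f /\ exists M : R, forall x, `|f x| <= M.

Lemma bounded_measurable_cst (c : R) : bounded_measurable (fun=> c).
Proof. by split; [exact: measurable_cst|exists `|c|]. Qed.

Lemma bounded_measurableD f g : bounded_measurable f -> bounded_measurable g ->
  bounded_measurable (fun x => f x + g x).
Proof.
move=> [mf [M fM]] [mg [N gN]]; split; first exact: measurable_funD.
by exists (M + N) => x; rewrite (le_trans (ler_normD _ _))// lerD.
Qed.

Lemma bounded_measurableM f g : bounded_measurable f -> bounded_measurable g ->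
  bounded_measurable (fun x => f x * g x).
Proof.
move=> [mf [M fM]] [mg [N gN]]; split; first exact: measurable_funM.
by exists (M * N) => x; rewrite normrM ler_pM.
Qed.

Lemma measurable_cosR : measurable_fun setT (@cos R).
Proof. apply: continuous_measurable_fun; exact: continuous_cos. Qed.

Lemma measurable_sinR : measurable_fun setT (@sin R).
Proof. apply: continuous_measurable_fun; exact: continuous_sin. Qed.

Lemma bounded_measurable_cos f : measurable_fun setT f ->
  bounded_measurable (fun x => cos (f x)).
Proof.
move=> mf; split; first exact: measurableT_comp measurable_cosR _.
by exists 1 => x; rewrite ler_norml cos_geN1 cos_le1.
Qed.

Lemma bounded_measurable_sin f : measurable_fun setT f ->
  bounded_measurable (fun x => sin (f x)).
Proof.
move=> mf; split; first exact: measurableT_comp measurable_sinR _.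
by exists 1 => x; rewrite ler_norml sin_geN1 sin_le1.
Qed.

Lemma bounded_measurable_indic (A : set T) : measurable A ->
  bounded_measurable (\1_A : T -> R).
Proof.
move=> mA; split; first exact: measurable_indic.
by exists 1 => x; rewrite indicE; case: (_ \in _); rewrite ?normr1 ?normr0.
Qed.

Variable P : probability T R.

Lemma bounded_measurable_integrable f : bounded_measurable f ->
  P.-integrable setT (EFin \o f).
Proof.
move=> [mf [M fM]]; apply: measurable_bounded_integrable => //.
  by rewrite (le_lt_trans (probability_le1 P _))// ltry.
exists M; split; first exact: num_real.
by move=> y My x _ /=; rewrite (le_trans (fM x))// ltW.
Qed.

Lemma RintD f g : bounded_measurable f -> bounded_measurable g ->
  \int[P]_x (f x + g x) = \int[P]_x f x + \int[P]_x g x.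
Proof. by move=> ? ?; apply: RintegralD => //; exact: bounded_measurable_integrable. Qed.

Lemma RintZ (c : R) f : bounded_measurable f ->
  \int[P]_x (c * f x) = c * \int[P]_x f x.
Proof. by move=> ?; apply: RintegralZl => //; exact: bounded_measurable_integrable. Qed.

Lemma Rint_cvg (F : nat -> T -> R) f (M : R) :
  (forall n, measurable_fun setT (F n)) -> measurable_fun setT f ->
  (forall n x, `|F n x| <= M) -> (forall x, F n x @[n --> \oo] --> f x) ->
  \int[P]_x F n x @[n --> \oo] --> \int[P]_x f x.
Proof.
move=> mF mf FM Ff.
have bF n : bounded_measurable (F n) by split => //; exists M; exact: FM.
have iF n : (\int[P]_x (F n x)%:E)%E \is a fin_num.
  exact: (integrable_fin_num measurableT (bounded_measurable_integrable (bF n))).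
have [] := @dominated_convergence _ _ _ P setT measurableT
  (fun n x => (F n x)%:E) (EFin \o f) (cst M%:E).
- by move=> n; exact/measurable_EFinP.
- exact/measurable_EFinP.
- by apply: aeW => x _; apply: cvg_EFin; [exact: nearW|exact: Ff].
- exact: (bounded_measurable_integrable (bounded_measurable_cst M)).
- by apply: aeW => x n _; rewrite /= lee_fin.
move=> If _ cvF.
have fF : (\int[P]_x (f x)%:E)%E \is a fin_num by exact: (integrable_fin_num measurableT If).
rewrite /Rintegral; apply: fine_cvg; rewrite fineK //.
Qed.

Lemma Rint_indic (A : set T) : measurable A -> \int[P]_x (\1_A x : R) = fine (P A).
Proof. by move=> mA; rewrite /Rintegral integral_indic // setIT. Qed.

Lemma le_Rint f g : bounded_measurable f -> bounded_measurable g ->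
  (forall x, f x <= g x) -> \int[P]_x f x <= \int[P]_x g x.
Proof. by move=> ? ? fg; apply: le_Rintegral => //; exact: bounded_measurable_integrable. Qed.

Lemma Rint_cst (c : R) : \int[P]_x c = c.
Proof. by rewrite Rintegral_cst //; have -> : fine (P setT) = 1; rewrite ?mulr1 ?probability_setT. Qed.
End bounded_measurable.

Section sign_iteration.
Context {R : realType}.

(* On [-1, 1] its iterates converge to the sign. *)
Definition sgstep (s : R) : R := (3 * s - s ^+ 3) / 2.

Lemma sgstepN (s : R) : sgstep (- s) = - sgstep s.
Proof. by rewrite /sgstep; field. Qed.

Lemma iter_sgstepN n (s : R) : iter n sgstep (- s) = - iter n sgstep s.
Proof. by elim: n => //= n ->; rewrite sgstepN. Qed.

(** The gap to the fixed point 1 satisfies [1 - sgstep x = (1 - x) * ((1 - x) * (2 + x) / 2)]. For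
    [s <= x <= 1] the second factor equals [1 - (x + x ^+ 2) / 2], at most [1 - s / 2], whence
    geometric decay; the induction carries [s <= x] for this purpose. *)
Lemma iter_sgstep_bound n (s : R) : 0 < s <= 1 ->
  (s <= iter n sgstep s <= 1) && (1 - iter n sgstep s <= (1 - s / 2) ^+ n).
Proof.
move=> /andP[s0 s1]; elim: n => [|n]; first by rewrite /= lexx s1 expr0; lra.
rewrite iterS; set x := iter n sgstep s => /andP[/andP[sx x1] xn].
have stepE : 1 - sgstep x = (1 - x) * ((1 - x) * (2 + x) / 2).
  by rewrite /sgstep; field.
have h1 : sgstep x = x + x * (1 - x ^+ 2) / 2 by rewrite /sgstep; field.
apply/andP; split; first (apply/andP; split).
- rewrite h1 (le_trans sx)// lerDl divr_ge0 // mulr_ge0 ?subr_ge0 ?expr_le1 //; lra.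
- by rewrite -subr_ge0 stepE !mulr_ge0 ?subr_ge0 // ; lra.
rewrite stepE exprSr ler_pM //; first lra.
  by rewrite !mulr_ge0 //; lra.
rewrite -subr_ge0 (_ : _ - _ = ((x - s) + x ^+ 2) / 2); last by field.
by rewrite divr_ge0 // addr_ge0 ?subr_ge0 // sqr_ge0.
Qed.

Lemma norm_iter_sgstep n (s : R) : `|s| <= 1 -> `|iter n sgstep s| <= 1.
Proof.
have iter0 : iter n sgstep 0 = 0.
  by elim: n => //= n ->; rewrite /sgstep mulr0 expr0n /= subrr mul0r.
wlog s0 : s / 0 <= s => [H s1|].
  have [/H|/ltW s0] := leP 0 s; first exact.
  by rewrite -normrN -iter_sgstepN H ?normrN // oppr_ge0.
move: s0; rewrite le_eqVlt => /predU1P[<- _|s0]; first by rewrite iter0 normr0.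
rewrite (gtr0_norm s0) => s1.
have s01 : 0 < s <= 1 by rewrite s0.
have /andP[/andP[sx x1] _] := iter_sgstep_bound n s01.
by rewrite ger0_norm ?x1 // (le_trans (ltW s0) (sx)).
Qed.

Lemma cvg_iter_sgstep (s : R) : `|s| <= 1 -> iter n sgstep s @[n --> \oo] --> Num.sg s.
Proof.
have H : forall s : R, 0 < s <= 1 -> iter n sgstep s @[n --> \oo] --> (1 : R).
  move=> {}s s01; have h n := iter_sgstep_bound n s01.
  have hl : 1 - (1 - s / 2) ^+ n @[n --> \oo] --> (1 : R).
    rewrite -[X in _ --> X]subr0; apply: cvgB; first exact: cvg_cst.
    by apply: cvg_expr; move: s01 => /andP[? ?]; rewrite ger0_norm; lra.
  apply: (squeeze_cvgr _ hl (cvg_cst _)); apply: nearW => n.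
  by have /andP[/andP[_ ->]] := h n; rewrite andbT lerBlDr addrC -lerBlDr.
case: (ltrgt0P s) => [s0 s1|s0 s1|-> _].
- by rewrite gtr0_sg //; apply: H; rewrite s0.
- rewrite ltr0_sg //.
  have -> : (fun n => iter n sgstep s) = (fun n => - iter n sgstep (- s)).
    by apply/funext => n; rewrite iter_sgstepN opprK.
  by apply: cvgN; apply: H; rewrite oppr_gt0 s0.
rewrite sgr0.
have -> : (fun n => iter n sgstep 0) = (fun=> 0).
  by apply/funext; elim => //= n ->; rewrite /sgstep mulr0 expr0n /= subrr mul0r.
exact: cvg_cst.
Qed.

Lemma sin_sg (x : R) : `|x| < pi -> Num.sg (sin x) = Num.sg x.
Proof.
have H (y : R) : 0 < y -> y < pi -> Num.sg (sin y) = Num.sg y.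
  by move=> y0 ypi; rewrite !gtr0_sg // sin_gt0_pi // y0.
case: (ltrgt0P x) => [x0 xpi|x0 xpi|-> _]; last by rewrite sin0.
- exact: H.
- by apply: oppr_inj; rewrite -!sgrN -sinN; apply: H; rewrite ?oppr_gt0.
Qed.
End sign_iteration.

(** * Two laws on the plane with the same characteristic function *)

Section char_fun.
Context {R : realType} {d1 d2 : measure_display} {Omega1 : measurableType d1}
  {Omega2 : measurableType d2}.
Variables (P1 : probability Omega1 R) (P2 : probability Omega2 R).
Variables (X1 : Omega1 -> R * R) (X2 : Omega2 -> R * R).
Hypothesis mX1 : measurable_fun setT X1.
Hypothesis mX2 : measurable_fun setT X2.
Implicit Types f g : R * R -> R.

Let agree f := \int[P1]_w f (X1 w) = \int[P2]_w f (X2 w).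

Let bm1 f : bounded_measurable f -> bounded_measurable (f \o X1).
Proof. by move=> [mf [M fM]]; split; [exact: measurableT_comp|exists M => x; exact: fM]. Qed.
Let bm2 f : bounded_measurable f -> bounded_measurable (f \o X2).
Proof. by move=> [mf [M fM]]; split; [exact: measurableT_comp|exists M => x; exact: fM]. Qed.

Let agreeD f g : bounded_measurable f -> bounded_measurable g ->
  agree f -> agree g -> agree (fun x => f x + g x).
Proof.
move=> bf bg af ag; rewrite /agree (RintD _ (bm1 bf) (bm1 bg)).
by rewrite (RintD _ (bm2 bf) (bm2 bg)) /= af ag.
Qed.

Let agreeZ c f : bounded_measurable f -> agree f -> agree (fun x => c * f x).
Proof.
by move=> bf af; rewrite /agree (RintZ _ _ (bm1 bf)) (RintZ _ _ (bm2 bf)) /= af.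
Qed.

Let cs (t : R * R) (x : R * R) : R := cos (t.1 * x.1 + t.2 * x.2).
Let sn (t : R * R) (x : R * R) : R := sin (t.1 * x.1 + t.2 * x.2).

Let mlin (t : R * R) : measurable_fun setT (fun x : R * R => t.1 * x.1 + t.2 * x.2).
Proof.
by apply: measurable_funD; apply: measurable_funM.
Qed.
Let bcs t : bounded_measurable (cs t). Proof. exact: bounded_measurable_cos (mlin t). Qed.
Let bsn t : bounded_measurable (sn t). Proof. exact: bounded_measurable_sin (mlin t). Qed.

(** The two laws, weighted by the possibly signed density [f], have the same Fourier transform. *)
Let good f := bounded_measurable f /\
  forall t, agree (fun x => f x * cs t x) /\ agree (fun x => f x * sn t x).

(* The multipliers of [good] form a class containing the trigonometric
   functions and closed under sums, products and bounded limits, hence, by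
   iterating [sgstep], under [Num.sg]. *)
Let mult g := bounded_measurable g /\ forall f, good f -> good (fun x => f x * g x).

Let mult_cst c : mult (fun=> c).
Proof.
split; first exact: bounded_measurable_cst.
move=> f [bf gf]; split; first by apply: bounded_measurableM => //; exact: bounded_measurable_cst.
move=> t; have [h1 h2] := gf t; split.
  rewrite (_ : (fun _ => _) = (fun x => c * (f x * cs t x))).
    by apply: agreeZ => //; exact: bounded_measurableM.
  by apply/funext => x; ring.
rewrite (_ : (fun _ => _) = (fun x => c * (f x * sn t x))).
  by apply: agreeZ => //; exact: bounded_measurableM.
by apply/funext => x; ring.
Qed.

Let multM g h : mult g -> mult h -> mult (fun x => g x * h x).
Proof.
move=> [bg gg] [bh gh]; split; first exact: bounded_measurableM.
move=> f /gg/gh; congr good; apply/funext => x; ring.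
Qed.

Let multD g h : mult g -> mult h -> mult (fun x => g x + h x).
Proof.
move=> [bg gg] [bh gh]; split; first exact: bounded_measurableD.
move=> f gf; have [bfg hg] := gg _ gf; have [bfh hh] := gh _ gf.
split.
  rewrite (_ : (fun _ => _) = (fun x => f x * g x + f x * h x)).
    exact: bounded_measurableD.
  by apply/funext => x; ring.
move=> t; have [? ?] := hg t; have [? ?] := hh t; split.
  rewrite (_ : (fun _ => _) = (fun x => f x * g x * cs t x + f x * h x * cs t x)).
    by apply: agreeD => //; exact: bounded_measurableM.
  by apply/funext => x; ring.
rewrite (_ : (fun _ => _) = (fun x => f x * g x * sn t x + f x * h x * sn t x)).
  by apply: agreeD => //; exact: bounded_measurableM.
by apply/funext => x; ring.
Qed.

Let bounded_measurable_lim (G : nat -> R * R -> R) g (M : R) :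
  (forall n, bounded_measurable (G n)) -> (forall n x, `|G n x| <= M) ->
  (forall x, G n x @[n --> \oo] --> g x) -> bounded_measurable g.
Proof.
move=> bG GM Gg; split.
  by apply: (@measurable_fun_cvg _ _ R setT G g) => // n; have [] := bG n.
exists M => x; have Gx : `|G n x| @[n --> \oo] --> `|g x| by apply: cvg_norm; exact: Gg.
by apply: (closed_cvg (fun y => y <= M)) Gx; [exact: closed_le|apply: nearW => n; exact: GM].
Qed.

Let agree_lim (G : nat -> R * R -> R) g (M : R) :
  (forall n, bounded_measurable (G n)) -> (forall n x, `|G n x| <= M) ->
  (forall x, G n x @[n --> \oo] --> g x) -> (forall n, agree (G n)) -> agree g.
Proof.
move=> bG GM Gg aG; have bg := bounded_measurable_lim bG GM Gg.
have c1 : \int[P1]_w G n (X1 w) @[n --> \oo] --> \int[P1]_w g (X1 w).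
  by apply: (@Rint_cvg _ _ _ _ _ _ M) => // [n|]; [have [] := bm1 (bG n)|have [] := bm1 bg].
have c2 : \int[P2]_w G n (X2 w) @[n --> \oo] --> \int[P2]_w g (X2 w).
  by apply: (@Rint_cvg _ _ _ _ _ _ M) => // [n|]; [have [] := bm2 (bG n)|have [] := bm2 bg].
have cE : (fun n => \int[P1]_w G n (X1 w)) = (fun n => \int[P2]_w G n (X2 w)).
  by apply/funext => n; exact: aG.
by rewrite cE in c1; apply: cvg_unique c2.
Qed.

Let mult_lim (G : nat -> R * R -> R) g (M : R) :
  (forall n, mult (G n)) -> (forall n x, `|G n x| <= M) ->
  (forall x, G n x @[n --> \oo] --> g x) -> mult g.
Proof.
move=> mG GM Gg; have bG n : bounded_measurable (G n) by have [] := mG n.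
have bg := bounded_measurable_lim bG GM Gg; split => // f gf.
have [bf _] := gf; split; first exact: bounded_measurableM.
have [_ [N fN]] := bf.
(* [c] stands for the cosine or the sine of frequency [t], so the products are dominated by the
   constant [N * M]. *)
have H (c : R * R -> R) : bounded_measurable c -> (forall x, `|c x| <= 1) ->
    (forall n, agree (fun x => f x * G n x * c x)) -> agree (fun x => f x * g x * c x).
  move=> bc c1 aG; apply: (@agree_lim (fun n x => f x * G n x * c x) _ (N * M)) => //.
  - by move=> n; do 2 apply: bounded_measurableM => //.
  - move=> n x; rewrite normrM -[leRHS]mulr1 ler_pM // normrM.
    by rewrite ler_pM // fN.
  - by move=> x; apply: cvgMl; apply: cvgMr; exact: Gg.
move=> t; split; apply: H => //; try by move=> x; rewrite ler_norml ?cos_geN1 ?cos_le1 ?sin_geN1 ?sin_le1.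
  by move=> n; have [_ /(_ f gf)[_ /(_ t)[]]] := mG n.
by move=> n; have [_ /(_ f gf)[_ /(_ t)[]]] := mG n.
Qed.

Let good_lin (a b : R) f g : bounded_measurable f -> bounded_measurable g ->
  agree f -> agree g -> agree (fun x => a * f x + b * g x).
Proof.
move=> bf bg af ag; apply: agreeD; try exact: agreeZ.
  by apply: bounded_measurableM => //; exact: bounded_measurable_cst.
by apply: bounded_measurableM => //; exact: bounded_measurable_cst.
Qed.

(** A product of two trigonometric functions is half a sum or difference of those at the frequencies
    [t + s] and [t - s], where [good f] already gives agreement. *)
Let mult_cs s : mult (cs s).
Proof.
split => // f [bf gf]; split; first exact: bounded_measurableM.
move=> t; have [c1 s1] := gf (t.1 + s.1, t.2 + s.2).
have [c2 s2] := gf (t.1 - s.1, t.2 - s.2); split.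
  rewrite (_ : (fun _ => _) = (fun x => 2^-1 * (f x * cs (t.1 + s.1, t.2 + s.2) x) + 2^-1 * (f x * cs (t.1 - s.1, t.2 - s.2) x))).
    by apply: good_lin => //; exact: bounded_measurableM.
  apply/funext => x; rewrite /cs /=.
  rewrite (_ : (t.1 + _) * x.1 + _ * x.2 = (t.1 * x.1 + t.2 * x.2) + (s.1 * x.1 + s.2 * x.2)); last by ring.
  rewrite (_ : (t.1 - _) * x.1 + _ * x.2 = (t.1 * x.1 + t.2 * x.2) - (s.1 * x.1 + s.2 * x.2)); last by ring.
  set A := t.1 * x.1 + t.2 * x.2; set B := s.1 * x.1 + s.2 * x.2.
  by rewrite (cosD A B) (cosB A B); field.
rewrite (_ : (fun _ => _) = (fun x => 2^-1 * (f x * sn (t.1 + s.1, t.2 + s.2) x) + 2^-1 * (f x * sn (t.1 - s.1, t.2 - s.2) x))).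
  by apply: good_lin => //; exact: bounded_measurableM.
apply/funext => x; rewrite /cs /sn /=.
rewrite (_ : (t.1 + _) * x.1 + _ * x.2 = (t.1 * x.1 + t.2 * x.2) + (s.1 * x.1 + s.2 * x.2)); last by ring.
rewrite (_ : (t.1 - _) * x.1 + _ * x.2 = (t.1 * x.1 + t.2 * x.2) - (s.1 * x.1 + s.2 * x.2)); last by ring.
  set A := t.1 * x.1 + t.2 * x.2; set B := s.1 * x.1 + s.2 * x.2.
by rewrite (sinD A B) (sinB A B); field.
Qed.

Let mult_sn s : mult (sn s).
Proof.
split => // f [bf gf]; split; first exact: bounded_measurableM.
move=> t; have [c1 s1] := gf (t.1 + s.1, t.2 + s.2).
have [c2 s2] := gf (t.1 - s.1, t.2 - s.2); split.
  rewrite (_ : (fun _ => _) = (fun x => 2^-1 * (f x * sn (t.1 + s.1, t.2 + s.2) x) + (- 2^-1) * (f x * sn (t.1 - s.1, t.2 - s.2) x))).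
    by apply: good_lin => //; exact: bounded_measurableM.
  apply/funext => x; rewrite /cs /sn /=.
  rewrite (_ : (t.1 + _) * x.1 + _ * x.2 = (t.1 * x.1 + t.2 * x.2) + (s.1 * x.1 + s.2 * x.2)); last by ring.
  rewrite (_ : (t.1 - _) * x.1 + _ * x.2 = (t.1 * x.1 + t.2 * x.2) - (s.1 * x.1 + s.2 * x.2)); last by ring.
    set A := t.1 * x.1 + t.2 * x.2; set B := s.1 * x.1 + s.2 * x.2.
by rewrite (sinD A B) (sinB A B); field.
rewrite (_ : (fun _ => _) = (fun x => (- 2^-1) * (f x * cs (t.1 + s.1, t.2 + s.2) x) + 2^-1 * (f x * cs (t.1 - s.1, t.2 - s.2) x))).
  by apply: good_lin => //; exact: bounded_measurableM.
apply/funext => x; rewrite /cs /sn /=.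
rewrite (_ : (t.1 + _) * x.1 + _ * x.2 = (t.1 * x.1 + t.2 * x.2) + (s.1 * x.1 + s.2 * x.2)); last by ring.
rewrite (_ : (t.1 - _) * x.1 + _ * x.2 = (t.1 * x.1 + t.2 * x.2) - (s.1 * x.1 + s.2 * x.2)); last by ring.
  set A := t.1 * x.1 + t.2 * x.2; set B := s.1 * x.1 + s.2 * x.2.
by rewrite (cosD A B) (cosB A B); field.
Qed.

Let mult_iter g n : mult g -> mult (fun x => iter n sgstep (g x)).
Proof.
move=> mg; elim: n => //= n IH.
rewrite (_ : (fun _ => _) = (fun x => 3 / 2 * iter n sgstep (g x) + (- 2^-1) * (iter n sgstep (g x) * (iter n sgstep (g x) * iter n sgstep (g x))))).
  by apply: multD; apply: multM => //; do 2 apply: multM => //.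
by apply/funext => x; rewrite /sgstep; field.
Qed.

Let mult_sg g : mult g -> (forall x, `|g x| <= 1) -> mult (fun x => Num.sg (g x)).
Proof.
move=> mg g1; apply: (@mult_lim (fun n x => iter n sgstep (g x)) _ 1).
- by move=> n; exact: mult_iter.
- by move=> n x; exact: norm_iter_sgstep.
- by move=> x; exact: cvg_iter_sgstep.
Qed.

(* sg y is the limit of sg (sin (y / n)). *)
Let mult_halfplane (t : R * R) (a : R) :
  mult (fun x => Num.sg (t.1 * x.1 + t.2 * x.2 - a)).
Proof.
pose G (n : nat) (x : R * R) : R :=
  sin ((t.1 * x.1 + t.2 * x.2 - a) / n.+1%:R).
apply: (@mult_lim (fun n x => Num.sg (G n x)) _ 1).
- move=> n; apply: mult_sg; last first.
    by move=> x; rewrite ler_norml ?sin_geN1 ?sin_le1.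
  pose s := (t.1 / n.+1%:R, t.2 / n.+1%:R).
  (* The subtraction formula separates the constant phase from the frequency [s] and leaves known
     multipliers. *)
  rewrite (_ : G n = (fun x => cos (a / n.+1%:R) * sn s x + (- sin (a / n.+1%:R)) * cs s x)).
    exact: multD (multM (mult_cst _) (mult_sn s)) (multM (mult_cst _) (mult_cs s)).
  apply/funext => x; rewrite /G /sn /cs /=.
  rewrite (_ : _ / _ = (t.1 / n.+1%:R * x.1 + t.2 / n.+1%:R * x.2) - a / n.+1%:R).
    by rewrite sinB; ring.
  by field.
- by move=> n x; rewrite normr_sg; case: (_ == _).
move=> x; set y := _ - a.
apply/cvgrPdist_lt => e e0; near=> n.
have n0 : (0 : R) < n.+1%:R by [].
rewrite /G -/y sin_sg.
  have -> : Num.sg (y / n.+1%:R) = Num.sg y by rewrite sgrM (@gtr0_sg _ n.+1%:R^-1) ?invr_gt0 // mulr1.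
  by rewrite subrr normr0.
rewrite normrM normfV (gtr0_norm n0) ltr_pdivrMr //.
have : `|y| < n%:R * pi.
  by rewrite -ltr_pdivrMr ?pi_gt0 //; near: n; exact: nbhs_infty_gtr.
by move=> /lt_le_trans; apply; rewrite mulrC ler_pM2l ?pi_gt0 // ler_nat.
Unshelve. all: by end_near. Qed.

(** The constant 1 is [good] by hypothesis, the indicator of a quadrant is a multiplier as a product
    of two half-plane indicators, and pairing it with frequency 0 reads off its probability.
    Quadrants are closed under intersection and generate the Borel sets, so they suffice for the
    whole law. *)
Lemma char_fun_quadrant :
  (forall t s : R, expect_expi P1 (fun w => t * (X1 w).1 + s * (X1 w).2)
                 = expect_expi P2 (fun w => t * (X2 w).1 + s * (X2 w).2)) ->
  forall a b : R, P1 (X1 @^-1` [set x | a < x.1 /\ b < x.2])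
                = P2 (X2 @^-1` [set x | a < x.1 /\ b < x.2]).
Proof.
move=> H a b.
have g1 : good (fun=> 1).
  split; first exact: bounded_measurable_cst.
  move=> t; have := H t.1 t.2; rewrite /expect_expi => -[h1 h2].
  by split; rewrite /agree; under eq_Rintegral do rewrite mul1r;
    under [RHS]eq_Rintegral do rewrite mul1r.
have mI (t : R * R) (c : R) : mult (fun x => (c < t.1 * x.1 + t.2 * x.2)%R%:R : R).
  (* For a sign [sigma], [(sigma + sigma ^+ 2) / 2] is 1 if [sigma = 1] and 0 if [sigma] is 0 or -1:
     the open half-plane. *)
  rewrite (_ : (fun _ => _) = (fun x => 2^-1 * (Num.sg (t.1 * x.1 + t.2 * x.2 - c) +
     Num.sg (t.1 * x.1 + t.2 * x.2 - c) * Num.sg (t.1 * x.1 + t.2 * x.2 - c)))).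
    have ms := mult_halfplane t c.
    by apply: multM; [exact: mult_cst|exact: multD ms (multM ms ms)].
  by apply/funext => x; rewrite -subr_gt0; case: sgrP => _ /=; field.
have mQ := multM (mI (1, 0) a) (mI (0, 1) b).
have [bQ /(_ _ g1)[_ /(_ (0, 0))[]]] := mQ.
pose Q := [set x : R * R | a < x.1 /\ b < x.2].
have mQ' : measurable Q.
  have -> : Q = (fst @^-1` `]a, +oo[%classic) `&` (snd @^-1` `]b, +oo[%classic).
    by apply/seteqP; split => x /=; rewrite !in_itv /= !andbT.
  apply: measurableI; rewrite -[X in measurable X]setTI.
    by apply: measurable_fst => //; exact: measurable_itv.
  by apply: measurable_snd => //; exact: measurable_itv.
have E (x : R * R) : 1 * ((a < (1, 0).1 * x.1 + (1, 0).2 * x.2)%R%:R *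
    (b < (0, 1).1 * x.1 + (0, 1).2 * x.2)%R%:R) * cs (0, 0) x = \1_Q x :> R.
  rewrite /cs /= !mul0r !mul1r addr0 !add0r cos0 mulr1 indicE -natrM mulnb.
  by congr (_%:R); apply/esym; rewrite /Q; congr nat_of_bool; apply/idP/andP; rewrite inE.
rewrite /agree.
under eq_Rintegral do rewrite E; under [X in _ = X]eq_Rintegral do rewrite E.
have mq1 : measurable (X1 @^-1` Q) by rewrite -[X in measurable X]setTI; exact: mX1.
have mq2 : measurable (X2 @^-1` Q) by rewrite -[X in measurable X]setTI; exact: mX2.
have e1 := Rint_indic P1 mq1; have e2 := Rint_indic P2 mq2.
rewrite {}e1 {}e2 => e12 _.
rewrite -[LHS]fineK ?fin_num_measure // -[RHS]fineK ?fin_num_measure //.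
by rewrite e12.
Qed.
End char_fun.

Section mfun_of.
Context {d d'} {T : measurableType d} {T' : measurableType d'}.
Variables (f : T -> T') (mf : measurable_fun setT f).
(** The measurability proof is an argument so that the instance below can rest on it; [distribution]
    then applies to functions whose measurability is only a lemma. *)
Definition mfun_of & measurable_fun setT f := f.
HB.instance Definition _ := isMeasurableFun.Build _ _ _ _ (mfun_of mf) mf.
End mfun_of.

(** * Independence and path spaces *)

Section dynkin_arguments.
Context {R : realType}.

Lemma measurable_preim {d d'} {T : measurableType d} {T' : measurableType d'}
  (f : T -> T') (A : set T') : measurable_fun setT f -> measurable A -> measurable (f @^-1` A).
Proof. by move=> mf mA; rewrite -[X in measurable X]setTI; exact: mf. Qed.

Lemma trivIset_preim {T T' : Type} (f : T -> T') (F : (set T') ^nat) :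
  trivIset setT F -> trivIset setT (fun n => f @^-1` F n).
Proof.
move=> tF; apply/trivIsetP => i j _ _ ij.
by rewrite -preimage_setI; move/trivIsetP : tF => ->; rewrite ?preimage_set0.
Qed.

Lemma same_law_pi {d1 d2 d'} {Omega1 : measurableType d1} {Omega2 : measurableType d2}
    {T : measurableType d'} (P1 : probability Omega1 R) (P2 : probability Omega2 R)
    (X1 : Omega1 -> T) (X2 : Omega2 -> T) (G : set (set T)) :
  measurable_fun setT X1 -> measurable_fun setT X2 ->
  @measurable _ T = <<s G >> -> setI_closed G ->
  (forall A, G A -> P1 (X1 @^-1` A) = P2 (X2 @^-1` A)) -> same_law P1 X1 P2 X2.
Proof.
move=> mX1 mX2 GE GI H A mA.
apply: (@dynkin_induction _ T G (fun A => P1 (X1 @^-1` A) = P2 (X2 @^-1` A))) => //; last by rewrite -GE.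
- by rewrite (preimage_setT X1) (preimage_setT X2) !probability_setT.
- move=> S mS SE.
  have m1 : measurable (X1 @^-1` S) by exact: measurable_preim.
  have m2 : measurable (X2 @^-1` S) by exact: measurable_preim.
  change (P1 (~` (X1 @^-1` S)) = P2 (~` (X2 @^-1` S))).
  by rewrite (probability_setC _ m1) (probability_setC _ m2) SE.
- move=> F mF tF FE; rewrite (preimage_bigcup _ X1) (preimage_bigcup _ X2) !measure_bigcup //.
  + by apply: eq_eseriesr => i _; exact: FE.
  + by move=> i _; exact: measurable_preim.
  + exact: trivIset_preim.
  + by move=> i _; exact: measurable_preim.
  + exact: trivIset_preim.
Qed.

Context {d} {Omega : measurableType d} (P : probability Omega R).
Let pr A := fine (P A).

Lemma fine_probD A B : measurable A -> measurable B -> A `&` B = set0 ->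
  fine (P (A `|` B)) = fine (P A) + fine (P B).
Proof.
by move=> mA mB AB; rewrite measureU // fineD // fin_num_measure.
Qed.

Lemma le_fine_prob A B : measurable A -> measurable B -> A `<=` B ->
  fine (P A) <= fine (P B).
Proof.
by move=> mA mB AB; rewrite fine_le ?fin_num_measure // le_measure ?inE.
Qed.

(* That every [Z n] has the law [nu] makes the approximation of a countable
   union by finite ones uniform in [n]. *)
Let asymptotic_dynkin {d'} {T : measurableType d'} (Z : nat -> Omega -> T)
    (C : nat -> set Omega) (nu : probability T R) (c : R) (G : set (set T)) :
  (forall n, measurable_fun setT (Z n)) -> (forall n, measurable (C n)) ->
  (forall n A, measurable A -> P (Z n @^-1` A) = nu A) ->
  pr (C n) @[n --> \oo] --> c ->
  @measurable _ T = <<s G >> -> setI_closed G ->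
  (forall A, G A -> pr (Z n @^-1` A `&` C n) @[n --> \oo] --> fine (nu A) * c) ->
  forall A, measurable A -> pr (Z n @^-1` A `&` C n) @[n --> \oo] --> fine (nu A) * c.
Proof.
move=> mZ mC Znu Cc GE GI GH A mA.
have mZA n S : measurable S -> measurable (Z n @^-1` S) by exact: measurable_preim.
have mZC n S : measurable S -> measurable (Z n @^-1` S `&` C n).
  by move=> mS; apply: measurableI => //; exact: mZA.
apply: (@dynkin_induction _ T G
  (fun A => pr (Z n @^-1` A `&` C n) @[n --> \oo] --> fine (nu A) * c)) => //; last by rewrite -GE.
- rewrite probability_setT mul1r; under eq_fun do rewrite preimage_setT setTI; exact: Cc.
- move=> S mS cS.
  have -> : fine (nu (~` S)) * c = c - fine (nu S) * c.
    by rewrite probability_setC // fineB ?fin_num_measure // mulrBl mul1r.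
  under eq_fun => n.
    have -> : pr (Z n @^-1` (~` S) `&` C n) = pr (C n) - pr (Z n @^-1` S `&` C n).
      apply/eqP; rewrite eq_sym subr_eq addrC -fine_probD; last first.
      - by rewrite setIACA preimage_setC setICr set0I.
      - by apply: mZC; exact: measurableC.
      - exact: mZC.
      by rewrite -setIUl -preimage_setU setUv preimage_setT setTI.
    over.
  exact: cvgB.
move=> F mF tF FH.
pose U := \bigcup_k F k; pose V K := \big[setU/set0]_(i < K) F i.
have mU : measurable U by exact: bigcupT_measurable.
have mV K : measurable (V K) by exact: bigsetU_measurable.
have VU K : V K `<=` U by exact: bigsetU_bigcup.
have VS K : V K `&` F K = set0.
  rewrite /V big_distrl /= big1 // => i _.
  by move/trivIsetP : tF => /(_ i K Logic.I Logic.I); apply; rewrite neq_ltn ltn_ord.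
have cV K : pr (Z n @^-1` (V K) `&` C n) @[n --> \oo] --> fine (nu (V K)) * c.
  elim: K => [|K IH].
    rewrite /V big_ord0 measure0 /= mul0r.
    under eq_fun do rewrite preimage_set0 set0I /pr measure0 /=.
    exact: cvg_cst.
  rewrite /V big_ord_recr /= -/(V K).
  have -> : fine (nu (V K `|` F K)) = fine (nu (V K)) + fine (nu (F K)).
    by rewrite measureU // fineD // fin_num_measure.
  under eq_fun => n.
    rewrite preimage_setU setIUl /pr fine_probD; [over|exact: mZC|exact: mZC|].
    by rewrite setIACA -preimage_setI VS preimage_set0 set0I.
  by rewrite mulrDl; apply: cvgD; [exact: IH|exact: FH].
have cK : fine (nu (V K)) @[K --> \oo] --> fine (nu U).
  apply: fine_cvg; rewrite fineK ?fin_num_measure //.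
  have -> : U = \bigcup_K V K.
    apply/seteqP; split => [x [k _ Fkx]|x [K _ VKx]]; last exact: VU VKx.
    by exists k.+1 => //; rewrite /V big_ord_recr; right.
  apply: nondecreasing_cvg_mu => //; first exact: bigcupT_measurable.
  by move=> m n mn; apply/subsetPset; exact: subset_bigsetU.
apply/cvgrPdist_lt => e e0.
(* The error splits into the mass of [U] outside [V K], the same defect multiplied by [c], and the
   convergence already known for [V K]; each gets a third. *)
have e30 : 0 < e / 3 by lra.
have cKc : fine (nu (V K)) * c @[K --> \oo] --> fine (nu U) * c by exact: cvgMl.
have [K [K1 K2]] : exists K, `|fine (nu U) - fine (nu (V K))| < e / 3 /\
    `|fine (nu U) * c - fine (nu (V K)) * c| < e / 3.
  move/cvgrPdist_lt : cK => /(_ _ e30) h1; move/cvgrPdist_lt : cKc => /(_ _ e30) h2.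
  by have [K _ HK] := filterI h1 h2; exists K; exact: (HK K (leqnn K)).
have /cvgrPdist_lt /(_ _ e30) h3 := cV K.
have dV : V K `&` (U `\` V K) = set0 by apply/seteqP; split => x // [? []].
apply: filterS h3 => n h3.
have D1 : pr (Z n @^-1` U `&` C n) = pr (Z n @^-1` (V K) `&` C n) + pr (Z n @^-1` (U `\` V K) `&` C n).
  rewrite /pr -fine_probD; last first.
  - by rewrite setIACA -preimage_setI dV preimage_set0 set0I.
  - by apply: mZC; exact: measurableD.
  - exact: mZC.
  by rewrite -setIUl -preimage_setU setDUK.
have D2 : pr (Z n @^-1` (U `\` V K) `&` C n) <= fine (nu U) - fine (nu (V K)).
  have -> : fine (nu U) - fine (nu (V K)) = pr (Z n @^-1` (U `\` V K)).
    rewrite /pr Znu; last exact: measurableD.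
    apply/eqP; rewrite subr_eq addrC -[X in _ == X]fineD ?fin_num_measure //; last exact: measurableD.
    rewrite -measureU //; [by rewrite setDUK|exact: measurableD].
  apply: le_fine_prob; [by apply: mZC; exact: measurableD|by apply: mZA; exact: measurableD|].
  exact: subIsetl.
have D3 : 0 <= pr (Z n @^-1` (U `\` V K) `&` C n) by rewrite fine_ge0.
rewrite D1.
move: K1 K2 h3 D2 D3; rewrite !ltr_norml => /andP[? ?] /andP[? ?] /andP[? ?] ? ?.
by apply/andP; split; lra.
Qed.

(** Two applications of [asymptotic_dynkin], one per factor. The outer one extends [B] with the
    event of [X] fixed; the inner one extends [A] for a fixed [B] in [G2], with the constant
    sequence [X] and the events of [Y n], whose probabilities do not depend on [n]. *)
Lemma asymptotic_independence_pi {d1 d2} {T1 : measurableType d1} {T2 : measurableType d2}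
    (X : Omega -> T1) (Y : nat -> Omega -> T2) (G1 : set (set T1)) (G2 : set (set T2)) :
  measurable_fun setT X -> (forall n, measurable_fun setT (Y n)) ->
  (forall n, same_law P (Y n) P (Y 0%N)) ->
  @measurable _ T1 = <<s G1 >> -> setI_closed G1 ->
  @measurable _ T2 = <<s G2 >> -> setI_closed G2 ->
  (forall A B, G1 A -> G2 B -> fine (P (X @^-1` A `&` Y n @^-1` B)) @[n --> \oo] -->
     fine (P (X @^-1` A)) * fine (P (Y 0%N @^-1` B))) ->
  forall A B, measurable A -> measurable B ->
    fine (P (X @^-1` A `&` Y n @^-1` B)) @[n --> \oo] -->
     fine (P (X @^-1` A)) * fine (P (Y 0%N @^-1` B)).
Proof.
move=> mX mY lY GE1 GI1 GE2 GI2 H A B mA mB.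
under eq_fun do rewrite setIC.
rewrite mulrC.
apply: (@asymptotic_dynkin _ _ Y (fun=> X @^-1` A)
  (distribution P (mfun_of (mY 0%N))) _ G2) => //.
- by move=> n; exact: measurable_preim.
- exact: cvg_cst.
move=> {mB}B GB; have mB : measurable B by rewrite GE2; exact: sub_sigma_algebra.
under eq_fun do rewrite setIC.
rewrite mulrC.
apply: (@asymptotic_dynkin _ _ (fun=> X) (fun n => Y n @^-1` B)
  (distribution P (mfun_of mX)) _ G1) => //.
- by move=> n; exact: measurable_preim.
- by under eq_fun do rewrite /pr lY //; exact: cvg_cst.
- by move=> {mA}A GA; exact: H.
Qed.

(** The case of a constant sequence [Y]: uniqueness of the limit turns the asymptotic product
    formula into an equality. *)
Lemma independence_pi {d1 d2} {T1 : measurableType d1} {T2 : measurableType d2}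
    (X : Omega -> T1) (Y : Omega -> T2) (G1 : set (set T1)) (G2 : set (set T2)) :
  measurable_fun setT X -> measurable_fun setT Y ->
  @measurable _ T1 = <<s G1 >> -> setI_closed G1 ->
  @measurable _ T2 = <<s G2 >> -> setI_closed G2 ->
  (forall A B, G1 A -> G2 B ->
     P (X @^-1` A `&` Y @^-1` B) = (P (X @^-1` A) * P (Y @^-1` B))%E) ->
  forall A B, measurable A -> measurable B ->
    P (X @^-1` A `&` Y @^-1` B) = (P (X @^-1` A) * P (Y @^-1` B))%E.
Proof.
move=> mX mY GE1 GI1 GE2 GI2 H A B mA mB.
have mXA C : measurable C -> measurable (X @^-1` C) by exact: measurable_preim.
have mYA C : measurable C -> measurable (Y @^-1` C) by exact: measurable_preim.
have := @asymptotic_independence_pi _ _ _ _ X (fun=> Y) G1 G2 mX (fun=> mY)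
  (fun _ _ _ => erefl) GE1 GI1 GE2 GI2.
have H' C D : G1 C -> G2 D -> fine (P (X @^-1` C `&` Y @^-1` D)) @[_ --> \oo] -->
    fine (P (X @^-1` C)) * fine (P (Y @^-1` D)).
  move=> GC GD.
  have mC : measurable C by rewrite GE1; exact: sub_sigma_algebra.
  have mD : measurable D by rewrite GE2; exact: sub_sigma_algebra.
  rewrite H // fineM ?fin_num_measure //; [exact: cvg_cst|exact: mXA|exact: mYA].
move=> /(_ H' A B mA mB) /(cvg_unique (@norm_hausdorff _ _)) /(_ (cvg_cst _)) E.
rewrite -[LHS]fineK ?fin_num_measure //; last by apply: measurableI; [exact: mXA|exact: mYA].
by rewrite -E EFinM !fineK ?fin_num_measure //; [exact: mYA|exact: mXA].
Qed.
End dynkin_arguments.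

(** * Path spaces and cylinder sets *)

Section path_space.
Context {R : realType} {I : choiceType} {d'} {T : measurableType d'}.

(** A condition is attached to every coordinate and is trivial off the finite list [s], so
    intersections and substitutions act coordinatewise. The generated sigma-algebra is the product
    one. *)
Definition cylinder : set (set (I -> T)) :=
  [set A | exists (s : seq I) (B : I -> set T), [/\ forall i, measurable (B i),
     forall i, i \notin s -> B i = setT & A = [set x | forall i, B i (x i)]]].

Definition path_space := g_sigma_algebraType cylinder.
HB.instance Definition _ := Measurable.on path_space.

Lemma measurable_path_spaceE : @measurable _ path_space = <<s cylinder >>.
Proof. by []. Qed.

Lemma cylinder_setI : setI_closed cylinder.
Proof.
move=> _ _ [s [B [mB sB ->]]] [s' [B' [mB' sB' ->]]].
exists (s ++ s'), (fun i => B i `&` B' i); split.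
- by move=> i; exact: measurableI.
- by move=> i; rewrite mem_cat negb_or => /andP[/sB-> /sB'->]; rewrite setIT.
- apply/seteqP; split => x /= => [[h h'] i|h]; first by split.
  by split => i; have [] := h i.
Qed.

Lemma measurable_coord (i : I) : measurable_fun setT (fun x : path_space => x i).
Proof.
move=> _ B mB; rewrite setTI; apply: sub_sigma_algebra.
exists [:: i], (fun j => if j == i then B else setT); split.
- by move=> j; case: ifP.
- by move=> j; rewrite inE => /negbTE ->.
- apply/seteqP; split => x /= => [h j|/(_ i)]; last by rewrite eqxx.
  by case: eqP => // ->.
Qed.

Lemma forall_bigcap {U : Type} (f : I -> U -> T) (s : seq I) (B : I -> set T) :
  (forall i, i \notin s -> B i = setT) ->
  [set w | forall i, B i (f i w)] = \bigcap_(i in [set` s]) (f i @^-1` B i).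
Proof.
move=> sB; apply/seteqP; split => w /= => [h i _|h i]; first exact: h.
by have [/h//|/sB ->] := boolP (i \in s).
Qed.

Lemma bigcap_seq_measurable {d} {U : measurableType d} (s : seq I) (F : I -> set U) :
  (forall i, measurable (F i)) -> measurable (\bigcap_(i in [set` s]) F i).
Proof. by move=> mF; rewrite bigcap_seq; apply: bigsetI_measurable. Qed.

Lemma measurable_path {d} {U : measurableType d} (f : U -> path_space) :
  (forall i, measurable_fun setT (fun w => f w i)) -> measurable_fun setT f.
Proof.
move=> mf; apply: (@measurability _ _ U path_space setT f cylinder) => //.
move=> _ [_ [s [B [mB sB ->]]] <-]; rewrite setTI.
change (measurable [set w | forall i, B i (f w i)]).
rewrite (forall_bigcap (fun i w => f w i) sB); apply: bigcap_seq_measurable => i.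
exact: measurable_preim.
Qed.

Lemma independent_forall {d} {Omega : measurableType d} (P : probability Omega R)
    (X : I -> Omega -> T) (s : seq I) (B : I -> set T) :
  mutually_independent P X -> uniq s -> (forall i, measurable (B i)) ->
  (forall i, i \notin s -> B i = setT) ->
  P [set w | forall i, B i (X i w)] = (\prod_(i <- s) P (X i @^-1` B i))%E.
Proof. by move=> iX us mB sB; rewrite (forall_bigcap X sB); exact: iX. Qed.

Definition path_of {d} {Omega : measurableType d} (X : I -> Omega -> T) (w : Omega) : path_space :=
  fun i => X i w.

Lemma measurable_path_of {d} {Omega : measurableType d} (X : I -> Omega -> T) :
  (forall i, measurable_fun setT (X i)) -> measurable_fun setT (path_of X).
Proof. by move=> mX; apply: measurable_path. Qed.

Lemma same_law_path {d1 d2} {Omega1 : measurableType d1} {Omega2 : measurableType d2}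
    (P1 : probability Omega1 R) (P2 : probability Omega2 R)
    (X : I -> Omega1 -> T) (Y : I -> Omega2 -> T) :
  (forall i, measurable_fun setT (X i)) -> (forall i, measurable_fun setT (Y i)) ->
  mutually_independent P1 X -> mutually_independent P2 Y ->
  (forall i, same_law P1 (X i) P2 (Y i)) ->
  same_law P1 (path_of X) P2 (path_of Y).
Proof.
move=> mX mY iX iY XY; apply: (same_law_pi (G := cylinder : set (set path_space))).
- exact: measurable_path_of.
- exact: measurable_path_of.
- exact: measurable_path_spaceE.
- exact: cylinder_setI.
move=> _ [s [B [mB sB ->]]].
have sB' i : i \notin undup s -> B i = setT by rewrite mem_undup; exact: sB.
rewrite /preimage /= (independent_forall iX (undup_uniq s) mB sB').
rewrite (independent_forall iY (undup_uniq s) mB sB').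
by apply: eq_bigr => i _; exact: XY.
Qed.

Section blocks.
Context {d} {Omega : measurableType d} (P : probability Omega R).
Variables (X : I -> Omega -> T) (kappa : pred I) (t0 : T).
Hypothesis mX : forall i, measurable_fun setT (X i).
Hypothesis iX : mutually_independent P X.

(** Coordinates outside a block are frozen at [t0] instead of dropped, so both blocks take values in
    the same path space. *)
Definition block_in : I -> Omega -> T := fun i => if kappa i then X i else cst t0.
Definition block_out : I -> Omega -> T := fun i => if kappa i then cst t0 else X i.

Lemma measurable_block_in i : measurable_fun setT (block_in i).
Proof. by rewrite /block_in; case: ifP. Qed.

Lemma measurable_block_out i : measurable_fun setT (block_out i).
Proof. by rewrite /block_out; case: ifP. Qed.

(** A condition on a frozen coordinate holds always or never, according to [t0]. Cylinder events of
    both blocks thus become cylinder events of [X], and at each index one of the two conditions is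
    [setT] or [set0], so the product formula factors index by index. *)
Lemma independent_blocks : independent_pair P (path_of block_in) (path_of block_out).
Proof.
move=> A B mA mB; apply: (independence_pi (G1 := cylinder : set (set path_space)) (G2 := cylinder : set (set path_space))) => //.
- exact/measurable_path_of/measurable_block_in.
- exact/measurable_path_of/measurable_block_out.
- exact: cylinder_setI.
- exact: cylinder_setI.
move=> {mA mB A B} _ _ [s1 [B1 [m1 e1 ->]]] [s2 [B2 [m2 e2 ->]]].
pose D1 i := if kappa i then B1 i else if t0 \in B1 i then setT else set0.
pose D2 i := if kappa i then (if t0 \in B2 i then setT else set0) else B2 i.
have mD1 i : measurable (D1 i) by rewrite /D1; do 2 case: ifP => // _.
have mD2 i : measurable (D2 i) by rewrite /D2; do 2 case: ifP => // _.
pose s := undup (s1 ++ s2).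
have D1T i : i \notin s -> D1 i = setT.
  rewrite mem_undup mem_cat negb_or => /andP[/e1 E _]; rewrite /D1 E.
  by rewrite in_setT; case: ifP.
have D2T i : i \notin s -> D2 i = setT.
  rewrite mem_undup mem_cat negb_or => /andP[_ /e2 E]; rewrite /D2 E.
  by rewrite in_setT; case: ifP.
have E1 : path_of block_in @^-1` [set x | forall i, B1 i (x i)] =
    [set w | forall i, D1 i (X i w)].
  have aux i w : B1 i (block_in i w) <-> D1 i (X i w).
    rewrite /block_in /D1; case: ifP => // _; case: ifPn; first by rewrite inE.
    by rewrite notin_setE.
  by apply/seteqP; split => w /= h i; apply/aux/h.
have E2 : path_of block_out @^-1` [set x | forall i, B2 i (x i)] =
    [set w | forall i, D2 i (X i w)].
  have aux i w : B2 i (block_out i w) <-> D2 i (X i w).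
    rewrite /block_out /D2; case: ifP => // _; case: ifPn; first by rewrite inE.
    by rewrite notin_setE.
  by apply/seteqP; split => w /= h i; apply/aux/h.
have E12 : path_of block_in @^-1` [set x | forall i, B1 i (x i)] `&`
    path_of block_out @^-1` [set x | forall i, B2 i (x i)] =
    [set w | forall i, (D1 i `&` D2 i) (X i w)].
  rewrite E1 E2; apply/seteqP; split => w /= => [[h h'] i|h]; first by split.
  by split => i; have [] := h i.
have us : uniq s by exact: undup_uniq.
rewrite E12 (independent_forall (B := fun i => D1 i `&` D2 i) iX us); last 2 first.
- by move=> i; exact: measurableI.
- by move=> i si; rewrite D1T // D2T // setIT.
rewrite E1 E2 (independent_forall iX us mD1 D1T) (independent_forall iX us mD2 D2T).
rewrite -big_split /=; apply: eq_bigr => i _.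
rewrite /D1 /D2; case: ifP => _.
  by case: ifP => _; rewrite ?setIT ?setI0 ?preimage_set0 ?measure0 ?mule0 // preimage_setT probability_setT mule1.
by case: ifP => _; rewrite ?setTI ?set0I ?preimage_set0 ?measure0 ?mul0e // preimage_setT probability_setT mul1e.
Qed.
End blocks.

End path_space.

Lemma independent_reindex {R : realType} {d d'} {Omega : measurableType d}
    {T : measurableType d'} (P : probability Omega R) {I J : choiceType}
    (X : I -> Omega -> T) (f : J -> I) :
  injective f -> mutually_independent P X -> mutually_independent P (X \o f).
Proof.
move=> fI iX s B us mB.
(* [B] is carried along [f]: injectivity makes the chosen preimage the right one, and indices
   outside the range carry no condition. *)
pose C i := if pselect (exists j, f j = i) is left e then B (projT1 (cid e)) else setT.
have Cf j : C (f j) = B j.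
  rewrite /C; case: pselect => [e|]; last by case; exists j.
  by case: cid => j' /= /fI ->.
have mC i : measurable (C i) by rewrite /C; case: pselect.
have um : uniq (map f s) by rewrite map_inj_uniq.
have := iX (map f s) C um mC; rewrite big_map => H.
rewrite (eq_bigr (fun j => P (X (f j) @^-1` C (f j)))); last by move=> j _; rewrite Cf.
rewrite -H; congr (P _); apply/seteqP; split => w h.
  by move=> _ /mapP[j js ->]; rewrite /= Cf; exact: h.
by move=> j js; have := h (f j) (map_f f js); rewrite /= Cf.
Qed.

(** * Pairing and shifting independent sequences *)

Section pairs_and_shifts.
Context {R : realType} {d d'} {Omega : measurableType d} {T : measurableType d'}.
Variable P : probability Omega R.

(** By induction on the list of indices: the head reads only the coordinates [f j0] and [g j0],
    which the rest avoids, so the two are functions of complementary blocks. *)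
Lemma independent_pairs {I J : choiceType} {d''} {T' : measurableType d''}
    (X : I -> Omega -> T) (f g : J -> I) (h : T * T -> T') :
  (forall i, measurable_fun setT (X i)) -> mutually_independent P X ->
  injective f -> injective g -> (forall i j, f i != g j) ->
  measurable_fun setT h ->
  mutually_independent P (fun j w => h (X (f j) w, X (g j) w)).
Proof.
move=> mX iX fI gI fg mh s B.
pose Z j w := h (X (f j) w, X (g j) w).
elim: s => [_ _|j0 s IH /= /andP[j0s us] mB].
  by rewrite big_nil bigcap_seq big_nil probability_setT.
rewrite big_cons -IH //.
have -> : \bigcap_(i in [set` j0 :: s]) (Z i @^-1` B i) =
    Z j0 @^-1` B j0 `&` \bigcap_(i in [set` s]) (Z i @^-1` B i).
  apply/seteqP; split => w /= => [H|[H0 H] j /=]; last by rewrite inE => /predU1P[->|/H].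
  by split => [|j js]; apply: H; rewrite /= inE ?eqxx // js orbT.
pose kappa := [pred i | (i == f j0) || (i == g j0)].
pose A1 := [set x : @path_space I _ T | B j0 (h (x (f j0), x (g j0)))].
pose A2 := \bigcap_(j in [set` s]) [set x : @path_space I _ T | B j (h (x (f j), x (g j)))].
have mA (j : J) : measurable [set x : @path_space I _ T | B j (h (x (f j), x (g j)))].
  apply: (@measurable_preim _ _ (@path_space I _ T) T' (fun x => h (x (f j), x (g j))) (B j)) => //.
  by apply: (measurableT_comp mh); apply: measurable_fun_pair; exact: measurable_coord.
have mA2 : measurable A2 by exact: bigcap_seq_measurable.
pose t0 : T := point.
have := independent_blocks kappa t0 mX iX (mA j0) mA2.
have -> : path_of (block_in X kappa t0) @^-1` [set x | B j0 (h (x (f j0), x (g j0)))] =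
    Z j0 @^-1` B j0.
  by apply/seteqP; split => w; rewrite /= /path_of /block_in /= !eqxx orbT.
have -> : path_of (block_out X kappa t0) @^-1` A2 = \bigcap_(j in [set` s]) (Z j @^-1` B j).
  have aux w j : j \in s -> B j (h (path_of (block_out X kappa t0) w (f j),
      path_of (block_out X kappa t0) w (g j))) <-> (Z j @^-1` B j) w.
    move=> js; rewrite /path_of /block_out /=.
    have jj0 : j != j0 by apply: contraNneq j0s => <-.
    by rewrite (inj_eq fI) (inj_eq gI) (negbTE jj0) (negbTE (fg _ _)) eq_sym (negbTE (fg _ _)).
  by apply/seteqP; split => w H j js; apply/(aux w j js); exact: (H j js).
by [].
Qed.

Lemma iid_shift_law (X : int -> Omega -> T) (n : int) :
  (forall i, measurable_fun setT (X i)) -> mutually_independent P X ->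
  (forall i, same_law P (X i) P (X 0)) ->
  same_law P (path_of (fun i => X (i + n))) P (path_of X).
Proof.
move=> mX iX lX; apply: same_law_path => //.
  exact: (independent_reindex (addIr n) iX).
by move=> i A mA; rewrite lX // -(lX i).
Qed.

(** For cylinders the two events read disjoint finite sets of coordinates once the shift is large,
    so the limiting value is attained exactly; [asymptotic_independence_pi] extends this to all
    events. *)
Lemma iid_shift_mixing (X : int -> Omega -> T) :
  (forall i, measurable_fun setT (X i)) -> mutually_independent P X ->
  (forall i, same_law P (X i) P (X 0)) ->
  forall A B, measurable A -> measurable B ->
    fine (P (path_of X @^-1` A `&` path_of (fun i => X (i + n%:Z)) @^-1` B)) @[n --> \oo] -->
     fine (P (path_of X @^-1` A)) * fine (P (path_of X @^-1` B)).
Proof.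
move=> mX iX lX A B mA mB.
(* The second factor becomes the law of the path shifted by 0, the initial term of the sequence in
   [asymptotic_independence_pi]. *)
rewrite -(iid_shift_law 0 mX iX lX mB).
apply: (@asymptotic_independence_pi _ _ _ _ _ _ _ _ (path_of X) (fun n => path_of (fun i => X (i + n%:Z)))
   (cylinder : set (set path_space)) (cylinder : set (set path_space))) => //.
- exact: measurable_path_of.
- by move=> n; apply: measurable_path_of.
- by move=> n C mC; rewrite !iid_shift_law.
- exact: cylinder_setI.
- exact: cylinder_setI.
move=> {mA mB}{}A {}B cA cB.
have mB : measurable (B : set path_space) by exact: sub_sigma_algebra.
have mA : measurable (A : set path_space) by exact: sub_sigma_algebra.
move: cA cB => [s1 [B1 [m1 e1 AE]]] [s2 [B2 [m2 e2 BE]]].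
(* If [i] is in [s2] and [i + n] in [s1], then [n <= |i + n| + |i| <= N]; any [n > N] therefore
   separates the index sets. *)
pose N := (\sum_(i <- s1) absz i + \sum_(j <- s2) absz j)%N.
apply: cvg_near_cst; exists N.+1 => // n /= Nn.
pose t0 : T := point; pose kappa := [pred i | i \in s1].
have mC : measurable [set x : @path_space int _ T | B (fun i => x (i + n%:Z))].
  apply: (@measurable_preim _ _ (@path_space int _ T) path_space (fun x i => x (i + n%:Z)) B) => //.
  by apply: measurable_path => i; exact: measurable_coord.
have := independent_blocks kappa t0 mX iX mA mC.
have -> : path_of (block_in X kappa t0) @^-1` A = path_of X @^-1` A.
  have aux w i : B1 i (block_in X kappa t0 i w) <-> B1 i (X i w).
    by rewrite /block_in /=; case: ifPn => // /e1 ->.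
  by rewrite AE; apply/seteqP; split => w H i; apply/aux; exact: H.
have -> : path_of (block_out X kappa t0) @^-1` [set x | B (fun i => x (i + n%:Z))] =
    path_of (fun i => X (i + n%:Z)) @^-1` B.
  have aux w i : B2 i (block_out X kappa t0 (i + n%:Z) w) <-> B2 i (X (i + n%:Z) w).
    have [is2|/e2 -> //] := boolP (i \in s2).
    rewrite /block_out /=; case: ifP => // is1.
    have h1 : (absz (i + n%:Z)%R <= \sum_(i <- s1) absz i)%N.
      by rewrite (big_rem _ is1) /= leq_addr.
    have h2 : (absz i <= \sum_(j <- s2) absz j)%N by rewrite (big_rem _ is2) /= leq_addr.
    by move: Nn h1 h2; rewrite /N; lia.
  by rewrite BE; apply/seteqP; split => w H i; apply/aux; exact: H.
move=> ->; rewrite fineM ?fin_num_measure //.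
- by congr (_ * fine _); rewrite (iid_shift_law n mX iX lX mB) (iid_shift_law 0 mX iX lX mB).
- by apply: measurable_preim mA; exact: measurable_path_of.
- by apply: measurable_preim mB; exact: measurable_path_of.
Qed.
End pairs_and_shifts.

Lemma measurable_fun_ltR {R : realType} {d} {U : measurableType d} (f : U -> R) :
  (forall a : R, measurable [set w | f w < a]) -> measurable_fun setT f.
Proof.
move=> H; apply: (@measurability _ _ U (measurableTypeR R) setT f _ (RGenInftyO.measurableE R)).
move=> _ [_ [a ->] <-]; rewrite setTI.
by rewrite (_ : _ @^-1` _ = [set w | f w < a]).
Qed.

Lemma rnorm_tri {R : realType} {k : scalar_kind} {E : normedModType (scalars R k)} (x y z : E) :
  rnorm (x - z) <= rnorm (x - y) + rnorm (y - z).
Proof. by rewrite (le_trans _ (rnormD _ _))// addrA subrK. Qed.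

Lemma nat_inv_lt {R : realType} (e : R) : 0 < e -> exists n, n.+1%:R^-1 < e.
Proof.
move=> e0; exists (Num.truncn e^-1); rewrite invf_plt ?posrE //; exact: truncnS_gt.
Qed.

Lemma addrB_split {V : zmodType} (a b c d x : V) :
  a + b - x = (c + d - x) + ((a - c) + (b - d)).
Proof. by rewrite (addrACA a) -opprD [RHS]addrC addrA subrK. Qed.

(** * Borel measurability in separable spaces *)

Section borel_normed.
Context {R : realType} {k : scalar_kind} {E : normedModType (scalars R k)}.
Hypothesis sepE : separable E.
Context {d} {U : measurableType d}.
Implicit Types f g : U -> borel E.

Lemma separable_seq : exists D : nat -> E, forall x (e : R), 0 < e -> exists n, rnorm (x - D n) < e.
Proof.
have [D cD dD] := sepE.
have /countable_injP[h hI] := cD.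
pose s n : E := if pselect (exists2 x, D x & h x = n) is left e then projT1 (cid2 e) else 0.
exists s => x e e0.
have [y [/= yD xy]] : ([set y | rnorm (x - y) < e] `&` D) !=set0.
  rewrite setIC; rewrite setIC; have := dD (interior [set y | rnorm (x - y) < e]).
  case => [||y [/interior_subset yx Dy]].
  - exists x; apply/nbhs_rnormP; exists e => //.
  - exact: open_interior.
  - by exists y.
exists (h y); rewrite /s; case: pselect => [e'|]; last by case; exists y.
by case: cid2 => z Dz /= hz; rewrite (hI z y) ?inE.
Qed.

Lemma open_rnorm_lt (x : E) (a : R) : open [set y : E | rnorm (y - x) < a].
Proof.
rewrite openE => y /= yx; apply/nbhs_rnormP; exists (a - rnorm (y - x)); first by rewrite subr_gt0.
move=> z zy /=; apply: le_lt_trans (rnorm_tri z y x) _.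
by rewrite (rnormB z) -ltrBrDr.
Qed.

Lemma measurable_rnormB f (x : E) : measurable_fun setT f ->
  measurable_fun setT (fun w => rnorm ((f w : E) - x)).
Proof.
move=> mf; apply: measurable_fun_ltR => a.
change (measurable (f @^-1` [set y : E | rnorm (y - x) < a])).
apply: measurable_preim => //.
apply: sub_sigma_algebra; exact: open_rnorm_lt.
Qed.

(** By separability an open set is the countable union of the balls of radius [n.+1%:R^-1] around
    the points [D m] that it contains, and the preimages of these balls are sublevel sets of the
    given distance functions. *)
Lemma measurable_borelP f :
  (forall x, measurable_fun setT (fun w => rnorm ((f w : E) - x))) -> measurable_fun setT f.
Proof.
move=> mf; apply: (@measurability _ _ U (borel E) setT f (@open E)) => //.
move=> _ [V oV <-]; rewrite setTI.
have [D HD] := separable_seq.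
pose S (nm : nat * nat) := [set w | rnorm (f w - D nm.2) < nm.1.+1%:R^-1] `&`
  [set w | forall y, rnorm (y - D nm.2) < nm.1.+1%:R^-1 -> V y].
have -> : f @^-1` V = \bigcup_nm S nm.
  apply/seteqP; split => w /= => [Vw|[nm _ []] /= /[swap] H]; last exact: H.
  have /nbhs_rnormP[e e0 eV] : nbhs (f w : E) V by apply: open_nbhs_nbhs.
  (* Two radii, from the point to [D m] and from [D m] to [y], must fit into [e]. *)
  have [n ne] : exists n, n.+1%:R^-1 < e / 2 by apply: nat_inv_lt; lra.
  have [m fm] := HD (f w) n.+1%:R^-1 ltac:(by rewrite invr_gt0).
  exists (n, m) => //; split => //= y ym.
  apply: eV; apply: le_lt_trans (rnorm_tri _ (D m) _) _.
  rewrite [rnorm (D m - y)]rnormB; apply: lt_trans (ltrD fm ym) _.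
  by rewrite [ltRHS]splitr ltrD.
apply: countable_bigcupT_measurable => // -[n m]; apply: measurableI.
  rewrite (_ : mkset _ = (fun w => rnorm (f w - D m)) @^-1` `]-oo, n.+1%:R^-1[%classic).
    exact: measurable_preim.
  by apply/seteqP; split => w /=; rewrite in_itv.
have [H|H] := pselect (forall y, rnorm (y - D m) < n.+1%:R^-1 -> V y).
  by rewrite (_ : mkset _ = setT) //; apply/seteqP; split.
by rewrite (_ : mkset _ = set0) //; apply/seteqP; split.
Qed.

(** Separability replaces the pair [(f w, g w)] by a pair of points of a countable set, so that
    [f w + g w] lying in an open ball becomes a countable union of events, each constraining [f] and
    [g] separately. *)
Lemma measurable_borelD f g : measurable_fun setT f -> measurable_fun setT g ->
  measurable_fun setT (fun w => (f w : E) + (g w : E) : borel E).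
Proof.
move=> mf mg; apply: measurable_borelP => x; apply: measurable_fun_ltR => a.
have [D HD] := separable_seq.
have mlt (h : U -> borel E) (y : E) (b : R) : measurable_fun setT h -> measurable [set w | rnorm ((h w : E) - y) < b].
  move=> mh; rewrite (_ : mkset _ = (fun w => rnorm ((h w : E) - y)) @^-1` `]-oo, b[%classic).
    by apply: measurable_preim => //; exact: measurable_rnormB.
  by apply/seteqP; split => w /=; rewrite in_itv.
pose S (nm : nat * (nat * nat)) :=
  ([set w | rnorm (f w - D nm.2.1) < nm.1.+1%:R^-1] `&` [set w | rnorm (g w - D nm.2.2) < nm.1.+1%:R^-1]) `&`
  [set w | rnorm (D nm.2.1 + D nm.2.2 - x) + 2 * nm.1.+1%:R^-1 < a].
have -> : [set w | rnorm (f w + g w - x) < a] = \bigcup_nm S nm.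
  apply/seteqP; split => w /=.
    move=> fga; pose e := a - rnorm (f w + g w - x).
    have e0 : 0 < e by rewrite subr_gt0.
    (* Replacing [f w] and [g w] by [D p] and [D q] costs twice the radius, and the margin in [S]
       costs it twice more. *)
    have [n ne] : exists n, n.+1%:R^-1 < e / 4 by apply: nat_inv_lt; lra.
    have n0 : 0 < n.+1%:R^-1 :> R by rewrite invr_gt0.
    have [p fp] := HD (f w) _ n0; have [q gq] := HD (g w) _ n0.
    exists (n, (p, q)) => //; split => //=.
    have -> : D p + D q - x = (f w + g w - x) + ((D p - f w) + (D q - g w)). exact: addrB_split.
    rewrite -ltrBrDr (le_lt_trans (rnormD _ _))//.
    have h1 := rnormD (D p - f w) (D q - g w).
    rewrite (rnormB _ (f w)) (rnormB _ (g w)) in h1.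
    have h2 : rnorm (D p - f w + (D q - g w)) < 2 * n.+1%:R^-1.
      by rewrite mulr_natl mulr2n; exact: le_lt_trans h1 (ltrD fp gq).
    have key (i X Y : R) : i < (a - X) / 4 -> Y < 2 * i -> X + Y < a - 2 * i by move=> ? ?; lra.
    exact: key ne h2.
  move=> [[n [p q]] _ [[/= h1 h2] h3]].
  have -> : f w + g w - x = (D p + D q - x) + ((f w - D p) + (g w - D q)). exact: addrB_split.
  rewrite (le_lt_trans (rnormD _ _))//.
  have h4 : rnorm (f w - D p + (g w - D q)) < 2 * n.+1%:R^-1.
    by rewrite mulr_natl mulr2n; exact: le_lt_trans (rnormD _ _) (ltrD h1 h2).
  have key (X Y i : R) : X + 2 * i < a -> Y < 2 * i -> X + Y < a by move=> ? ?; lra.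
  exact: key h3 h4.
apply: countable_bigcupT_measurable => // -[n [p q]]; apply: measurableI.
  by apply: measurableI; exact: mlt.
by rewrite /=; have [h|h] := boolP (rnorm (D p + D q - x) + 2 * n.+1%:R^-1 < a);
  [rewrite (_ : mkset _ = setT) //|rewrite (_ : mkset _ = set0) //]; apply/seteqP; split => // w /=; rewrite ?h // (negbTE h).
Qed.

Lemma measurable_borel_cst (x : E) : measurable_fun setT (fun _ : U => x : borel E).
Proof. exact: measurable_cst. Qed.

Lemma measurable_borel_sum (I : Type) (r : seq I) (F : I -> U -> borel E) :
  (forall i, measurable_fun setT (F i)) ->
  measurable_fun setT (fun w => \sum_(i <- r) (F i w : E) : borel E).
Proof.
move=> mF; elim: r => [|i r IH].
  by under eq_fun do rewrite big_nil; exact: measurable_borel_cst.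
by under eq_fun do rewrite big_cons; apply: measurable_borelD.
Qed.

Lemma measurable_borel_cvg (F : nat -> U -> borel E) f :
  (forall n, measurable_fun setT (F n)) ->
  (forall w, (F n w : E) @[n --> \oo] --> (f w : E)) -> measurable_fun setT f.
Proof.
move=> mF Ff; apply: measurable_borelP => x.
apply: (@measurable_fun_cvg _ _ R setT (fun n w => rnorm (F n w - x))).
  by move=> n; exact: measurable_rnormB.
move=> w _; apply/cvgrPdist_lt => e e0.
have /cvg_rnormP/(_ e e0) := Ff w; apply: filterS => n.
by apply: le_lt_trans; rewrite (le_trans (ler_rnormB _ _))// opprB addrA subrK.
Qed.

Lemma measurable_rnorm f : measurable_fun setT f -> measurable_fun setT (fun w => rnorm (f w : E)).
Proof. by move=> /measurable_rnormB-/(_ 0); under eq_fun do rewrite subr0. Qed.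
End borel_normed.

Section lipschitz.
Context {R : realType} {k : scalar_kind} {E F : normedModType (scalars R k)}.

Lemma lipschitz_measurable (h : E -> F) (C : R) :
  (forall x y, rnorm (h x - h y) <= C * rnorm (x - y)) ->
  measurable_fun setT (h : borel E -> borel F).
Proof.
move=> hC; apply: (@measurability _ _ (borel E) (borel F) setT h (@open F)) => //.
move=> _ [V oV <-]; rewrite setTI; apply: sub_sigma_algebra.
rewrite openE => x /= Vhx; apply/nbhs_rnormP.
have /nbhs_rnormP[e e0 eV] : nbhs (h x) V by exact: open_nbhs_nbhs.
(* [C] may be zero or negative; division needs a positive constant. *)
pose C' := Num.max C 1.
have C'0 : 0 < C' by rewrite lt_max ltr01 orbT.
exists (e / C'); first by rewrite divr_gt0.
move=> y xy; apply: eV; apply: le_lt_trans (hC _ _) _.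
apply: (@le_lt_trans _ _ (C' * rnorm (x - y))).
  by rewrite ler_wpM2r ?rnorm_ge0 // le_max lexx.
by rewrite mulrC -ltr_pdivlMr.
Qed.

Lemma lipschitz_continuous (h : E -> F) (C : R) :
  (forall x y, rnorm (h x - h y) <= C * rnorm (x - y)) -> continuous h.
Proof.
move=> hC x V /nbhs_rnormP[e e0 eV]; apply/nbhs_rnormP.
pose C' := Num.max C 1.
have C'0 : 0 < C' by rewrite lt_max ltr01 orbT.
exists (e / C'); first by rewrite divr_gt0.
move=> y xy; apply: eV; apply: le_lt_trans (hC _ _) _.
apply: (@le_lt_trans _ _ (C' * rnorm (x - y))).
  by rewrite ler_wpM2r ?rnorm_ge0 // le_max lexx.
by rewrite mulrC -ltr_pdivlMr.
Qed.

Lemma rnorm_scalelB (c c' : scalars R k) (x : E) :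
  rnorm (c *: x - c' *: x) = kabs (c - c') * rnorm x.
Proof. by rewrite -scalerBl rnormZ. Qed.
End lipschitz.

(** * Borel sets of the scalar field *)

Section scalar_borel.
Context (R : realType) (k : scalar_kind).
Local Notation K := (scalars R k).

(** [K^o] is the scalar field as a normed space over itself; through it the results on [E] apply to
    scalars. *)
Lemma rnorm_regular (x : K) : rnorm (x : K^o) = kabs x.
Proof. by []. Qed.

Lemma of_realB (a b : R) : of_real k (a - b) = of_real k a - of_real k b.
Proof. by rewrite of_realD of_realN. Qed.

Lemma kabs_re_im_decomp (a b : R) : kabs (of_real k a + imag_unit R k * of_real k b) <= `|a| + `|b|.
Proof.
rewrite (le_trans (kabsD _ _))// kabsM !kabs_of_real lerD2l.
by rewrite ler_piMl ?kabs_imag_unit.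
Qed.

Lemma separable_scalars : separable (K^o : normedModType K).
Proof.
pose f (q : rat * rat) : K^o := of_real k (ratr q.1) + imag_unit R k * of_real k (ratr q.2).
exists (range f); first exact: sub_countable (card_image_le _ _) (countableP _).
move=> O [x Ox] oO.
have /nbhs_rnormP[e e0 eO] : nbhs (x : K^o) O by exact: open_nbhs_nbhs.
have ratd (a : R) : exists q : rat, `|a - ratr q| < e / 2.
  have [|q] := @rat_in_itvoo R (a - e / 2) (a + e / 2); first lra.
  by rewrite in_itv /= => /andP[h1 h2]; exists q; rewrite ltr_norml; apply/andP; split; lra.
have [p hp] := ratd (re_part x); have [q hq] := ratd (im_part x).
exists (f (p, q)); split; last by exists (p, q).
apply: eO; rewrite rnorm_regular.
have -> : x - f (p, q) = of_real k (re_part x - ratr p) + imag_unit R k * of_real k (im_part x - ratr q) :> K.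
  by rewrite [X in X - _](re_im_decomp x) /f /= opprD addrACA -mulrBr -!of_realB.
by rewrite (le_lt_trans (kabs_re_im_decomp _ _))// [ltRHS]splitr ltrD.
Qed.

Lemma measurable_re_part : measurable_fun setT (@re_part R k : borel K -> R).
Proof.
apply: measurable_fun_ltR => a; apply: sub_sigma_algebra.
rewrite openE => x /= xa; apply/(@nbhs_rnormP R k (K^o)); exists (a - re_part x).
  by rewrite subr_gt0.
move=> y /=; rewrite rnorm_regular => h.
have := re_part_le (x - y); rewrite re_partD re_partN => /le_lt_trans/(_ h).
by rewrite ltr_norml => /andP[h1 _]; lra.
Qed.

Lemma measurable_im_part : measurable_fun setT (@im_part R k : borel K -> R).
Proof.
apply: measurable_fun_ltR => a; apply: sub_sigma_algebra.
rewrite openE => x /= xa; apply/(@nbhs_rnormP R k (K^o)); exists (a - im_part x).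
  by rewrite subr_gt0.
move=> y /=; rewrite rnorm_regular => h.
have := im_part_le (x - y); rewrite im_partD im_partN => /le_lt_trans/(_ h).
by rewrite ltr_norml => /andP[h1 _]; lra.
Qed.

Lemma measurable_of_real : measurable_fun setT (of_real k : R -> borel K).
Proof.
apply: (@measurability _ _ _ (borel K) setT (of_real k) (@open K)) => //.
move=> _ [V oV <-]; rewrite setTI; apply: open_measurable.
rewrite openE => a /= Va.
have /(@nbhs_rnormP R k (K^o))[e e0 eV] : nbhs (of_real k a) V by exact: open_nbhs_nbhs.
apply/nbhs_ballP; exists e => // b; rewrite -ball_normE /= => ab.
by apply: eV; rewrite rnorm_regular -of_realB kabs_of_real.
Qed.

Lemma lipschitz_scale (c : K) : measurable_fun setT (fun x : borel K => c * x : borel K).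
Proof.
apply: (@lipschitz_measurable R k (K^o) (K^o) (fun x => c * x) (kabs c)) => x y.
by rewrite -[leLHS]/(kabs (c * x - c * y)) -mulrBr kabsM.
Qed.

Lemma measurable_scalars {d} {U : measurableType d} (f : U -> borel K) :
  measurable_fun setT (@re_part R k \o f) -> measurable_fun setT (@im_part R k \o f) ->
  measurable_fun setT f.
Proof.
move=> mr mi.
have -> : f = fun w => of_real k (re_part (f w)) + imag_unit R k * of_real k (im_part (f w)).
  by apply/funext => w; exact: re_im_decomp.
apply: (@measurable_borelD R k (K^o) separable_scalars).
  exact: (measurableT_comp measurable_of_real mr).
apply: (measurableT_comp (lipschitz_scale _)).
exact: (measurableT_comp measurable_of_real mi).
Qed.

Lemma measurable_scalarsD {d} {U : measurableType d} (f g : U -> borel K) :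
  measurable_fun setT f -> measurable_fun setT g ->
  measurable_fun setT (fun w => (f w : K) + (g w : K) : borel K).
Proof. exact: (@measurable_borelD R k (K^o) separable_scalars). Qed.

(** Over the reals [im_part] vanishes, so this is a half-line if [b < 0] and empty otherwise. *)
Definition quadrant (a b : R) : set K := [set x | a < re_part x /\ b < im_part x].
Definition quadrants : set (set K) := [set A | exists a b, A = quadrant a b].

Lemma quadrants_setI : setI_closed quadrants.
Proof.
move=> _ _ [a [b ->]] [a' [b' ->]]; exists (Num.max a a'), (Num.max b b').
apply/seteqP; split => x; rewrite /quadrant /= !gt_max; first by move=> [[-> ->] [-> ->]].
by move=> [/andP[-> ->] /andP[-> ->]].
Qed.

Lemma measurable_fun_gtR {d} {U : measurableType d} (f : U -> R) :
  (forall a : R, measurable [set w | a < f w]) -> measurable_fun setT f.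
Proof.
move=> H; rewrite (_ : f = (fun w => - (- f w))); last by apply/funext => w; rewrite opprK.
apply: measurable_funN; apply: measurable_fun_ltR => a.
by rewrite (_ : mkset _ = [set w | - a < f w]) //; apply/seteqP; split => w /=; rewrite ltrNl.
Qed.

(** The hard inclusion says that the identity is measurable from the sigma-algebra of quadrants to
    the Borel one. It is enough to test real and imaginary parts, and an open half-plane is the
    union of the quadrants whose other bound is [- n%:R]. *)
Lemma borel_quadrants : @measurable _ (borel K) = <<s quadrants >>.
Proof.
pose K' := g_sigma_algebraType quadrants.
apply/seteqP; split; last first.
  apply: smallest_sub; first exact: sigma_algebra_measurable.
  move=> _ [a [b ->]].
  have -> : quadrant a b = (@re_part R k @^-1` `]a, +oo[%classic) `&` (@im_part R k @^-1` `]b, +oo[%classic).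
    by apply/seteqP; split => x /=; rewrite /quadrant /= !in_itv /= !andbT.
  apply: (@measurableI _ (borel K)); apply: (@measurable_preim _ _ (borel K) _) => //.
    exact: measurable_re_part.
  exact: measurable_im_part.
have q (a b : R) : measurable (quadrant a b : set K') by apply: sub_sigma_algebra; exists a, b.
have : measurable_fun setT (fun x : K' => x : borel K).
  have big (x : R) : exists n : nat, - n%:R < x.
    exists (Num.truncn (- x)).+1; rewrite ltrNl; exact: truncnS_gt.
  apply: measurable_scalars; apply: measurable_fun_gtR => a.
    rewrite (_ : mkset _ = \bigcup_n (quadrant a (- n%:R) : set K')); first exact: bigcupT_measurable.
    apply/seteqP; split => x /= => [ax|[n _ []]//].
    by have [n hn] := big (im_part x); exists n.
  rewrite (_ : mkset _ = \bigcup_n (quadrant (- n%:R) a : set K')); first exact: bigcupT_measurable.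
  apply/seteqP; split => x /= => [ax|[n _ []]//].
  by have [n hn] := big (re_part x); exists n.
move=> mid A mA; have := mid measurableT A mA.
by rewrite setTI.
Qed.

Lemma same_law_char {d1 d2} {Omega1 : measurableType d1} {Omega2 : measurableType d2}
    (P1 : probability Omega1 R) (P2 : probability Omega2 R)
    (X1 : Omega1 -> borel K) (X2 : Omega2 -> borel K) :
  measurable_fun setT X1 -> measurable_fun setT X2 ->
  (forall t s : R, expect_expi P1 (fun w => t * re_part (X1 w) + s * im_part (X1 w))
                 = expect_expi P2 (fun w => t * re_part (X2 w) + s * im_part (X2 w))) ->
  same_law P1 X1 P2 X2.
Proof.
move=> m1 m2 H.
apply: (@same_law_pi _ _ _ _ _ _ (borel K) _ _ _ _ quadrants) => //.
- exact: borel_quadrants.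
- exact: quadrants_setI.
move=> _ [a [b ->]].
have mp d (U : measurableType d) (X : U -> borel K) : measurable_fun setT X ->
    measurable_fun setT (fun w => (re_part (X w), im_part (X w))).
  move=> mX; apply: measurable_fun_pair.
    exact: measurableT_comp measurable_re_part mX.
  exact: measurableT_comp measurable_im_part mX.
exact: (char_fun_quadrant (mp _ _ _ m1) (mp _ _ _ m2) H a b).
Qed.
End scalar_borel.

Section independent_expectation.
Context {R : realType} {d} {Omega : measurableType d} (P : probability Omega R).
Variables U V : Omega -> R.
Hypotheses (mU : measurable_fun setT U) (mV : measurable_fun setT V).
Hypothesis iUV : independent_pair P U V.

(** Independence makes the joint law agree with the product of the marginal laws, by uniqueness of
    product measures; Fubini then separates the integrals. *)
Lemma Rint_independent (f g : R -> R) : bounded_measurable f -> bounded_measurable g ->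
  \int[P]_w (f (U w) * g (V w)) = \int[P]_w f (U w) * \int[P]_w g (V w).
Proof.
move=> bf bg.
have mUV : measurable_fun setT (fun w => (U w, V w)) by exact: measurable_fun_pair.
pose m1 := distribution P (mfun_of mU); pose m2 := distribution P (mfun_of mV).
pose nu := distribution P (mfun_of mUV).
pose h (z : R * R) : R := f z.1 * g z.2.
have [mf [M fM]] := bf; have [mg [N gN]] := bg.
have mh : measurable_fun setT h.
  apply: measurable_funM; first exact: measurableT_comp mf (@measurable_fst _ _ _ _).
  exact: measurableT_comp mg (@measurable_snd _ _ _ _).
have hMN z : `|h z| <= M * N by rewrite /h normrM ler_pM.
have bh : bounded_measurable h by split => //; exists (M * N).
have nuE A : measurable A -> (m1 \x m2)%E A = nu A.
  by apply: product_measure_unique => {}A B mA mB; exact: iUV.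
have ih : (m1 \x m2)%E.-integrable setT (EFin \o h).
  apply: measurable_bounded_integrable => //.
    rewrite [X in (X < _)%E]nuE //; exact: le_lt_trans (probability_le1 nu measurableT) (ltry 1).
  exists (M * N); split; first exact: num_real.
  by move=> y My x _ /=; rewrite (le_trans (hMN x))// ltW.
have bU (p : R -> R) : bounded_measurable p -> bounded_measurable (fun w => p (U w)).
  by move=> [mp [L pL]]; split; [exact: measurableT_comp mp mU|exists L].
have bV (p : R -> R) : bounded_measurable p -> bounded_measurable (fun w => p (V w)).
  by move=> [mp [L pL]]; split; [exact: measurableT_comp mp mV|exists L].
have I1 (p : R -> R) : bounded_measurable p -> (\int[m1]_x (p x)%:E = (\int[P]_w p (U w))%:E)%E.
  move=> bp; rewrite /Rintegral fineK; last first.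
    exact: (integrable_fin_num measurableT (bounded_measurable_integrable P (bU _ bp))).
  rewrite /m1 integral_distribution //=; first by apply/measurable_EFinP; case: bp.
  exact: (bounded_measurable_integrable P (bU _ bp)).
have I2 (p : R -> R) : bounded_measurable p -> (\int[m2]_x (p x)%:E = (\int[P]_w p (V w))%:E)%E.
  move=> bp; rewrite /Rintegral fineK; last first.
    exact: (integrable_fin_num measurableT (bounded_measurable_integrable P (bV _ bp))).
  rewrite /m2 integral_distribution //=; first by apply/measurable_EFinP; case: bp.
  exact: (bounded_measurable_integrable P (bV _ bp)).
have bUV : bounded_measurable (fun w => f (U w) * g (V w)).
  by apply: bounded_measurableM; [exact: bU|exact: bV].
have E1 : (\int[P]_w (f (U w) * g (V w))%:E = \int[m1 \x m2]_z (h z)%:E)%E.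
  transitivity (\int[nu]_z (h z)%:E)%E.
    rewrite /nu integral_distribution //=; first exact/measurable_EFinP.
    exact: (bounded_measurable_integrable P bUV).
  by apply: eq_measure_integral => A mA _; rewrite -[LHS]nuE.
rewrite {1}/Rintegral E1 -integral12_prod_meas1 //.
have E2 x : fubini_F m2 (EFin \o h) x = (f x * \int[P]_w g (V w))%:E.
  rewrite /fubini_F /=.
  under eq_integral do rewrite /h /= EFinM.
  rewrite integralZl //; first by rewrite I2 // -EFinM.
  exact: (bounded_measurable_integrable m2 bg).
under eq_integral do rewrite E2.
rewrite I1; last by apply: bounded_measurableM => //; exact: bounded_measurable_cst.
rewrite /= [RHS]mulrC -(RintZ P _ (bU _ bf)).
by apply: eq_Rintegral => w _; rewrite mulrC.
Qed.

Lemma expect_expi_independent :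
  expect_expi P (fun w => U w + V w) = expect_expi P U * expect_expi P V.
Proof.
have bc : bounded_measurable (fun x : R => cos x) by apply: bounded_measurable_cos; exact: measurable_id.
have bs : bounded_measurable (fun x : R => sin x) by apply: bounded_measurable_sin; exact: measurable_id.
have bcU := bounded_measurable_cos mU; have bsU := bounded_measurable_sin mU.
have bcV := bounded_measurable_cos mV; have bsV := bounded_measurable_sin mV.
rewrite /expect_expi; apply/eqP; rewrite eq_complex /=; apply/andP; split; apply/eqP.
  under eq_Rintegral do rewrite cosD -mulN1r.
  rewrite (RintD P (bounded_measurableM bcU bcV)); last first.
    by apply: bounded_measurableM; [exact: bounded_measurable_cst|exact: bounded_measurableM].
  rewrite (RintZ P _ (bounded_measurableM bsU bsV)) mulN1r.
  by rewrite (Rint_independent bc bc) (Rint_independent bs bs).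
under eq_Rintegral do rewrite sinD.
rewrite (RintD P (bounded_measurableM bsU bcV) (bounded_measurableM bcU bsV)).
by rewrite (Rint_independent bc bs) (Rint_independent bs bc) addrC.
Qed.
End independent_expectation.

(** * Isotropic stable laws *)

Section circle.
Context {R : realType} (alpha : R).
Hypotheses (alpha_gt0 : 0 < alpha) (alpha_le2 : alpha <= 2).

Lemma continuous_norm_powR : continuous (fun y : R => `|y| `^ alpha).
Proof.
move=> y; have [->|y0] := eqVneq y 0.
  rewrite /continuous_at normr0 powR0 ?gt_eqF //.
  apply/cvgr0Pnorm_lt => e e0.
  (* At 0 differentiability can fail, so the radius comes from inverting the power directly. *)
  have e'0 : 0 < e `^ alpha^-1 by exact: powR_gt0.
  apply/nbhs_ballP; exists (e `^ alpha^-1) => // z; rewrite /= sub0r normrN => ze.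
  rewrite ger0_norm ?powR_ge0 //.
  have -> : e = (e `^ alpha^-1) `^ alpha by rewrite -powRrM mulVf ?gt_eqF // powRr1 // ltW.
  by rewrite gt0_ltr_powR // nnegrE // ltW.
apply: (@continuous_comp _ _ _ (fun y : R => `|y|) (fun z : R => z `^ alpha)).
  exact: norm_continuous.
apply: differentiable_continuous; apply/derivable1_diffP.
by apply: derivable_powR; rewrite in_itv /= normr_gt0 y0.
Qed.

Definition itv_int (h : R -> R) (a b : R) :=
  (\int[lebesgue_measure]_(x in `[a, b]) (h x)%:E)%E.

Lemma integral_shift (G : R -> R) (a b phi : R) : a <= b -> continuous G ->
  itv_int G (a + phi) (b + phi) = itv_int (fun x => G (x + phi)) a b.
Proof.
move=> ab cG.
have dF (x : R) : is_derive x (1 : R) (fun x : R => x + phi) (1 : R).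
  have : is_derive x (1 : R) (fun x : R => x + phi) (1 + 0) by apply: is_deriveD.
  by rewrite addr0.
have F1 : (fun x : R => x + phi)^`()%classic = cst 1.
  by apply/funext => x; rewrite derive1E derive_val.
have cF : continuous (fun x : R => x + phi).
  by move=> x; apply: cvgD; [exact: cvg_id|exact: cvg_cst].
rewrite /itv_int (@integration_by_substitution_increasing R (fun x => x + phi) G a b) //.
- by apply: eq_integral => x _ /=; rewrite F1 /= mulr1.
- by move=> x y _ _ xy; rewrite ltrD2r.
- by rewrite F1 => x _; exact: cst_continuous.
- by rewrite F1; exact: is_cvg_cst.
- by rewrite F1; exact: is_cvg_cst.
- split => [x _||].
  + by apply/ex_derive.
  + by apply: cvg_at_right_filter; exact: cF.
  + by apply: cvg_at_left_filter; exact: cF.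
- by apply: continuous_subspaceT; exact: cG.
Qed.

Lemma itv_int_split (h : R -> R) (a b c : R) : continuous h -> (forall x, 0 <= h x) ->
  a <= b -> b <= c -> (itv_int h a c = itv_int h a b + itv_int h b c)%E.
Proof.
move=> ch h0 ab bc.
have mh D : measurable D -> measurable_fun D (EFin \o h).
  move=> mD; apply: (@measurable_funS _ _ _ _ setT) => //; apply/measurable_EFinP.
  exact: continuous_measurable_fun.
rewrite /itv_int (@itv_bndbnd_setU _ _ _ (BRight b)) ?bnd_simp //.
rewrite ge0_integral_setU //; last 3 first.
- by apply: mh; exact: measurableU.
- by move=> x _; rewrite lee_fin.
- by rewrite disj_set2E; apply/eqP/seteqP; split => // x [] /=; rewrite !in_itv /= => /andP[_ h1] /andP[h2 _]; move: (le_lt_trans h1 h2); rewrite ltxx.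
by rewrite (@integral_itv_obnd_cbnd _ b (BRight c) (EFin \o h)) //; apply: mh.
Qed.

(** The shifted interval from [phi] to [pi *+ 2 + phi] is cut at [pi *+ 2], and its last piece is
    moved back by one period to the interval from 0 to [phi]. *)
Lemma integral_periodic_shift (h : R -> R) (phi : R) : continuous h -> (forall x, 0 <= h x) ->
  periodic h (pi *+ 2) -> 0 <= phi <= pi *+ 2 ->
  itv_int (fun x => h (x + phi)) 0 (pi *+ 2) = itv_int h 0 (pi *+ 2).
Proof.
move=> ch h0 hp /andP[p0 p2].
have pi0 : 0 <= pi *+ 2 :> R by rewrite ltW // twopi_gt0.
rewrite -integral_shift // add0r.
rewrite (itv_int_split ch h0 p2) ?lerDl // (itv_int_split ch h0 p0 p2) addeC; congr (_ + _)%E.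
rewrite -{1}(add0r (pi *+ 2)) (addrC (pi *+ 2)) integral_shift //.
by apply: eq_integral => x _; rewrite hp.
Qed.

Definition circle_mean (f : R * R -> R) : R :=
  \int[@circle_uniform R]_(s in @unit_circle R) f s.

Lemma circle_meanE (f : R * R -> R) : measurable_fun setT f -> (forall s, 0 <= f s) ->
  circle_mean f = fine (((pi *+ 2)^-1)%:E * itv_int (fun x => f (cos x, sin x)) 0 (pi *+ 2))%E.
Proof.
move=> mf f0; rewrite /circle_mean /Rintegral; congr fine.
have mU : measurable (@unit_circle R).
  have mc : measurable_fun setT (fun s : R * R => s.1 ^+ 2 + s.2 ^+ 2).
    by apply: measurable_funD; apply: measurable_funX.
  rewrite (_ : @unit_circle R = (fun s : R * R => s.1 ^+ 2 + s.2 ^+ 2) @^-1` [set 1]) //.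
  by apply: measurable_preim.
rewrite /circle_uniform ge0_integral_pushforward //; last 2 first.
- by apply/measurable_EFinP; exact: measurable_funS mf.
- by move=> s _; rewrite lee_fin.
have -> : @circle_param R @^-1` @unit_circle R = setT.
  by apply/seteqP; split => // x _; rewrite /unit_circle /circle_param /= cos2Dsin2.
have mfc : measurable_fun setT (EFin \o f \o @circle_param R).
  apply/measurable_EFinP; exact: measurableT_comp mf (@measurable_circle_param R).
rewrite integral_uniform //; last by move=> x; rewrite lee_fin.
by rewrite subr0.
Qed.
End circle.

Section circle_char.
Context {R : realType} (alpha : R).
Hypotheses (alpha_gt0 : 0 < alpha) (alpha_le2 : alpha <= 2).

(** The angle comes from [acos] and lies between 0 and [pi], so the sign of [s] is recorded
    separately in [e]. *)
Lemma polar_coordinates (t s : R) : exists phi e : R, [/\ 0 <= phi <= pi, (e = 1) \/ (e = -1),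
  t = Num.sqrt (t ^+ 2 + s ^+ 2) * cos phi & s = e * (Num.sqrt (t ^+ 2 + s ^+ 2) * sin phi)].
Proof.
set r := Num.sqrt _.
have r2 : r ^+ 2 = t ^+ 2 + s ^+ 2 by rewrite sqr_sqrtr // addr_ge0 // sqr_ge0.
have r0 : 0 <= r by exact: sqrtr_ge0.
have [r00|rn0] := eqVneq r 0.
  move: r2; rewrite r00 expr0n /= => /esym/eqP; rewrite paddr_eq0 ?sqr_ge0 // !sqrf_eq0.
  move=> /andP[/eqP -> /eqP ->]; exists 0, 1.
  by split; rewrite ?lexx ?pi_ge0 ?mul0r ?mulr0 //; left.
have rgt0 : 0 < r by rewrite lt_neqAle eq_sym rn0.
have tr : -1 <= t / r <= 1.
  rewrite -ler_norml normrM normfV (gtr0_norm rgt0) ler_pdivrMr // mul1r.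
  by rewrite -(@ler_pXn2r _ 2) ?nnegrE // real_normK ?num_real // r2 lerDl sqr_ge0.
exists (acos (t / r)), (if 0 <= s then 1 else -1).
have sE : r * sin (acos (t / r)) = `|s|.
  rewrite sin_acos //.
  have -> : 1 - (t / r) ^+ 2 = (s / r) ^+ 2.
    by rewrite !expr_div_n r2; field; rewrite -r2 expf_neq0.
  by rewrite sqrtr_sqr normrM normfV (gtr0_norm rgt0); field.
split.
- by rewrite acos_ge0 // acos_lepi.
- by case: ifP => _; [left|right].
- by rewrite acosK ?in_itv //=; field.
- rewrite sE; case: ifP => [s0|/negbT]; first by rewrite ger0_norm // mul1r.
  by rewrite -ltNge => s0; rewrite ltr0_norm // mulN1r opprK.
Qed.

Let hcos (x : R) : R := `|cos x| `^ alpha.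

Let chcos : continuous hcos.
Proof.
by move=> x; apply: (@continuous_comp _ _ _ (@cos R) (fun y => `|y| `^ alpha));
  [exact: continuous_cos|exact: continuous_norm_powR].
Qed.
Let hcos_ge0 x : 0 <= hcos x. Proof. exact: powR_ge0. Qed.
Let hcos_per : periodic hcos (pi *+ 2). Proof. by move=> x; rewrite /hcos cosD2pi. Qed.
Let hcos_le1 x : hcos x <= 1.
Proof.
have p1 : (1 : R) `^ alpha = 1 by rewrite powR1.
rewrite -p1 /hcos ge0_ler_powR ?nnegrE //; first exact: ltW.
by rewrite ler_norml cos_geN1 cos_le1.
Qed.

Let pi2_gt0 : 0 < pi *+ 2 :> R. Proof. exact: twopi_gt0. Qed.

Let mcont (h : R -> R) D : measurable D -> continuous h -> measurable_fun D (EFin \o h).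
Proof.
move=> mD ch; apply: (@measurable_funS _ _ _ _ setT) => //; apply/measurable_EFinP.
exact: continuous_measurable_fun.
Qed.

Let itv_int_cst (c : R) : itv_int (fun=> c) 0 (pi *+ 2) = (c * (pi *+ 2))%:E.
Proof.
rewrite /itv_int integral_cst //= lebesgue_measure_itv /= lte_fin pi2_gt0.
by rewrite -EFinD subr0 EFinM.
Qed.

Let hcos_fin : itv_int hcos 0 (pi *+ 2) \is a fin_num.
Proof.
rewrite ge0_fin_numE; last by apply: integral_ge0 => x _; rewrite lee_fin.
apply: (@le_lt_trans _ _ (itv_int (fun=> 1) 0 (pi *+ 2))); last by rewrite itv_int_cst ltry.
apply: ge0_le_integral => //.
- by move=> x _; rewrite lee_fin.
- exact: mcont.
- by move=> x _; rewrite lee_fin.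
Qed.

(** The circle integral for the direction [(1, 0)], and by rotation invariance for every unit
    direction. *)
Definition circle_const : R := circle_mean (fun s => `|s.1| `^ alpha).

Let mlinpow (t s : R) : measurable_fun setT (fun z : R * R => `|t * z.1 + s * z.2| `^ alpha).
Proof.
apply: (measurableT_comp (measurable_powR alpha)); apply: measurableT_comp => //.
by apply: measurable_funD; apply: measurable_funM.
Qed.

Let circle_constE : circle_const = (pi *+ 2)^-1 * fine (itv_int hcos 0 (pi *+ 2)).
Proof.
rewrite /circle_const circle_meanE; last 2 first.
- have := mlinpow 1 0; congr measurable_fun; apply/funext => z.
  by rewrite mul1r mul0r addr0.
- by move=> s; exact: powR_ge0.
exact: (@fineM _ ((pi *+ 2)^-1)%:E (itv_int hcos 0 (pi *+ 2)) isT hcos_fin).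
Qed.

(** In polar coordinates [t * cos x + s * sin x = r * cos (x - e * phi)]. The factor [r] comes out
    with exponent [alpha], and periodicity removes the rotation. *)
Lemma circle_mean_powR (t s : R) :
  circle_mean (fun z => `|t * z.1 + s * z.2| `^ alpha) =
  circle_const * Num.sqrt (t ^+ 2 + s ^+ 2) `^ alpha.
Proof.
have [phi [e [/andP[p0 ppi] e1 tE sE]]] := polar_coordinates t s.
set r := Num.sqrt (t ^+ 2 + s ^+ 2) in tE sE *.
have r0 : 0 <= r by exact: sqrtr_ge0.
rewrite circle_meanE //.
have ppi2 : 0 <= phi <= pi *+ 2 by rewrite p0 (le_trans ppi)// mulr2n lerDl pi_ge0.
have E : itv_int (fun x => `|t * (cos x, sin x).1 + s * (cos x, sin x).2| `^ alpha) 0 (pi *+ 2) =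
    itv_int (fun x => r `^ alpha * hcos (x - e * phi)) 0 (pi *+ 2).
  rewrite /itv_int; apply: eq_integral => x _; congr EFin.
  rewrite /hcos -powRM // -[X in (X * _) `^ _](ger0_norm r0) -normrM /=; congr (`|_| `^ _).
  rewrite {1}tE {1}sE cosB.
  by case: e1 => ->; rewrite ?mul1r ?mulN1r ?cosN ?sinN; ring.
have ch (a : R) : continuous (fun x => hcos (x + a)).
  move=> x; apply: (@continuous_comp _ _ _ (fun x => x + a) hcos); last exact: chcos.
  by apply: cvgD; [exact: cvg_id|exact: cvg_cst].
have E2 : itv_int (fun x => hcos (x - e * phi)) 0 (pi *+ 2) = itv_int hcos 0 (pi *+ 2).
  case: e1 => ->; last first.
    by rewrite mulN1r opprK integral_periodic_shift.
  (* Only nonnegative shifts are available, so the shift by [- phi] is undone: the lemma is applied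
     to the already rotated function. *)
  have hp : periodic (fun x => hcos (x - phi)) (pi *+ 2) by move=> x; rewrite addrAC hcos_per.
  have := integral_periodic_shift (ch (- phi)) (fun _ => hcos_ge0 _) hp ppi2.
  rewrite mul1r => <-; apply: eq_integral => x _; by rewrite addrK.
rewrite E circle_constE.
have -> : itv_int (fun x => r `^ alpha * hcos (x - e * phi)) 0 (pi *+ 2) =
    ((r `^ alpha)%:E * itv_int hcos 0 (pi *+ 2))%E.
  rewrite -E2 /itv_int; under eq_integral do rewrite EFinM.
  rewrite ge0_integralZl //.
  - exact: mcont.
  - by move=> x _; rewrite lee_fin.
  - by rewrite lee_fin powR_ge0.
by rewrite muleCA !fineM ?fin_numM // mulrC.
Qed.

(** Since [|cos x| <= 1] and [alpha <= 2], [hcos x] is at least [cos x ^+ 2], whose integral over a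
    period is positive. *)
Lemma circle_const_gt0 : 0 < circle_const.
Proof.
rewrite circle_constE mulr_gt0 ?invr_gt0 //.
pose c2 (x : R) : R := cos x ^+ 2.
have cc2 : continuous c2.
  move=> x; apply: (@continuous_comp _ _ _ (@cos R) (fun y => y ^+ 2));
   [exact: continuous_cos|exact: exprn_continuous].
have c20 x : 0 <= c2 x by exact: sqr_ge0.
have c2h x : c2 x <= hcos x.
  rewrite /c2 /hcos -real_normK ?num_real // -powR_mulrn //.
  have [->|c0] := eqVneq (cos x) 0; first by rewrite normr0 !powR0 // gt_eqF.
  by apply: ger_powR => //; rewrite normr_gt0 c0 ler_norml cos_geN1 cos_le1.
(* A shift by [pi / 2] turns one copy of the squared cosine into a squared sine; the two add up to
   1. *)
have J2 : (itv_int c2 0 (pi *+ 2) + itv_int c2 0 (pi *+ 2) = (pi *+ 2)%:E)%E.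
  rewrite -{2}(@integral_periodic_shift R c2 (pi / 2)) //; last first.
  - have key (p : R) : 0 <= p -> 0 <= p / 2 <= p *+ 2.
      move=> p0; rewrite divr_ge0 //= (mulr2n p) (@le_trans _ _ p) ?lerDl //.
      by rewrite ler_pdivrMr // ler_peMr // ler1n.
    exact: key (pi_ge0 R).
  - by move=> x; rewrite /c2 cosD2pi.
  rewrite /itv_int -ge0_integralD //.
  - rewrite -[in RHS](mul1r (pi *+ 2)) -itv_int_cst /itv_int.
    by apply: eq_integral => x _; rewrite /c2 cosDpihalf sqrrN -EFinD cos2Dsin2.
  - by move=> x _; rewrite lee_fin.
  - exact: mcont.
  - by move=> x _; rewrite lee_fin.
  - apply: mcont => //; move=> x; apply: (@continuous_comp _ _ _ (fun x => x + pi / 2) c2); last exact: cc2.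
    by apply: cvgD; [exact: cvg_id|exact: cvg_cst].
have le : (itv_int c2 0 (pi *+ 2) <= itv_int hcos 0 (pi *+ 2))%E.
  apply: ge0_le_integral => //.
  - by move=> x _; rewrite lee_fin.
  - exact: mcont.
  - exact: mcont.
  - by move=> x _; rewrite lee_fin.
have : ((pi *+ 2)%:E <= itv_int hcos 0 (pi *+ 2) + itv_int hcos 0 (pi *+ 2))%E.
  by rewrite -J2 leeD.
rewrite -(fineK hcos_fin) -EFinD lee_fin /=; move: pi2_gt0.
by set J := fine _; lra.
Qed.
End circle_char.

Section sas.
Context {R : realType} {k : scalar_kind} (alpha : R).
Hypothesis alpha_gt0 : 0 < alpha.
Local Notation K := (scalars R k).

(* The exponent is the one of both kinds of scalars: by rotation invariance the
   integral over the circle is a constant times [|t + i s| ^ alpha]. *)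
Definition sas {d} {Omega : measurableType d} (P : probability Omega R) (kappa : R)
    (X : Omega -> borel K) : Prop :=
  measurable_fun setT X /\ forall t s : R,
    expect_expi P (fun w => t * re_part (X w) + s * im_part (X w)) =
    Complex (expR (- (kappa * kabs (of_real k t + imag_unit R k * of_real k s) `^ alpha))) 0.

Context {d} {Omega : measurableType d} (P : probability Omega R).
Implicit Types X Y : Omega -> borel K.

Lemma sas_same_law {d'} {Omega' : measurableType d'} (P' : probability Omega' R)
    (kappa : R) X (Y : Omega' -> borel K) : sas P kappa X -> sas P' kappa Y -> same_law P X P' Y.
Proof.
by move=> [mX cX] [mY cY]; apply: same_law_char => // t s; rewrite cX cY.
Qed.

(* [t' + i s'] is [conj c * (t + i s)]. *)
Lemma scalar_dual (c : K) : exists t' s' : R -> R -> R, forall t s,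
  (forall x : K, t * re_part (c * x) + s * im_part (c * x) =
                 t' t s * re_part x + s' t s * im_part x) /\
  kabs (of_real k (t' t s) + imag_unit R k * of_real k (s' t s)) =
  kabs c * kabs (of_real k t + imag_unit R k * of_real k s).
Proof.
rewrite /kabs /re_part /im_part /of_real /imag_unit; move: c; case: k => [c|[a b]] /=.
  exists (fun t s => t * c), (fun t s => 0) => t s.
  by split => [x|]; rewrite ?mul0r ?mulr0 ?addr0 ?mulrA // normrM mulrC.
exists (fun t s => t * a + s * b), (fun t s => s * a - t * b) => t s.
split => [[x y]|] /=; first by ring.
rewrite -sqrtrM; last by rewrite addr_ge0 // sqr_ge0.
by congr Num.sqrt; ring.
Qed.

Lemma sas_scale (c : K) (kappa : R) X : sas P kappa X ->
  sas P (kappa * kabs c `^ alpha) (fun w => c * X w : borel K).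
Proof.
move=> [mX cX]; split.
  exact: (measurableT_comp (lipschitz_scale c) mX).
move=> t s; have [t' [s' /(_ t s)[E1 E2]]] := scalar_dual c.
have -> : (fun w => t * re_part (c * (X w : K)) + s * im_part (c * (X w : K))) =
    (fun w => t' t s * re_part (X w) + s' t s * im_part (X w)).
  by apply/funext => w; rewrite E1.
by rewrite cX E2 powRM ?kabs_ge0 // mulrA.
Qed.

Lemma independent_pair_comp {d1 d2} {T1 : measurableType d1} {T2 : measurableType d2}
    (X Y : Omega -> T1) (f g : T1 -> T2) :
  measurable_fun setT f -> measurable_fun setT g ->
  independent_pair P X Y -> independent_pair P (f \o X) (g \o Y).
Proof.
by move=> mf mg iXY A B mA mB; apply: (iXY (f @^-1` A) (g @^-1` B)); exact: measurable_preim.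
Qed.

Lemma measurable_re_im (t s : R) : measurable_fun setT
  (fun x : borel K => t * re_part x + s * im_part x).
Proof.
apply: measurable_funD; apply: measurable_funM => //.
  exact: measurable_re_part.
exact: measurable_im_part.
Qed.

Lemma sas_add (k1 k2 : R) X Y : sas P k1 X -> sas P k2 Y -> independent_pair P X Y ->
  sas P (k1 + k2) (fun w => (X w : K) + (Y w : K) : borel K).
Proof.
move=> [mX cX] [mY cY] iXY; split; first exact: measurable_scalarsD.
move=> t s.
have -> : (fun w => t * re_part ((X w : K) + (Y w : K)) + s * im_part ((X w : K) + (Y w : K))) =
    (fun w => (t * re_part (X w) + s * im_part (X w)) + (t * re_part (Y w) + s * im_part (Y w))).
  by apply/funext => w; rewrite re_partD im_partD; ring.
rewrite (@expect_expi_independent _ _ _ P (fun w => t * re_part (X w) + s * im_part (X w))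
   (fun w => t * re_part (Y w) + s * im_part (Y w))).
- rewrite cX cY; apply/eqP; rewrite eq_complex /= !mulr0 !mul0r addr0 subr0 eqxx andbT.
  by rewrite -expRD -opprD -mulrDl.
- exact: measurableT_comp (measurable_re_im t s) mX.
- exact: measurableT_comp (measurable_re_im t s) mY.
- exact: (independent_pair_comp (measurable_re_im t s) (measurable_re_im t s) iXY).
Qed.
End sas.

Lemma stable_measure_sas {R : realType} (k : scalar_kind) (alpha : R) {d} {Omega : measurableType d}
    (P : probability Omega R) (M : set int -> Omega -> scalars R k) :
  0 < alpha -> alpha <= 2 -> stable_random_measure (@counting int R) P alpha M ->
  mutually_independent P (fun n : int => M [set n] : Omega -> borel (scalars R k)) /\
  exists2 kappa : R, 0 < kappa & forall n : int, sas alpha P kappa (M [set n]).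
Proof.
move=> a0 a2 HM.
have c1 (n : int) : @counting int R [set n] = 1%E.
  by rewrite /counting asboolT //; rewrite fset_set1 finmap.cardfs1.
have fin1 (n : int) : finite_measure_set (@counting int R) [set n].
  by split => //; rewrite [X in (X < _)%E](c1 n) ltry.
have f1 n : fine (@counting int R [set n]) = 1 by rewrite c1.
have rm : random_measure (@counting int R) P M.
  by move: M HM; case: k => M [].
have [mM iM _] := rm.
split.
  move=> s B us mB.
  (* Independence of a random measure concerns families of disjoint sets indexed by ordinals: here
     the singletons of the entries of [s], disjoint because [s] has no repetition. *)
  pose A (i : 'I_(size s)) := [set nth 0 s i].
  have tA : trivIset setT A.
    apply/trivIsetP => i j _ _ ij; apply/seteqP; split => // x [/= -> /eqP].
    by rewrite nth_uniq // => /eqP/val_inj/eqP; rewrite (negbTE ij).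
  have := iM _ A (fun i => fin1 _) tA (index_enum 'I_(size s)) (fun i => B (nth 0 s i))
    (index_enum_uniq _) (fun i => mB _).
  rewrite (big_nth 0) big_mkord => <-; congr (P _).
  apply/seteqP; split => w /= H.
    by move=> i _; apply: (H (nth 0 s i)); rewrite /= mem_nth.
  move=> x /= xs; rewrite -(nth_index 0 xs).
  by have := H (Ordinal (eq_ind_r is_true xs (index_mem x s))) (mem_index_enum _).
move: M HM mM {rm iM}; case: k => M [_ cM] mM.
  exists 1 => // n; split; first exact: mM.
  move=> t s.
  have -> : (fun w => t * @re_part R RealScalars (M [set n] w) + s * im_part (k := RealScalars) (M [set n] w)) =
      (fun w => t * M [set n] w) by apply/funext => w; rewrite /= mulr0 addr0.
  rewrite (cM _ (fin1 n) t) [fine _]f1 !mul1r.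
  have -> : kabs (of_real RealScalars t + imag_unit R RealScalars * of_real RealScalars s) = `|t|.
    by rewrite /kabs /= mul0r addr0.
  by [].
(* In the complex case the control integral over the circle contributes this constant, where the
   real case has 1. *)
exists (circle_const alpha); first exact: circle_const_gt0.
move=> n; split; first exact: mM.
move=> t s.
rewrite (cM _ (fin1 n) t s) [fine _]f1 mul1r.
have -> : kabs (of_real ComplexScalars t + imag_unit R ComplexScalars * of_real ComplexScalars s) =
    Num.sqrt (t ^+ 2 + s ^+ 2).
  by rewrite /kabs /=; congr Num.sqrt; rewrite !mul0r !mulr0 !mul1r subr0 ?addr0 !add0r ?addr0.
by rewrite -/(circle_mean (fun z : R * R => `|t * z.1 + s * z.2| `^ alpha)) circle_mean_powR.
Qed.

Lemma positive_cover {R : realType} {d} {Omega : measurableType d} (P : probability Omega R)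
    (A : set Omega) (B : nat -> set Omega) :
  measurable A -> (forall n, measurable (B n)) -> A `<=` \bigcup_n B n ->
  (0 < P A)%E -> exists n, (0 < P (B n))%E.
Proof.
move=> mA mB AB PA; apply: contrapT => H.
have N n : P.-negligible (B n).
  apply/negligibleP => //; apply/eqP; rewrite eq_le measure_ge0 andbT leNgt.
  by apply/negP => h; apply: H; exists n.
have : P.-negligible A by apply: negligibleS AB _; exact: negligible_bigcup.
by move=> nA; move: PA; rewrite (measure_negligible mA nA) ltxx.
Qed.

(** From [cos x = 1 - 2 * sin (x / 2) ^+ 2] and [|sin y| <= |y|], the latter by the mean value
    theorem for [z - sin z]. *)
Lemma cos_ge {R : realType} (x : R) : 1 - x ^+ 2 / 2 <= cos x.
Proof.
have H (y : R) : 0 <= y -> sin y <= y.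
  move=> y0; have [->|yn0] := eqVneq y 0; first by rewrite sin0.
  have ygt : 0 < y by rewrite lt_neqAle eq_sym yn0.
  have dF (z : R) : is_derive z (1 : R) (fun z => z - sin z) (1 - cos z).
    by apply: is_deriveB.
  have [|c _ E] := @MVT R (fun z => z - sin z) (fun z => 1 - cos z) 0 y ygt (fun z _ => dF z).
    apply: continuous_subspaceT => z; apply: cvgB; [exact: cvg_id|exact: continuous_sin].
  rewrite -subr_ge0; move: E; rewrite sin0 !subr0 => ->.
  by rewrite mulr_ge0 // subr_ge0 cos_le1.
have Hn (y : R) : `|sin y| <= `|y|.
  wlog y0 : y / 0 <= y => [W|].
    have [/W//|/ltW y0] := leP 0 y.
    by have := W (- y); rewrite sinN !normrN oppr_ge0; apply.
  rewrite [leRHS]ger0_norm // ler_norml H // andbT.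
  have [y1|/ltW y1] := leP y 1; last by rewrite (le_trans _ (sin_geN1 y))// lerN2.
  have : 0 <= sin y.
    by apply: sin_ge0_pi; rewrite y0 (le_trans y1)// (le_trans _ (pi_ge2 R))// ler1n.
  by apply: le_trans; rewrite oppr_le0.
rewrite {2}(_ : x = (x / 2) *+ 2); last by rewrite mulr2n -splitr.
rewrite cos_mulr2n cos2sin2.
have : sin (x / 2) ^+ 2 <= (x / 2) ^+ 2.
  by rewrite -(real_normK (num_real (sin _))) -(real_normK (num_real (x / 2))) ler_pXn2r ?nnegrE.
set S := sin _ ^+ 2 => h.
have -> : (1 - S) *+ 2 - 1 = 1 - 2 * S by rewrite mulr2n; ring.
have -> : x ^+ 2 / 2 = 2 * (x / 2) ^+ 2 by field.
by rewrite lerD2l lerN2 ler_pM2l.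
Qed.

(** * Support of a stable law on the scalars *)

Section sas_support.
Context {R : realType} {k : scalar_kind} (alpha : R).
Hypothesis alpha_gt0 : 0 < alpha.
Local Notation K := (scalars R k).
Context {d} {Omega : measurableType d} (P : probability Omega R).
Variables (X Y : Omega -> borel K) (kappa : R).
Hypothesis kappa_gt0 : 0 < kappa.
Hypotheses (sX : sas alpha P kappa X) (sY : sas alpha P kappa Y).
Hypothesis iXY : independent_pair P X Y.

Let mX : measurable_fun setT X. Proof. by have [] := sX. Qed.
Let mY : measurable_fun setT Y. Proof. by have [] := sY. Qed.

Lemma sas_comb (c1 c2 : K) (kap : R) : kappa * (kabs c1 `^ alpha + kabs c2 `^ alpha) = kap ->
  sas alpha P kap (fun w => c1 * (X w : K) + c2 * (Y w : K) : borel K).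
Proof.
move=> <-; rewrite mulrDr; apply: sas_add.
- exact: sas_scale.
- exact: sas_scale.
- exact: (independent_pair_comp (lipschitz_scale c1) (lipschitz_scale c2) iXY).
Qed.

Let near (Z : Omega -> borel K) (x : K) (e : R) := [set w | kabs ((Z w : K) - x) < e].
Let mball (x : K) (e : R) : measurable ([set y | kabs (y - x) < e] : set (borel K)).
Proof. by apply: sub_sigma_algebra; exact: (@open_rnorm_lt R k (K^o)). Qed.
Let mnear (Z : Omega -> borel K) (x : K) (e : R) : measurable_fun setT Z -> measurable (near Z x e).
Proof. by move=> mZ; exact: measurable_preim mZ (mball x e). Qed.

(** Under the condition on [c1] and [c2], [c1 * X + c2 * Y] has the law of [X]. Both moduli are then
    at most 1, so the errors of [X] near [x] and [Y] near [y] add up to less than [2 * e]. *)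
Let pos_comb (c1 c2 x y : K) (e : R) : kabs c1 `^ alpha + kabs c2 `^ alpha = 1 ->
  (0 < P (near X x e))%E -> (0 < P (near X y e))%E ->
  (0 < P (near X (c1 * x + c2 * y) (2 * e)))%E.
Proof.
move=> c12 px py.
have kle1 (c : K) : kabs c `^ alpha <= 1 -> kabs c <= 1.
  move=> h; rewrite leNgt; apply/negP => h1.
  have : (1 : R) `^ alpha < kabs c `^ alpha.
    by rewrite gt0_ltr_powR // nnegrE // kabs_ge0.
  by rewrite powR1 ltNge h.
have k1 : kabs c1 <= 1 by apply: kle1; rewrite -c12 lerDl powR_ge0.
have k2 : kabs c2 <= 1 by apply: kle1; rewrite -c12 lerDr powR_ge0.
have sW := @sas_comb c1 c2 kappa ltac:(by rewrite c12 mulr1).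
rewrite -(sas_same_law sW sX (mball _ _)).
have XY : same_law P Y P X by exact: sas_same_law sY sX.
apply: (@lt_le_trans _ _ (P (near X x e `&` near Y y e))).
  rewrite (iXY (mball x e) (mball y e)) (XY _ (mball y e)).
  by rewrite mule_gt0.
apply: le_measure; rewrite ?inE.
- by apply: measurableI; exact: mnear.
- by apply: mnear; have [] := sW.
move=> w [h1 h2]; rewrite /near /=.
have -> : c1 * (X w : K) + c2 * (Y w : K) - (c1 * x + c2 * y) =
    c1 * ((X w : K) - x) + c2 * ((Y w : K) - y).
  by rewrite !mulrBr opprD addrACA.
rewrite (le_lt_trans (kabsD _ _))// !kabsM mulr_natl mulr2n.
have := kabs_ge0 ((X w : K) - x); have := kabs_ge0 ((Y w : K) - y) => y0 x0.
apply: ltrD; [apply: le_lt_trans h1|apply: le_lt_trans h2]; rewrite ler_piMl //.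
Qed.

(** Countably many balls of radius [e] cover the scalars, so one of them meets a charged event in
    positive probability. *)
Let cover (e : R) (A : set Omega) : 0 < e -> measurable A -> (0 < P A)%E ->
  exists y, (0 < P (A `&` near X y e))%E.
Proof.
move=> e0 mA PA; have [D HD] := separable_seq (@separable_scalars R k).
have [|||n Pn] := @positive_cover _ _ _ P A (fun n => A `&` near X (D n) e) mA.
- by move=> n; apply: measurableI => //; exact: mnear.
- by move=> w Aw; have [n hn] := HD (X w) e e0; exists n.
- exact: PA.
by exists (D n).
Qed.

Let half : exists2 h : R, 0 < h & h `^ alpha = 2^-1.
Proof.
exists (2^-1 `^ alpha^-1); first by rewrite powR_gt0.
by rewrite -powRrM mulVf ?gt_eqF // powRr1.
Qed.

(* With [2 h ^ alpha = 1], [h X - h Y] has the law of [X], and it is small when [X]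
   and [Y] are close to the same point. *)
Let zero_support (e : R) : 0 < e -> (0 < P (near X 0 e))%E.
Proof.
move=> e0; have [h h0 hE] := half.
have [||y] := @cover (e / 2) setT _ measurableT _; first by rewrite divr_gt0.
  by rewrite probability_setT.
rewrite setTI => py.
have := @pos_comb (of_real k h) (- of_real k h) y y (e / 2) _ py py.
rewrite mulNr subrr mulrC divfK //; apply.
have -> : kabs (- of_real k h) = kabs (of_real k h) by rewrite -of_realN !kabs_of_real normrN.
by rewrite kabs_of_real gtr0_norm // hE; field.
Qed.

Let U w : R := re_part (X w).
Let V w : R := re_part (Y w).
Let mU : measurable_fun setT U. Proof. exact: measurableT_comp (@measurable_re_part R k) mX. Qed.
Let gtset (Z : Omega -> R) (u : R) : set Omega := [set w | u < Z w].
Let mgt (Z : Omega -> R) (u : R) : measurable_fun setT Z -> measurable (gtset Z u).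
Proof.
move=> mZ; rewrite (_ : gtset _ _ = Z @^-1` `]u, +oo[%classic); first exact: measurable_preim.
by apply/seteqP; split => w /=; rewrite in_itv /= andbT.
Qed.

Let re_char (t : R) : \int[P]_w cos (t * U w) = expR (- (kappa * `|t| `^ alpha)).
Proof.
have [_ /(_ t 0)] := sX; rewrite /expect_expi => -[+ _].
have -> : kabs (of_real k t + imag_unit R k * of_real k 0) = `|t|.
  by rewrite of_real0 mulr0 addr0 kabs_of_real.
by move=> <-; apply: eq_Rintegral => w _; rewrite mul0r addr0.
Qed.

(** By symmetry, if [U > 0] had probability 0 then so would [U < 0]; [U] would vanish almost surely
    and its characteristic function at 1 would be 1 instead of [exp (- kappa)]. *)
Let re_pos : exists2 u : R, 0 < u & (0 < P (gtset U u))%E.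
Proof.
have sN := @sas_scale R k alpha _ _ P (-1) kappa X sX.
have N1 : kabs (-1 : K) = 1 by rewrite -of_real1 -of_realN kabs_of_real normrN1.
rewrite N1 powR1 mulr1 in sN.
have mgtK (u : R) : measurable ([set x : borel K | u < re_part x]).
  rewrite (_ : mkset _ = @re_part R k @^-1` `]u, +oo[%classic).
    by apply: measurable_preim => //; exact: measurable_re_part.
  by apply/seteqP; split => w /=; rewrite in_itv /= andbT.
have pos0 : (0 < P (gtset U 0))%E.
  rewrite lt0e measure_ge0 andbT; apply/eqP => P0.
  have P0' : P (gtset (fun w => - U w) 0) = 0%E.
    rewrite -P0; have := sas_same_law sN sX (mgtK 0).
    rewrite /preimage /= => <-; congr (P _); apply/seteqP.
    by split => w /=; rewrite mulN1r re_partN.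
  have ae1 : {ae P, forall w, cos (1 * U w) = 1}.
    have [B [mB B0 sB]] : P.-negligible (gtset U 0 `|` gtset (fun w => - U w) 0).
      apply: negligibleU; apply/negligibleP => //; apply: mgt => //.
      exact: measurable_funN.
    exists B; split => //; apply: subset_trans sB.
    move=> w /= h; case: (ltrgt0P (U w)) => [|u0|u0]; [by left|by right; rewrite /gtset /= oppr_gt0|].
    by exfalso; apply: h; rewrite u0 mulr0 cos0.
  have := re_char 1; rewrite normr1 powR1 mulr1.
  have -> : \int[P]_w cos (1 * U w) = \int[P]_w 1.
    rewrite /Rintegral; congr fine; apply: ae_eq_integral => //.
    - apply/measurable_EFinP; apply: measurableT_comp measurable_cosR _.
      by apply: measurable_funM.
    - by apply: filterS ae1 => w /= -> _.
  rewrite Rint_cst -expR0 => /expR_inj/esym/eqP; rewrite oppr_eq0 => /eqP kap0.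
  by move: kappa_gt0; rewrite kap0 ltxx.
have [|||n Pn] := @positive_cover _ _ _ P _ (fun n => gtset U n.+1%:R^-1) (mgt 0 mU).
- by move=> n; exact: mgt.
- by move=> w /= /nat_inv_lt[n hn]; exists n.
- exact: pos0.
by exists n.+1%:R^-1; rewrite ?invr_gt0.
Qed.

Let re_grow (h u : R) : 0 < h -> h `^ alpha = 2^-1 ->
  (0 < P (gtset U u))%E -> (0 < P (gtset U (2 * h * u)))%E.
Proof.
move=> h0 hE pu.
have mgtK (v : R) : measurable ([set x : borel K | v < re_part x]).
  rewrite (_ : mkset _ = @re_part R k @^-1` `]v, +oo[%classic).
    by apply: measurable_preim => //; exact: measurable_re_part.
  by apply/seteqP; split => w /=; rewrite in_itv /= andbT.
have sW := @sas_comb (of_real k h) (of_real k h) kappa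
  ltac:(by rewrite kabs_of_real gtr0_norm // hE (_ : 2^-1 + 2^-1 = 1 :> R) ?mulr1 //; field).
have lW := sas_same_law sW sX (mgtK (2 * h * u)).
have XY : same_law P Y P X by exact: sas_same_law sY sX.
have -> : P (gtset U (2 * h * u)) = P (X @^-1` [set x : borel K | 2 * h * u < re_part x]) by [].
rewrite -lW; apply: (@lt_le_trans _ _ (P (X @^-1` [set x | u < re_part x] `&` Y @^-1` [set x | u < re_part x]))).
  by rewrite (iXY (mgtK u) (mgtK u)) (XY _ (mgtK u)) mule_gt0.
apply: le_measure; rewrite ?inE.
- by apply: measurableI; exact: measurable_preim.
- by apply: measurable_preim => //; have [] := sW.
move=> w [] /= h1 h2; rewrite re_partD !re_part_realM -mulrA mulr_natl mulr2n.
by rewrite ltrD // ltr_pM2l.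
Qed.

(* [h X + h Y] has the law of [X], and [2 h > 1] since [alpha > 1]. *)
Let gtset_unbounded (L : R) : 1 < alpha -> (0 < P (gtset U L))%E.
Proof.
move=> a1; have [h h0 hE] := half; have [u u0 pu] := re_pos.
have h1 : h < 1.
  rewrite ltNge; apply/negP => h1.
  have : (1 : R) `^ alpha <= h `^ alpha by rewrite ge0_ler_powR ?nnegrE // ltW.
  by rewrite powR1 hE invf_ge1 // leNgt ltr1n.
(* As [h < 1] and [alpha > 1], [1 / 2 = h ^ alpha = h * h ^ (alpha - 1) < h]. *)
have h2 : 1 < 2 * h.
  have : h `^ (alpha - 1) < 1 `^ (alpha - 1).
    by rewrite gt0_ltr_powR ?nnegrE ?subr_gt0 // ltW.
  rewrite powR1 => hh.
  have : h * h `^ (alpha - 1) < h * 1 by rewrite ltr_pM2l.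
  by rewrite mulr1 mulr_powRB1 ?(ltW h0) // hE -ltr_pdivrMl // mulr1.
have grow n : (0 < P (gtset U ((2 * h) ^+ n * u)))%E.
  by elim: n => [|n IH]; [rewrite expr0 mul1r|rewrite exprS -mulrA; exact: re_grow].
(* Bernoulli's inequality, which makes the thresholds reached by doubling exceed any [L]. *)
have bern n : 1 + n%:R * (2 * h - 1) <= (2 * h) ^+ n.
  elim: n => [|n IH]; first by rewrite mul0r addr0 expr0.
  rewrite exprS; apply: (@le_trans _ _ (2 * h * (1 + n%:R * (2 * h - 1)))); last first.
    by rewrite ler_pM2l // mulr_gt0.
  rewrite -subr_ge0 -(natr1 n).
  have -> : 2 * h * (1 + n%:R * (2 * h - 1)) - (1 + (n%:R + 1) * (2 * h - 1)) =
    n%:R * (2 * h - 1) ^+ 2 by ring.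
  by rewrite mulr_ge0 // sqr_ge0.
pose n := Num.truncn (`|L| / u / (2 * h - 1)).
have hn : L < (2 * h) ^+ n.+1 * u.
  apply: le_lt_trans (ler_norm L) _; rewrite -ltr_pdivrMr //.
  apply: lt_le_trans (bern _); rewrite -[ltLHS]add0r ltrD // -ltr_pdivrMr ?subr_gt0 //.
  exact: truncnS_gt.
apply: lt_le_trans (grow n.+1) _; apply: le_measure; rewrite ?inE; try exact: mgt.
by move=> w; rewrite /gtset /=; exact: lt_trans.
Qed.

Let big (L : R) : set Omega := [set w | L < kabs (X w : K)].
Let mbig (L : R) : measurable (big L).
Proof.
have mK : measurable_fun setT (fun w => kabs (X w : K)).
  have H := @measurable_rnorm R k (K^o) _ Omega X mX.
  exact: H.
rewrite (_ : big L = (fun w => kabs (X w : K)) @^-1` `]L, +oo[%classic); first exact: measurable_preim.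
by apply/seteqP; split => w /=; rewrite in_itv /= andbT.
Qed.

(* For [alpha <= 1], boundedness of [X] would give [1 - E cos (t U) = O(t ^ 2)],
   against [1 - exp (- kappa t ^ alpha)]. *)
Let sas_unbounded (L : R) : (0 < P (big L))%E.
Proof.
(* A larger [L] gives a smaller event; [L >= 1] will give [t <= 1]. *)
wlog L1 : L / 1 <= L => [W|].
  apply: lt_le_trans (W (Num.max L 1) _) _; first by rewrite le_max lexx orbT.
  apply: le_measure; rewrite ?inE //.
  by move=> w; rewrite /big /= gt_max => /andP[].
have [a1|a1] := ltP 1 alpha.
  apply: lt_le_trans (gtset_unbounded L a1) _; apply: le_measure; rewrite ?inE //; first exact: mgt.
  move=> w; rewrite /gtset /big /= => /lt_le_trans; apply.
  exact: le_trans (ler_norm _) (re_part_le _).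
rewrite lt0e measure_ge0 andbT; apply/eqP => P0.
have L0 : 0 < L by rewrite (lt_le_trans ltr01).
(* Small enough that [(1 - t ^+ 2 * L ^+ 2 / 2) * (1 + kappa * t)] exceeds 1: the linear gain in [t]
   beats the quadratic loss. *)
pose t := kappa / ((1 + kappa) * L ^+ 2).
have k1 : 0 < 1 + kappa by rewrite addr_gt0.
have L2 : 1 <= L ^+ 2 by rewrite exprn_ege1.
have L20 : 0 < L ^+ 2 by rewrite exprn_gt0.
have t0 : 0 < t by rewrite divr_gt0 // mulr_gt0.
have t1 : t <= 1.
  rewrite ler_pdivrMr ?mulr_gt0 // mul1r (@le_trans _ _ (1 + kappa)) //; first by rewrite lerDr.
  by rewrite ler_peMr // ltW.
have lower : 1 - t ^+ 2 * L ^+ 2 / 2 <= \int[P]_w cos (t * U w).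
  have mtU : measurable_fun setT (fun w => t * U w) by exact: measurable_funM.
  pose c := 1 - t ^+ 2 * L ^+ 2 / 2.
  have bI := bounded_measurable_indic (R := R) (mbig L).
  (* On [big L] the bound on the cosine can fail by at most 2; the indicator pays for it and
     integrates to 0 since [big L] is assumed null. *)
  have b2I : bounded_measurable (fun w => (-2) * (\1_(big L) w : R)).
    by apply: bounded_measurableM => //; exact: bounded_measurable_cst.
  have := @le_Rint _ _ _ P _ _ (bounded_measurableD (bounded_measurable_cst c) b2I) (bounded_measurable_cos mtU).
  rewrite (RintD _ (bounded_measurable_cst c) b2I) Rint_cst (RintZ _ _ bI) Rint_indic // P0 mulr0 addr0.
  apply => w; rewrite indicE; case: (boolP (w \in big L)) => [_|].
    rewrite mulr1 (@le_trans _ _ (-1)) ?cos_geN1 // /c.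
    have : 0 <= t ^+ 2 * L ^+ 2 / 2 by rewrite divr_ge0 // mulr_ge0 // sqr_ge0.
    by move=> ?; lra.
  rewrite notin_setE /big /= => /negP; rewrite -leNgt => XL.
  rewrite mulr0 addr0 (le_trans _ (cos_ge _))// /c lerD2l lerN2 ler_pM2r ?invr_gt0 //.
  rewrite exprMn ler_pM2l ?exprn_gt0 // -(real_normK (num_real (U w))) ler_pXn2r ?nnegrE //.
    exact: le_trans (re_part_le _) XL.
  exact: ltW.
move: lower; rewrite re_char gtr0_norm //.
have ta : t <= t `^ alpha by apply: ger1_powR => //; rewrite t0.
have kt : 0 < 1 + kappa * t by rewrite addr_gt0 // mulr_gt0.
(* For [t <= 1] and [alpha <= 1], [t <= t ^ alpha], and [1 + y <= exp y] at [y = kappa * t]. *)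
have up : expR (- (kappa * t `^ alpha)) <= (1 + kappa * t)^-1.
  rewrite expRN lef_pV2 ?posrE ?expR_gt0 //.
  apply: le_trans (expR_ge1Dx _) _; rewrite ler_expR.
  by rewrite ler_pM2l.
move=> /le_trans/(_ up); rewrite -[(1 + kappa * t)^-1]div1r ler_pdivlMr //.
apply/negP; rewrite -ltNge.
have key : t * ((1 + kappa) * L ^+ 2) = kappa by rewrite /t divfK // gt_eqF // mulr_gt0.
set q := t * L ^+ 2 in key *.
have E : t ^+ 2 * L ^+ 2 = t * q by rewrite /q; ring.
have q0 : 0 < q by rewrite mulr_gt0.
have qk : (1 + kappa) * q = kappa by rewrite -[RHS]key /q; ring.
rewrite E -subr_gt0.
have -> : (1 - t * q / 2) * (1 + kappa * t) - 1 = t * (kappa - q * (1 + kappa * t) / 2) by field.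
rewrite mulr_gt0 // subr_gt0 ltr_pdivrMr //.
apply: (@le_lt_trans _ _ (q * (1 + kappa))).
  by rewrite ler_pM2l // lerD2l ler_piMr // ltW.
by rewrite mulrC qk ltr_pMr // ltr1n.
Qed.

(* Take [y] in the support with [|y| > |x|]; the law of [X] is that of
   [(x / y) X + b Y] for some [b], and [0] is in the support of [Y]. *)
Lemma sas_full_support (x : K) (e : R) : 0 < e ->
  (0 < P (X @^-1` [set y : K | (kabs (y - x) < e)%R]))%E.
Proof.
move=> e0.
have [x0|xn0] := eqVneq (kabs x) 0.
  have -> : x = 0 by apply/normr0_eq0; rewrite kabsE x0 of_real0.
  exact: zero_support.
have xgt : 0 < kabs x by rewrite lt_neqAle eq_sym xn0 kabs_ge0.
have e2 : 0 < e / 2 by rewrite divr_gt0.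
(* The margin [e / 2] above [|x|] absorbs the distance from the sampled value to [y], so that
   [|y| > |x|]. *)
have [y py] := cover e2 (mbig (kabs x + e / 2)) (sas_unbounded (kabs x + e / 2)).
have py' : (0 < P (near X y (e / 2)))%E.
  apply: lt_le_trans py _; apply: le_measure; rewrite ?inE; [|exact: mnear|exact: subIsetr].
  by apply: measurableI => //; exact: mnear.
have xy : kabs x < kabs y.
  have [w [/= w1 w2]] : (big (kabs x + e / 2) `&` near X y (e / 2)) !=set0.
    by apply/set0P/eqP => E; move: py; rewrite E measure0 ltxx.
  have := kabsD ((X w : K) - y) y; rewrite subrK => h.
  have := lt_le_trans w1 h; rewrite -ltrBlDr => h3.
  rewrite -(ltrD2l (kabs ((X w : K) - y))); apply: lt_le_trans _ h.
  by apply: lt_trans _ w1; rewrite addrC ltrD2l.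
have y0 : 0 < kabs y by exact: lt_trans xgt xy.
have yn0 : y != 0.
  by apply/eqP => E; move: y0; rewrite E /kabs normr0 /re_part; case: (k); rewrite /= ltxx.
pose a := kabs x / kabs y.
have a0 : 0 < a by rewrite divr_gt0.
have a1 : a <= 1 by rewrite ler_pdivrMr // mul1r ltW.
have aa1 : a `^ alpha <= 1.
  have : a `^ alpha <= 1 `^ alpha by rewrite ge0_ler_powR ?nnegrE // ltW.
  by rewrite powR1.
pose b := (1 - a `^ alpha) `^ alpha^-1.
have bE : b `^ alpha = 1 - a `^ alpha.
  by rewrite /b -powRrM mulVf ?gt_eqF // powRr1 // subr_ge0.
have kxy : kabs (x / y) = a.
  have kn : kabs y != 0 by rewrite gt_eqF.
  by apply: (mulIf kn); rewrite -kabsM divfK // /a divfK // gt_eqF.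
have := @pos_comb (x / y) (of_real k b) y 0 (e / 2) _ py' (zero_support e2).
have eE : 2 * (e / 2) = e by field.
rewrite mulr0 addr0 divfK // eE; apply.
by rewrite kabs_of_real ger0_norm ?powR_ge0 // bE kxy addrC subrK.
Qed.
End sas_support.

(** Turns an identity valid on the convergence set, of probability one, into an equality of
    probabilities. *)
Lemma eq_prob_on {R : realType} {d} {Omega : measurableType d} (P : probability Omega R)
    (D A B : set Omega) : measurable D -> measurable A -> measurable B -> P D = 1%E ->
  A `&` D = B `&` D -> P A = P B.
Proof.
move=> mD mA mB PD AB.
have H C : measurable C -> P C = P (C `&` D).
  move=> mC.
  have PDc : P (~` D) = 0%E by rewrite probability_setC // PD subee.
  rewrite -[in LHS](setIT C) -(setUv D) setIUr measureU.
  - rewrite -[RHS]adde0; congr (_ + _)%E; apply/eqP; rewrite eq_le measure_ge0 andbT -PDc.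
    by apply: le_measure; rewrite ?inE; [apply: measurableI => //|..]; try exact: measurableC; exact: subIsetr.
  - exact: measurableI.
  - by apply: measurableI => //; exact: measurableC.
  - by rewrite setIACA setICr setI0.
by rewrite (H A) // (H B) // AB.
Qed.

Lemma measurable_if {d d'} {U : measurableType d} {T : measurableType d'} (D : set U)
    (f : U -> T) (t : T) : measurable D -> measurable_fun setT f ->
  measurable_fun setT (fun x => if pselect (D x) then f x else t).
Proof.
move=> mD mf _ A mA; rewrite setTI.
have [At|At] := pselect (A t).
  rewrite (_ : _ @^-1` _ = (D `&` f @^-1` A) `|` ~` D).
    by apply: measurableU; [apply: measurableI => //; exact: measurable_preim|exact: measurableC].
  apply/seteqP; split => x /=; case: pselect => Dx //=; [by left|by right|by case => [[]|]].
rewrite (_ : _ @^-1` _ = D `&` f @^-1` A).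
  by apply: measurableI => //; exact: measurable_preim.
by apply/seteqP; split => x /=; case: pselect => Dx //= [].
Qed.

(** * Series with random coefficients *)

Section convergence_set.
Context {R : realType} {k : scalar_kind} {E : completeNormedModType (scalars R k)}.
Hypothesis sepE : separable E.

(** The Cauchy criterion with the countably many tolerances [m.+1%:R^-1], so that the convergence
    set is built from countable unions and intersections. *)
Lemma cvg_cauchyP (f : nat -> E) : cvgn f <->
  forall m : nat, exists N, forall p q, (N <= p)%N -> (N <= q)%N -> rnorm (f p - f q) < m.+1%:R^-1.
Proof.
split=> [/cvg_rnormP fl m|H].
  have m0 : 0 < m.+1%:R^-1 / 2 :> R by rewrite divr_gt0 ?invr_gt0.
  have [N _ HN] := fl _ m0; exists N => p q Np Nq.
  have h1 := HN p Np; have h2 := HN q Nq; rewrite /= in h1 h2.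
  apply: le_lt_trans (rnorm_tri _ (lim (f @ \oo)) _) _.
  by rewrite [ltRHS]splitr [rnorm (f p - _)]rnormB ltrD.
apply/cauchy_cvgP/cauchy_exP => e e0.
have ee : e = of_real k (re_part e) by apply/ge0_of_real/ltW.
have re0 : 0 < re_part e by rewrite -(ltr_of_real k) -ee of_real0.
have [m hm] := nat_inv_lt re0; have [N HN] := H m.
exists (f N); exists N => // p /= Np.
by rewrite -ball_normE /= rnormE ee ltr_of_real (lt_trans _ hm) // HN.
Qed.

Lemma measurable_borelN {d} {U : measurableType d} (f : U -> borel E) :
  measurable_fun setT f -> measurable_fun setT (fun w => - (f w : E) : borel E).
Proof.
move=> mf; apply: (measurableT_comp (f := (fun x : E => - x) : borel E -> borel E)) mf.
by apply: (@lipschitz_measurable R k E E _ 1) => x y; rewrite mul1r -opprD rnormN.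
Qed.

Lemma measurable_cvg_set {d} {U : measurableType d} (F : nat -> U -> borel E) :
  (forall n, measurable_fun setT (F n)) -> measurable [set x | cvgn (fun n => F n x : E)].
Proof.
move=> mF.
pose C (m p q : nat) := [set x | rnorm ((F p x : E) - F q x) < m.+1%:R^-1].
have mC m p q : measurable (C m p q).
  rewrite (_ : C m p q = (fun x => rnorm ((F p x : E) - F q x)) @^-1` `]-oo, m.+1%:R^-1[%classic); last first.
    by apply/seteqP; split => w /=; rewrite in_itv.
  apply: measurable_preim => //.
  apply: (@measurable_rnorm R k E _ U (fun x => (F p x : E) - (F q x : E) : borel E)).
  by apply: (measurable_borelD sepE) => //; exact: measurable_borelN.
have -> : [set x | cvgn (fun n => F n x : E)] =
    \bigcap_m \bigcup_N \bigcap_(p in [set p | (N <= p)%N]) \bigcap_(q in [set q | (N <= q)%N]) C m p q.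
  apply/seteqP; split => x /= => [/cvg_cauchyP H m _|H].
    by have [N HN] := H m; exists N => // p Np q Nq; exact: HN.
  apply/cvg_cauchyP => m; have [N _ HN] := H m Logic.I.
  by exists N => p q Np Nq; exact: (HN p Np q Nq).
apply: bigcapT_measurable => m; apply: bigcupT_measurable => N.
apply: bigcap_measurable => [|p _]; first by exists N => /=.
by apply: bigcap_measurable => [|q _]; first by exists N => /=.
Qed.
End convergence_set.

Section series_map.
Context {R : realType} {k : scalar_kind} {E : completeNormedModType (scalars R k)}.
Hypothesis sepE : separable E.
Local Notation K := (scalars R k).
Variable u : int -> E.
Local Notation path := (@path_space int _ (borel K)).

Definition pos_sum (x : path) (n : nat) : E := \sum_(0 <= i < n) (x i%:Z : K) *: u i%:Z.
Definition neg_sum (x : path) (n : nat) : E :=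
  \sum_(0 <= i < n) (x (- i.+1%:Z) : K) *: u (- i.+1%:Z).
(** The halves converge separately, matching the two unrelated truncation levels of
    [bilateral_series_to]. *)
Definition cvg_paths : set path := [set x | cvgn (pos_sum x) /\ cvgn (neg_sum x)].
Definition series_map (x : path) : E :=
  if pselect (cvg_paths x) then limn (pos_sum x) + limn (neg_sum x) else 0.

Lemma series_mapE x : cvg_paths x -> series_map x = limn (pos_sum x) + limn (neg_sum x).
Proof. by rewrite /series_map; case: pselect. Qed.

Lemma measurable_term (i : int) : measurable_fun setT (fun x : path => (x i : K) *: u i : borel E).
Proof.
apply: (measurableT_comp (f := (fun c : K => c *: u i) : borel K -> borel E)) (measurable_coord i).
apply: (@lipschitz_measurable R k (K^o) E (fun c => c *: u i) (rnorm (u i))) => x y.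
by rewrite rnorm_scalelB mulrC.
Qed.

Lemma measurable_pos_sum n : measurable_fun setT (fun x => pos_sum x n : borel E).
Proof. by apply: (measurable_borel_sum sepE) => i; exact: measurable_term. Qed.

Lemma measurable_neg_sum n : measurable_fun setT (fun x => neg_sum x n : borel E).
Proof. by apply: (measurable_borel_sum sepE) => i; exact: measurable_term. Qed.

Lemma measurable_cvg_paths : measurable cvg_paths.
Proof.
apply: measurableI.
  exact: (@measurable_cvg_set R k E sepE _ path (fun n x => pos_sum x n) measurable_pos_sum).
exact: (@measurable_cvg_set R k E sepE _ path (fun n x => neg_sum x n) measurable_neg_sum).
Qed.

Lemma cvg_series_map x : cvg_paths x -> pos_sum x n + neg_sum x n @[n --> \oo] --> series_map x.
Proof.
move=> Dx; rewrite series_mapE //; have [c1 c2] := Dx; exact: cvgD.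
Qed.

Lemma measurable_series_map : measurable_fun setT (series_map : path -> borel E).
Proof.
(* Cut off outside [cvg_paths], the partial sums converge at every path, as [measurable_borel_cvg]
   requires. *)
pose F n (x : path) : borel E := if pselect (cvg_paths x) then pos_sum x n + neg_sum x n else 0.
apply: (@measurable_borel_cvg R k E sepE _ path F).
  move=> n; apply: (measurable_if (T := borel E) (f := fun x => pos_sum x n + neg_sum x n : borel E)).
    exact: measurable_cvg_paths.
  exact: (measurable_borelD sepE (measurable_pos_sum n) (measurable_neg_sum n)).
move=> x; rewrite /F; have [Dx|Dx] := pselect (cvg_paths x).
  have := cvg_series_map Dx.
  by apply: cvg_trans; apply: near_eq_cvg; apply: nearW => n; case: pselect.
have -> : series_map x = 0 by rewrite /series_map; case: pselect.
rewrite (_ : (fun n => _) = (fun=> 0)); first exact: cvg_cst.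
by apply/funext => n; case: pselect.
Qed.

Lemma series_map_bilateral x : cvg_paths x ->
  bilateral_series_to (fun n => (x n : K) *: u n) (series_map x).
Proof.
move=> Dx; have [c1 c2] := Dx; rewrite /bilateral_series_to /bilateral_psum series_mapE //.
apply: (@cvgD _ _ _ _ _ (fun N : nat * nat => pos_sum x N.1) (fun N => neg_sum x N.2)).
  exact: cvg_comp (@cvg_fst _ _ _ _ _) c1.
exact: cvg_comp (@cvg_snd _ _ _ _ _) c2.
Qed.

Lemma series_map_lim x (l : E) (l' : E) :
  pos_sum x n @[n --> \oo] --> l -> neg_sum x n @[n --> \oo] --> l' ->
  cvg_paths x /\ series_map x = l + l'.
Proof.
move=> c1 c2.
have Dx : cvg_paths x by split; apply/cvg_ex; [exists l|exists l'].
split => //; rewrite series_mapE //.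
by congr (_ + _); apply: cvg_lim.
Qed.

Lemma series_map_comb (a b : K) x y : cvg_paths x -> cvg_paths y ->
  cvg_paths (fun i => a * (x i : K) + b * (y i : K)) /\
  series_map (fun i => a * (x i : K) + b * (y i : K)) = a *: series_map x + b *: series_map y.
Proof.
move=> Dx Dy; have [x1 x2] := Dx; have [y1 y2] := Dy.
have := @series_map_lim (fun i => a * (x i : K) + b * (y i : K))
  (a *: limn (pos_sum x) + b *: limn (pos_sum y)) (a *: limn (neg_sum x) + b *: limn (neg_sum y)).
have E1 : pos_sum (fun i => a * (x i : K) + b * (y i : K)) = (fun n => a *: pos_sum x n + b *: pos_sum y n).
  apply/funext => n; rewrite /pos_sum !scaler_sumr -big_split /=; apply: eq_bigr => i _.
  by rewrite scalerDl !scalerA.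
have E2 : neg_sum (fun i => a * (x i : K) + b * (y i : K)) = (fun n => a *: neg_sum x n + b *: neg_sum y n).
  apply/funext => n; rewrite /neg_sum !scaler_sumr -big_split /=; apply: eq_bigr => i _.
  by rewrite scalerDl !scalerA.
have cc (f g : nat -> E) : cvgn f -> cvgn g -> a *: f n + b *: g n @[n --> \oo] --> a *: limn f + b *: limn g.
  by move=> cf cg; apply: cvgD; apply: cvgZr.
rewrite E1 E2 => /(_ (cc _ _ x1 y1) (cc _ _ x2 y2))[D ->]; split => //.
rewrite !series_mapE //.
by rewrite !scalerDr addrACA.
Qed.

Variable T : {linear E -> E}.
Hypothesis Tc : continuous T.
Hypothesis Tu : forall n : int, T (u n) = u (n - 1).

Definition path_shift (n : int) (x : path) : path := fun i => x (i + n).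

(** [T] lowers the index of each [u n], so it moves the coefficient [x n] to place [n - 1]. One term
    crosses between the halves: [x 0 *: u 0] leaves the nonnegative half and, after [T], opens the
    negative one. *)
Lemma series_map_shift x : cvg_paths x ->
  cvg_paths (path_shift 1 x) /\ series_map (path_shift 1 x) = T (series_map x).
Proof.
move=> Dx; have [c1 c2] := Dx.
have E1 : pos_sum (path_shift 1 x) = (fun n => T (pos_sum x n.+1 - (x 0 : K) *: u 0)).
  apply/funext => n; rewrite /pos_sum big_nat_recl // addrAC subrr add0r raddf_sum /=.
  apply: eq_bigr => i _; rewrite linearZ /= Tu /path_shift.
  by rewrite -addn1 PoszD addrK.
have E2 n : neg_sum (path_shift 1 x) n.+1 = T ((x 0 : K) *: u 0 + neg_sum x n).
  rewrite /neg_sum big_nat_recl // raddfD raddf_sum /= linearZ /= Tu; congr (_ + _).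
  apply: eq_bigr => i _; rewrite linearZ /= Tu /path_shift.
  have -> : - i.+2%:Z + 1 = - i.+1%:Z by lia.
  by have -> : - i.+1%:Z - 1 = - i.+2%:Z by lia.
have cT (f : nat -> E) (l : E) : f n @[n --> \oo] --> l -> T (f n) @[n --> \oo] --> T l.
  by move=> fl V /(@Tc l) h; exact: (fl _ h).
have l1 : pos_sum (path_shift 1 x) n @[n --> \oo] --> T (limn (pos_sum x) - (x 0 : K) *: u 0).
  rewrite E1; apply: cT; apply: cvgB; last exact: cvg_cst.
  by rewrite (@cvg_shiftS _ (pos_sum x)).
have l2 : neg_sum (path_shift 1 x) n @[n --> \oo] --> T ((x 0 : K) *: u 0 + limn (neg_sum x)).
  rewrite -cvg_shiftS; under eq_fun do rewrite E2.
  by apply: cT; apply: cvgD; [exact: cvg_cst|].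
have [D ->] := series_map_lim l1 l2; split => //.
by rewrite -raddfD addrA subrK series_mapE.
Qed.

Lemma series_map_iter_shift (n : nat) x : cvg_paths x ->
  series_map (path_shift n%:Z x) = iter n T (series_map x).
Proof.
move=> Dx.
suff [] : cvg_paths (path_shift n%:Z x) /\ series_map (path_shift n%:Z x) = iter n T (series_map x) by [].
elim: n => [|n [D IH]] /=.
  by rewrite (_ : path_shift 0 x = x) //; apply/funext => i; rewrite /path_shift addr0.
have -> : path_shift n.+1%:Z x = path_shift 1 (path_shift n%:Z x).
  by apply/funext => i; rewrite /path_shift; congr x; lia.
by rewrite -IH; exact: series_map_shift.
Qed.
End series_map.

Lemma sum_nat_truncate {V : nmodType} (F G : nat -> V) (N n : nat) : (N <= n)%N ->
  (forall i, (i < N)%N -> F i = G i) -> (forall i, (N <= i)%N -> F i = 0) ->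
  \sum_(0 <= i < n) F i = \sum_(0 <= i < N) G i.
Proof.
move=> Nn H1 H2; rewrite (@big_cat_nat _ _ _ N) //=.
have -> : \sum_(N <= i < n) F i = 0.
  by rewrite big_nat_cond big1 // => i /andP[/andP[Ni _] _]; exact: H2.
rewrite addr0 big_nat_cond [RHS]big_nat_cond; apply: eq_bigr => i /andP[/andP[_ iN] _].
exact: H1.
Qed.

(** * Finite windows and tails of a path *)

Section finite_paths.
Context {R : realType} {k : scalar_kind} {E : completeNormedModType (scalars R k)}.
Local Notation K := (scalars R k).
Variable u : int -> E.
Local Notation path := (@path_space int _ (borel K)).

(** Asymmetric on purpose: these are exactly the indices in [pos_sum _ N] and [neg_sum _ N], the
    latter running from -1 down to [- N]. *)
Definition window (N : nat) : pred int := [pred i : int | (- N%:Z <= i) && (i < N%:Z)].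

Lemma pos_sum_window (x y : path) (N n : nat) : (N <= n)%N ->
  (forall i, window N i -> x i = y i) -> (forall i, ~~ window N i -> x i = 0) ->
  pos_sum u x n = pos_sum u y N.
Proof.
move=> Nn H1 H2; apply: sum_nat_truncate => // i iN; [rewrite H1|rewrite H2 ?scale0r] => //; rewrite /window /=; lia.
Qed.

Lemma neg_sum_window (x y : path) (N n : nat) : (N <= n)%N ->
  (forall i, window N i -> x i = y i) -> (forall i, ~~ window N i -> x i = 0) ->
  neg_sum u x n = neg_sum u y N.
Proof.
move=> Nn H1 H2; apply: sum_nat_truncate => // i iN; [rewrite H1|rewrite H2 ?scale0r] => //; rewrite /window /=; lia.
Qed.

(** The part [z] of [x] inside the window has eventually constant partial sums, hence converges to
    the finite sum; [y] is [x - z], and the series map is linear on convergent paths. *)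
Lemma series_map_tail (N : nat) (x : path) : cvg_paths u x ->
  let y : path := fun i => if window N i then 0 else x i in
  cvg_paths u y /\ series_map u x = pos_sum u x N + neg_sum u x N + series_map u y.
Proof.
move=> Dx y.
pose z : path := fun i => if window N i then x i else 0.
have z1 : pos_sum u z n @[n --> \oo] --> pos_sum u x N.
  apply: cvg_near_cst; exists N => // n /= Nn; apply: pos_sum_window => // i; rewrite /z.
    by move->.
  by move/negbTE ->.
have z2 : neg_sum u z n @[n --> \oo] --> neg_sum u x N.
  apply: cvg_near_cst; exists N => // n /= Nn; apply: neg_sum_window => // i; rewrite /z.
    by move->.
  by move/negbTE ->.
have [Dz zE] := series_map_lim z1 z2.
have [] := series_map_comb 1 (-1) Dx Dz.
have -> : (fun i => 1 * (x i : K) + -1 * (z i : K)) = y.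
  by apply/funext => i; rewrite mul1r mulN1r /y /z; case: ifP => _; rewrite ?subrr ?subr0.
move=> Dy ->; split => //.
by rewrite zE scale1r scaleN1r addrC subrK.
Qed.

(** The vectors attaining a constant window sum from some size on form a linear subspace, and it
    contains each [u m] through the path that is 1 at [m] and 0 elsewhere. *)
Lemma lspan_paths (x : E) : lspan (range u) x ->
  exists (z : path) (N0 : nat), forall n, (N0 <= n)%N -> pos_sum u z n + neg_sum u z n = x.
Proof.
pose S (x : E) := exists (z : path) (N0 : nat), forall n, (N0 <= n)%N -> pos_sum u z n + neg_sum u z n = x.
have S0 : S 0.
  exists (fun=> 0), 0%N => n _; rewrite /pos_sum /neg_sum !big1 ?addr0 // => i _; exact: scale0r.
have SD a b : S a -> S b -> S (a + b).
  move=> [z [N H]] [z' [N' H']]; exists (fun i => (z i : K) + (z' i : K)), (maxn N N') => n.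
  rewrite geq_max => /andP[Nn N'n]; rewrite -(H n Nn) -(H' n N'n) addrACA; congr (_ + _).
    by rewrite -big_split /=; apply: eq_bigr => i _; rewrite scalerDl.
  by rewrite -big_split /=; apply: eq_bigr => i _; rewrite scalerDl.
have SZ (c : K) a : S a -> S (c *: a).
  move=> [z [N H]]; exists (fun i => c * (z i : K)), N => n Nn; rewrite -(H n Nn) scalerDr.
  by rewrite /pos_sum /neg_sum !scaler_sumr; congr (_ + _); apply: eq_bigr => i _; rewrite scalerA.
have Su m : S (u m).
  exists (fun i => (i == m)%:R), (absz m).+1 => n mn.
  case: m mn => [m mn|m mn].
    rewrite /neg_sum big1 => [|i _]; last by rewrite (_ : (_ == _) = false) ?scale0r //; lia.
    rewrite addr0 /pos_sum (big_cat_nat (n := m)) //=; last by rewrite ltnW.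
    rewrite big_nat_cond big1 ?add0r => [|i /andP[/andP[_ im] _]]; last first.
      by rewrite (_ : (_ == _) = false) ?scale0r //; lia.
    rewrite big_ltn // eqxx scale1r big_nat_cond big1 ?addr0 // => i /andP[/andP[mi _] _].
    by rewrite (_ : (_ == _) = false) ?scale0r //; lia.
  rewrite /pos_sum big1 ?add0r => [|i _]; last by rewrite (_ : (_ == _) = false) ?scale0r //; lia.
  rewrite /neg_sum (big_cat_nat (n := m)) //=; last by rewrite ltnW // ltnW.
  rewrite big_nat_cond big1 ?add0r => [|i /andP[/andP[_ im] _]]; last first.
    by rewrite (_ : (_ == _) = false) ?scale0r //; lia.
  rewrite big_ltn; last by rewrite ltnW.
  rewrite (_ : - m.+1%:Z = Negz m) // eqxx scale1r big_nat_cond big1 ?addr0 // => i /andP[/andP[mi _] _].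
  by rewrite (_ : (_ == _) = false) ?scale0r //; lia.
move=> [n [c [y [yu ->]]]]; elim/big_ind : _ => // i _; apply: SZ.
by have [m _ <-] := yu i; exact: Su.
Qed.
End finite_paths.

Lemma mutually_independent_comp {R : realType} {d d1 d2} {Omega : measurableType d}
    {T1 : measurableType d1} {T2 : measurableType d2} {I : choiceType}
    (P : probability Omega R) (X : I -> Omega -> T1) (g : T1 -> T2) :
  measurable_fun setT g -> mutually_independent P X -> mutually_independent P (fun i => g \o X i).
Proof.
by move=> mg iX s B us mB; apply: (iX s (fun i => g @^-1` B i) us) => i; exact: measurable_preim.
Qed.

(** The imaginary part of [x] is the real part of [- i * x], so almost sure convergence need only be
    proved for real parts of multiples. *)
Lemma scalar_reconstruct {R : realType} {k : scalar_kind} (x : scalars R k) :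
  x = of_real k (re_part (1 * x)) + imag_unit R k * of_real k (re_part (- imag_unit R k * x)).
Proof.
rewrite mul1r /of_real /re_part /imag_unit; move: x; case: k => [x|[a b]] /=.
  by rewrite mul0r addr0.
suff : Complex a b = Complex a 0 + Complex 0 1 * Complex (- 0 * a - - 1 * b) 0 :> R[i] by [].
by apply/eqP; rewrite eq_complex /= oppr0 mulN1r !mul0r !mulr0 !mul1r !opprK !subr0 !addr0 !add0r !eqxx.
Qed.

(** * Almost sure convergence from stable type *)

Section almost_sure_convergence.
Context {R : realType} {k : scalar_kind} {E : completeNormedModType (scalars R k)} (alpha : R).
Hypotheses (alpha_gt0 : 0 < alpha) (E_type : stable_type E alpha).
Local Notation K := (scalars R k).
Context {d} {Omega : measurableType d} (P : probability Omega R) (kappa : R).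
Hypothesis kappa_gt0 : 0 < kappa.
Variable X : nat -> Omega -> borel K.
Hypotheses (iX : mutually_independent P X) (sX : forall n, sas alpha P kappa (X n)).
Variable v : nat -> E.
Hypothesis v_sum : (\sum_(0 <= n <oo) (rnorm (v n) `^ alpha)%:E < +oo)%E.

(* After normalization the real part of [c * X n] is a [theta n] of [stable_type]. *)
Let re_series_cvg (c : K) :
  {ae P, forall w, cvgn (series (fun n => of_real k (re_part (c * (X n w : K))) *: v n))}.
Proof.
(* This case does occur: over the reals, [c = - imag_unit] is 0. *)
have [c0|cn0] := eqVneq (kabs c) 0.
  have -> : c = 0 by apply/normr0_eq0; rewrite kabsE c0 of_real0.
  apply: aeW => w; rewrite (_ : series _ = (fun=> 0)); first exact: is_cvg_cst.
  apply/funext => n; rewrite /series /= big1 // => i _.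
  have -> : re_part (0 * (X i w : K)) = 0 by rewrite -{1}(of_real0 R k) re_part_realM mul0r.
  by rewrite of_real0 scale0r.
have cgt : 0 < kabs c by rewrite lt_neqAle eq_sym cn0 kabs_ge0.
pose kap := kappa * kabs c `^ alpha.
have kap0 : 0 < kap by rewrite mulr_gt0 // powR_gt0.
pose r := kap `^ alpha^-1.
have r0 : 0 < r by exact: powR_gt0.
have rE : r `^ alpha = kap by rewrite /r -powRrM mulVf ?gt_eqF // powRr1 // ltW.
pose g (x : borel K) : R := r^-1 * re_part (c * (x : K)).
have mg : measurable_fun setT g.
  apply: measurable_funM => //; apply: (measurableT_comp (@measurable_re_part R k)).
  exact: lipschitz_scale.
have mX n : measurable_fun setT (X n) by have [] := sX n.
have mth n : measurable_fun setT (g \o X n) by exact: measurableT_comp mg (mX n).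
pose theta n : {RV P >-> R} := mfun_of (mth n).
have sc n := sas_scale c (sX n).
(* The factor [r] divided out of the coefficients is put on the vectors, multiplying the sum by
   [r ^ alpha]. *)
have x_sum : (\sum_(0 <= n <oo) (rnorm (of_real k r *: v n) `^ alpha)%:E < +oo)%E.
  under eq_eseriesr => n _.
    rewrite rnormZ kabs_of_real (gtr0_norm r0) powRM ?rnorm_ge0 ?(ltW r0) // rE EFinM.
    over.
  rewrite nneseriesZl //; last by move=> n _; rewrite lee_fin powR_ge0.
  by rewrite lte_mul_pinfty // lee_fin ltW.
have h1 : mutually_independent P (fun n => (theta n : Omega -> R)).
  exact: mutually_independent_comp mg iX.
have h2 n : same_law P (theta n) P (theta 0%N).
  by move=> A mA; apply: (sas_same_law (sX n) (sX 0%N) (measurable_preim mg mA)).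
have h3 n (t : R) : expect_expi P (fun w => t * theta n w) = Complex (expR (- (`|t| `^ alpha))) 0.
  have [_ /(_ (t * r^-1) 0)] := sc n.
  have -> : (fun w => t * r^-1 * re_part (c * (X n w : K)) + 0 * im_part (c * (X n w : K))) =
      (fun w => t * theta n w).
    by apply/funext => w; rewrite mul0r addr0 mulrA.
  move=> ->; have -> : kabs (of_real k (t * r^-1) + imag_unit R k * of_real k 0) = `|t| * r^-1.
    by rewrite of_real0 mulr0 addr0 kabs_of_real normrM normfV (gtr0_norm r0).
  rewrite powRM ?invr_ge0 ?(ltW r0) // -/kap.
  have -> : r^-1 `^ alpha = kap^-1.
    have kn : kap != 0 by rewrite gt_eqF.
    apply: (mulIf kn); rewrite mulVf // -{1}rE -powRM ?invr_ge0 ?(ltW r0) //.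
    by rewrite mulVf ?gt_eqF // powR1.
  by rewrite mulrCA mulfV ?gt_eqF // mulr1.
have := E_type x_sum h1 h2 h3; apply: filterS => w.
rewrite (_ : series _ = series (fun n => of_real k (re_part (c * (X n w : K))) *: v n)) //.
apply/funext => n; apply: eq_bigr => i _ /=.
rewrite scalerA -of_realM; congr (of_real k _ *: _).
by rewrite /theta /g /= mulrC mulVKf ?gt_eqF.
Qed.

Lemma stable_series_cvg :
  {ae P, forall w, cvgn (fun n => \sum_(0 <= i < n) (X i w : K) *: v i)}.
Proof.
have := re_series_cvg (- imag_unit R k); have := re_series_cvg 1.
apply: filterS2 => w c1 c2.
rewrite (_ : (fun n => _) = (fun n => series (fun n => of_real k (re_part (1 * (X n w : K))) *: v n) n +
   imag_unit R k *: series (fun n => of_real k (re_part (- imag_unit R k * (X n w : K))) *: v n) n)).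
  by apply: is_cvgD => //; exact: is_cvgZr.
apply/funext => n; rewrite /series /= scaler_sumr -big_split /=; apply: eq_bigr => i _.
by rewrite {1}[X i w]scalar_reconstruct scalerDl scalerA.
Qed.
End almost_sure_convergence.

Lemma same_law_pair {R : realType} {d d' d1} {Omega : measurableType d} {Omega' : measurableType d'}
    {T : measurableType d1} (P : probability Omega R) (P' : probability Omega' R)
    (X Y : Omega -> T) (X' Y' : Omega' -> T) :
  measurable_fun setT X -> measurable_fun setT Y ->
  measurable_fun setT X' -> measurable_fun setT Y' ->
  same_law P X P' X' -> same_law P Y P' Y' ->
  independent_pair P X Y -> independent_pair P' X' Y' ->
  same_law P (fun w => (X w, Y w)) P' (fun w => (X' w, Y' w)).
Proof.
move=> mX mY mX' mY' lX lY iXY iXY'.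
apply: (same_law_pi (G := [set C | exists A B, [/\ measurable A, measurable B & C = A `*` B]])).
- exact: measurable_fun_pair.
- exact: measurable_fun_pair.
- rewrite measurable_prod_measurableType; congr (<<s _ >>).
  apply/seteqP; split => C /=.
    by move=> [A mA [B mB <-]]; exists A, B.
  by move=> [A [B [mA mB ->]]]; exists A => //; exists B.
- move=> _ _ [A [B [mA mB ->]]] [A' [B' [mA' mB' ->]]]; exists (A `&` A'), (B `&` B'); split.
  + exact: measurableI.
  + exact: measurableI.
  + by rewrite setXI.
move=> _ [A [B [mA mB ->]]].
have -> : (fun w => (X w, Y w)) @^-1` (A `*` B) = X @^-1` A `&` Y @^-1` B by [].
have -> : (fun w => (X' w, Y' w)) @^-1` (A `*` B) = X' @^-1` A `&` Y' @^-1` B by [].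
by rewrite iXY // iXY' // lX // lY.
Qed.

Lemma nneseries_le_esum {R : realType} (f : nat -> int) (a : int -> R) : injective f ->
  (forall i, 0 <= a i) ->
  (\sum_(0 <= n <oo) (a (f n))%:E <= \esum_(i in [set: int]) (a i)%:E)%E.
Proof.
move=> fI a0; rewrite nneseries_esumT; last by move=> n; rewrite lee_fin.
rewrite -(@esum_image R nat int setT f (fun i => (a i)%:E)); last by move=> x y _ _; exact: fI.
rewrite esum_mkcond; apply: le_esum => i _; case: ifP => // _; by rewrite lee_fin.
Qed.

Section stable_series.
Context {R : realType} {k : scalar_kind} {E : completeNormedModType (scalars R k)} (alpha : R).
Hypothesis sepE : separable E.
Local Notation K := (scalars R k).
Local Notation path := (@path_space int _ (borel K)).
Variable u : int -> E.
Context {d} {Omega : measurableType d} (P : probability Omega R).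

Definition sas_sequence (kappa : R) (X : int -> Omega -> borel K) : Prop :=
  mutually_independent P X /\ forall n, sas alpha P kappa (X n).

Definition stable_sum (X : int -> Omega -> borel K) (w : Omega) : borel E :=
  series_map u (path_of X w).

Lemma measurable_sas_sequence kappa X i : sas_sequence kappa X -> measurable_fun setT (X i).
Proof. by case=> _ /(_ i)[]. Qed.

Lemma measurable_sas_path kappa X : sas_sequence kappa X -> measurable_fun setT (path_of X).
Proof. by move=> sX; apply: measurable_path_of => i; exact: measurable_sas_sequence sX. Qed.

Lemma measurable_stable_sum kappa X : sas_sequence kappa X -> measurable_fun setT (stable_sum X).
Proof.
by move=> sX; exact: measurableT_comp (measurable_series_map sepE u) (measurable_sas_path sX).
Qed.

Lemma sas_sequence_cvg kappa X : 0 < alpha -> stable_type E alpha ->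
  (\esum_(n in [set: int]) (rnorm (u n) `^ alpha)%:E < +oo)%E ->
  0 < kappa -> sas_sequence kappa X -> P (path_of X @^-1` cvg_paths u) = 1%E.
Proof.
move=> alpha_gt0 E_type u_sum kappa0 sX; have [iX saX] := sX.
have mD : measurable (path_of X @^-1` cvg_paths u).
  by apply: measurable_preim (measurable_sas_path sX) _; exact: measurable_cvg_paths.
have fin (f : nat -> int) : injective f ->
    (\sum_(0 <= n <oo) (rnorm (u (f n)) `^ alpha)%:E < +oo)%E.
  move=> fI; apply: le_lt_trans (nneseries_le_esum fI _) u_sum.
  by move=> i; exact: powR_ge0.
have I1 : injective (fun n : nat => n%:Z) by move=> m n [].
have I2 : injective (fun n : nat => - n.+1%:Z) by move=> m n; lia.
have := stable_series_cvg alpha_gt0 E_type kappa0 (independent_reindex I2 iX) (fun n => saX _) (fin _ I2).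
have := stable_series_cvg alpha_gt0 E_type kappa0 (independent_reindex I1 iX) (fun n => saX _) (fin _ I1).
move=> h1 h2.
have : {ae P, forall w, (path_of X @^-1` cvg_paths u) w} by apply: filterS2 h1 h2 => w c1 c2; split.
move=> nD; have := measure_negligible (measurableC mD) nD.
move=> P0; rewrite -[path_of X @^-1` _]setCK probability_setC; last exact: measurableC.
by rewrite P0 sube0.
Qed.

(** The sum is one fixed measurable function of the path, and independence together with [kappa]
    determines the law of the path. *)
Lemma stable_sum_same_law kappa X Y : sas_sequence kappa X -> sas_sequence kappa Y ->
  same_law P (stable_sum X) P (stable_sum Y).
Proof.
move=> sX sY A mA.
have mA' : measurable (series_map u @^-1` A : set path).
  by apply: (measurable_preim (T' := borel E)) => //; exact: measurable_series_map.
apply: (same_law_path _ _ _ _ _ mA').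
- by move=> i; exact: measurable_sas_sequence sX.
- by move=> i; exact: measurable_sas_sequence sY.
- by case: sX.
- by case: sY.
- by move=> i; apply: sas_same_law; [case: sX|case: sY].
Qed.

Lemma sas_sequence_scale kappa (c : K) X : sas_sequence kappa X ->
  sas_sequence (kappa * kabs c `^ alpha) (fun i w => c * (X i w : K) : borel K).
Proof.
move=> [iX sX]; split; last by move=> n; exact: sas_scale.
exact: (mutually_independent_comp (@lipschitz_scale R k c) iX).
Qed.

Lemma sas_sequence_reindex kappa X (f : int -> int) : injective f -> sas_sequence kappa X ->
  sas_sequence kappa (X \o f).
Proof. by move=> fI [iX sX]; split => [|n]; [exact: independent_reindex|exact: sX]. Qed.

Definition even_index (i : int) : int := i * 2.
Definition odd_index (i : int) : int := i * 2 + 1.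
Lemma even_index_inj : injective even_index. Proof. by rewrite /even_index => i j; lia. Qed.

Lemma odd_index_inj : injective odd_index. Proof. by rewrite /odd_index => i j; lia. Qed.

Lemma even_odd_index i j : even_index i != odd_index j. Proof. rewrite /even_index /odd_index; lia. Qed.

Lemma sas_sequence_pair kappa (a b : K) X : sas_sequence kappa X ->
  sas_sequence (kappa * (kabs a `^ alpha + kabs b `^ alpha))
    (fun i w => a * (X (even_index i) w : K) + b * (X (odd_index i) w : K) : borel K).
Proof.
move=> sX; have [iX saX] := sX.
have mX i := measurable_sas_sequence i sX.
have mh : measurable_fun setT (fun z : borel K * borel K => a * (z.1 : K) + b * (z.2 : K) : borel K).
  apply: measurable_scalarsD.
    exact: (measurableT_comp (lipschitz_scale a) measurable_fst).
  exact: (measurableT_comp (lipschitz_scale b) measurable_snd).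
split; first exact: (independent_pairs mX iX even_index_inj odd_index_inj even_odd_index mh).
move=> n; apply: (@sas_comb _ _ _ _ _ P (X (even_index n)) (X (odd_index n)) kappa) => //.
have ne : even_index n != odd_index n by exact: even_odd_index.
move=> A B mA mB.
(* Independence of a pair is read off from mutual independence on a list of two distinct indices. *)
have := iX [:: even_index n; odd_index n] (fun i => if i == even_index n then A else B) _ _.
rewrite !big_cons big_nil eqxx eq_sym (negbTE ne) mule1 => <-.
- congr (P _); apply/seteqP; split => w /=.
    by move=> [Aw Bw] i /=; rewrite !inE => /orP[/eqP->|/eqP->]; rewrite ?eqxx // eq_sym (negbTE ne).
  move=> H; split; first by have := H (even_index n); rewrite /= !inE !eqxx; apply.
  by have := H (odd_index n); rewrite /= !inE eq_sym (negbTE ne) eqxx; apply.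
- by rewrite /= inE ne.
- by move=> i; case: ifP.
Qed.

Lemma independent_even_odd kappa X : sas_sequence kappa X ->
  independent_pair P (stable_sum (X \o even_index)) (stable_sum (X \o odd_index)).
Proof.
move=> sX A B mA mB; have [iX _] := sX; have mX i := measurable_sas_sequence i sX.
pose kap := [pred i : int | ~~ odd (absz i)].
have ms (f : int -> int) : measurable_fun setT (fun x : path => series_map u (fun i => x (f i)) : borel E).
  apply: (measurableT_comp (f := series_map u : path -> borel E)).
    exact: measurable_series_map.
  by apply: measurable_path => i; exact: measurable_coord.
have mC f (C : set (borel E)) : measurable C -> measurable ((fun x : path => series_map u (fun i => x (f i))) @^-1` C).
  by move=> mC; apply: (measurable_preim (T' := borel E)).
have := independent_blocks kap (0 : borel K) mX iX (mC even_index A mA) (mC odd_index B mB).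
have E1 : path_of (block_in X kap 0) @^-1` ((fun x : path => series_map u (fun i => x (even_index i))) @^-1` A) =
    stable_sum (X \o even_index) @^-1` A.
  rewrite /preimage /stable_sum; apply/funext => w; congr (A (series_map u _)).
  by apply/funext => i; rewrite /path_of /block_in /kap /= (_ : ~~ _ = true) //; rewrite /even_index; lia.
have E2 : path_of (block_out X kap 0) @^-1` ((fun x : path => series_map u (fun i => x (odd_index i))) @^-1` B) =
    stable_sum (X \o odd_index) @^-1` B.
  rewrite /preimage /stable_sum; apply/funext => w; congr (B (series_map u _)).
  by apply/funext => i; rewrite /path_of /block_out /kap /= (_ : ~~ _ = false) //; rewrite /odd_index; lia.
by rewrite E1 E2.
Qed.
End stable_series.

(** * The law of the sum *)

Section stable_sum_properties.
Context {R : realType} {k : scalar_kind} {E : completeNormedModType (scalars R k)} (alpha : R).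
Hypothesis alpha_gt0 : 0 < alpha.
Hypotheses (sepE : separable E) (E_type : stable_type E alpha).
Local Notation K := (scalars R k).
Local Notation path := (@path_space int _ (borel K)).
Variable u : int -> E.
Hypothesis u_sum : (\esum_(n in [set: int]) (rnorm (u n) `^ alpha)%:E < +oo)%E.
Context {d} {Omega : measurableType d} (P : probability Omega R).
Variables (kappa : R) (X : int -> Omega -> borel K).
Hypotheses (kappa_gt0 : 0 < kappa) (sX : sas_sequence alpha P kappa X).

Let v : Omega -> borel E := stable_sum u X.
Let mv : measurable_fun setT v. Proof. exact: measurable_stable_sum sX. Qed.
Let good (Y : int -> Omega -> borel K) : set Omega := path_of Y @^-1` cvg_paths u.
Let mgood kap Y : sas_sequence alpha P kap Y -> measurable (good Y).
Proof.
by move=> sY; apply: measurable_preim (measurable_sas_path sY) _; exact: measurable_cvg_paths.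
Qed.
Let Pgood kap Y : 0 < kap -> sas_sequence alpha P kap Y -> P (good Y) = 1%E.
Proof. by move=> k0 sY; exact: (sas_sequence_cvg sepE alpha_gt0 E_type u_sum k0 sY). Qed.

Lemma stable_sum_bilateral :
  {ae P, forall w, bilateral_series_to (fun n => (X n w : K) *: u n) (v w)}.
Proof.
exists (~` good X); split.
- by apply: measurableC; exact: mgood sX.
- rewrite probability_setC ?(Pgood kappa_gt0 sX) ?subee //; exact: mgood sX.
- by move=> w; apply: contra_not => Dw; exact: series_map_bilateral.
Qed.

Lemma stable_sum_scale_law (c : K) : c != 0 ->
  same_law P (stable_sum u (fun i w => c * (X i w : K) : borel K)) P (fun w => c *: (v w : E) : borel E).
Proof.
move=> c0 A mA.
have mcv : measurable_fun setT (fun w => c *: (v w : E) : borel E).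
  apply: (measurableT_comp (f := (fun x : E => c *: x) : borel E -> borel E)) mv.
  apply: (@lipschitz_measurable R k E E _ (kabs c)) => x y.
  by rewrite -scalerBr rnormZ.
have sY := sas_sequence_scale c sX.
apply: (@eq_prob_on _ _ _ P (good X)).
- exact: mgood sX.
- by apply: measurable_preim mA; exact: measurable_stable_sum sY.
- exact: measurable_preim mA.
- exact: Pgood sX.
have E1 w : good X w -> stable_sum u (fun i w => c * (X i w : K) : borel K) w = c *: (v w : E).
  move=> Dw; have [_] := series_map_comb c 0 Dw Dw.
  rewrite scale0r addr0 => <-; rewrite /stable_sum; congr (series_map u _).
  by apply/funext => i; rewrite mul0r addr0.
by apply/seteqP; split => w [/= Aw Dw]; split => //=; [rewrite -E1|rewrite E1].
Qed.

Lemma stable_sum_opp_law : same_law P v P (fun w => - (v w : E) : borel E).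
Proof.
have N0 : (-1 : K) != 0 by rewrite oppr_eq0 oner_eq0.
have := stable_sum_scale_law N0.
have -> : (fun w => -1 *: (v w : E) : borel E) = (fun w => - (v w : E)).
  by apply/funext => w; rewrite scaleN1r.
move=> H A mA; rewrite -(H A mA).
apply: (stable_sum_same_law sepE u sX) => //.
have := sas_sequence_scale (-1) sX.
by rewrite -(of_real1 R k) -of_realN kabs_of_real normrN1 powR1 mulr1.
Qed.

(* [X1] and [X2] may be replaced by the sums over the even and the odd [X i], which
   are independent copies of [v] and images of [X] under the series map. *)
Lemma stable_sum_combination (a b : R) : 0 < a -> 0 < b ->
  forall d' (Omega' : measurableType d') (P' : probability Omega' R) (X1 X2 : Omega' -> borel E),
  measurable_fun setT X1 -> measurable_fun setT X2 ->
  same_law P' X1 P v -> same_law P' X2 P v -> independent_pair P' X1 X2 ->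
  same_law P' (fun w => of_real k a *: (X1 w : E) + of_real k b *: (X2 w : E) : borel E)
    P (fun w => of_real k ((a `^ alpha + b `^ alpha) `^ alpha^-1) *: (v w : E) : borel E).
Proof.
move=> a0 b0 d' Omega' P' X1 X2 m1 m2 l1 l2 i12 A mA.
set c := (a `^ alpha + b `^ alpha) `^ alpha^-1.
have c0 : 0 < c by rewrite powR_gt0 // addr_gt0 // powR_gt0.
have cE : c `^ alpha = a `^ alpha + b `^ alpha.
  by rewrite /c -powRrM mulVf ?gt_eqF // powRr1 // addr_ge0 // powR_ge0.
pose Xe := X \o even_index; pose Xo := X \o odd_index.
have se : sas_sequence alpha P kappa Xe by exact: (sas_sequence_reindex even_index_inj sX).
have so : sas_sequence alpha P kappa Xo by exact: (sas_sequence_reindex odd_index_inj sX).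
(* [Y] and the multiples of [X] by [c] are independent sequences with the same constant
   [kappa * (a ^ alpha + b ^ alpha)], hence their sums have the same law. *)
pose Y i w : borel K := of_real k a * (Xe i w : K) + of_real k b * (Xo i w : K).
have sY : sas_sequence alpha P (kappa * (a `^ alpha + b `^ alpha)) Y.
  have := sas_sequence_pair (of_real k a) (of_real k b) sX.
  by rewrite !kabs_of_real !gtr0_norm.
have sZ : sas_sequence alpha P (kappa * (a `^ alpha + b `^ alpha)) (fun i w => of_real k c * (X i w : K) : borel K).
  by have := sas_sequence_scale (of_real k c) sX; rewrite kabs_of_real gtr0_norm // cE.
have me := measurable_stable_sum sepE u se.
have mo := measurable_stable_sum sepE u so.
have le : same_law P' X1 P (stable_sum u Xe).
  by move=> B mB; rewrite l1 //; exact: (stable_sum_same_law sepE u sX se).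
have lo : same_law P' X2 P (stable_sum u Xo).
  by move=> B mB; rewrite l2 //; exact: (stable_sum_same_law sepE u sX so).
pose h (z : borel E * borel E) : borel E := of_real k a *: (z.1 : E) + of_real k b *: (z.2 : E).
have mh : measurable_fun setT h.
  have msc (r : R) : measurable_fun setT (fun x : borel E => of_real k r *: (x : E) : borel E).
    apply: (@lipschitz_measurable R k E E _ (kabs (of_real k r))) => x y.
    by rewrite -scalerBr rnormZ.
  apply: (measurable_borelD sepE).
    exact: (measurableT_comp (msc a) measurable_fst).
  exact: (measurableT_comp (msc b) measurable_snd).
have joint := same_law_pair m1 m2 me mo le lo i12 (independent_even_odd sepE u sX).
(* The law of the combination passes from [(X1, X2)] to the even and odd sums by equality of joint
   laws, then to the sum of [Y] by linearity, then to the sum of the multiples of [X], which is a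
   multiple of [v]. *)
transitivity (P (stable_sum u Y @^-1` A)); last first.
  rewrite (stable_sum_same_law sepE u sY sZ mA).
  apply: stable_sum_scale_law => //.
  by rewrite -(of_real0 R k) (inj_eq (@of_real_inj R k)) gt_eqF.
transitivity (P ((fun w => (stable_sum u Xe w, stable_sum u Xo w)) @^-1` (h @^-1` A))).
  by rewrite -joint //; exact: measurable_preim.
have De := mgood se; have Do := mgood so.
have PDo := Pgood kappa_gt0 so; have PDe := Pgood kappa_gt0 se.
apply: (@eq_prob_on _ _ _ P (good Xe `&` good Xo)).
- exact: measurableI.
- apply: (measurable_preim (f := fun w => (stable_sum u Xe w, stable_sum u Xo w))).
    exact: measurable_fun_pair.
  exact: measurable_preim.
- by apply: measurable_preim mA; exact: (measurable_stable_sum sepE u sY).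
- rewrite -PDe; apply: (@eq_prob_on _ _ _ P (good Xo)) => //; first exact: measurableI.
  by rewrite -setIA setIid.
have E1 w : good Xe w -> good Xo w -> stable_sum u Y w = h (stable_sum u Xe w, stable_sum u Xo w).
  move=> D1 D2; have [_ E0] := series_map_comb (of_real k a) (of_real k b) D1 D2.
  by rewrite /h /= -[RHS]E0.
by apply/seteqP; split => w [/= Aw [D1 D2]]; split => //=; [rewrite E1|rewrite -E1].
Qed.

Variable T : {linear E -> E}.
Variable C : R.
Hypothesis TC : forall x, rnorm (T x) <= C * rnorm x.
Hypothesis Tu : forall n : int, T (u n) = u (n - 1).

Let T_lip (x y : E) : rnorm (T x - T y) <= C * rnorm (x - y).
Proof. by rewrite -raddfB; exact: TC. Qed.
Let T_cont : continuous T. Proof. exact: lipschitz_continuous T_lip. Qed.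
Let T_meas n : measurable_fun setT (iter n T : borel E -> borel E).
Proof.
elim: n => [|n IH]; first exact: measurable_id.
exact: measurableT_comp (lipschitz_measurable T_lip) IH.
Qed.

Let shifted n := fun i : int => X (i + n%:Z).
Let sshifted n : sas_sequence alpha P kappa (shifted n).
Proof. by apply: (sas_sequence_reindex (f := fun i => i + n%:Z)) => // i j /addIr. Qed.

Let v_iter n w : good X w -> stable_sum u (shifted n) w = iter n T (v w).
Proof. by move=> Dw; rewrite /v /stable_sum -(series_map_iter_shift T_cont Tu n Dw). Qed.

Lemma stable_sum_invariant (A : set (borel E)) : measurable A -> P (v @^-1` (T @^-1` A)) = P (v @^-1` A).
Proof.
move=> mA; rewrite -(stable_sum_same_law sepE u (sshifted 1) sX mA).
apply: (@eq_prob_on _ _ _ P (good X)).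
- exact: mgood sX.
- by apply: measurable_preim mv _; exact: (measurable_preim (T_meas 1) mA).
- by apply: measurable_preim mA; exact: (measurable_stable_sum sepE u (sshifted 1)).
- exact: Pgood sX.
by apply/seteqP; split => w [/= Aw Dw]; split => //=; have := v_iter 1 Dw => /= h; [rewrite h|rewrite -h].
Qed.

Lemma stable_sum_mixing (A B : set (borel E)) : measurable A -> measurable B ->
  P (v @^-1` A `&` v @^-1` (iter n T @^-1` B)) @[n --> \oo] --> (P (v @^-1` A) * P (v @^-1` B))%E.
Proof.
move=> mA mB; have [iX saX] := sX.
have mphi (S : set (borel E)) : measurable S -> measurable (series_map u @^-1` S : set path).
  by move=> mS; apply: (measurable_preim (T' := borel E)) => //; exact: measurable_series_map.
have lX i : same_law P (X i) P (X 0) by exact: sas_same_law (saX i) (saX 0).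
have := iid_shift_mixing (fun i => measurable_sas_sequence i sX) iX lX (mphi A mA) (mphi B mB).
move=> H.
have mvS S : measurable S -> measurable (v @^-1` S) by exact: measurable_preim.
have mB' n : measurable (v @^-1` (iter n T @^-1` B)).
  by apply: mvS; exact: measurable_preim (T_meas n) mB.
rewrite -(fineK (fin_num_measure P _ (mvS A mA))) -(fineK (fin_num_measure P _ (mvS B mB))) -EFinM.
apply: cvg_EFin.
  by apply: nearW => n; apply: fin_num_measure; apply: measurableI => //; exact: mvS.
apply: cvg_trans H; apply: near_eq_cvg; apply: nearW => n /=; congr fine; apply/esym.
have ms : measurable (stable_sum u (shifted n) @^-1` B).
  by apply: measurable_preim mB; exact: (measurable_stable_sum sepE u (sshifted n)).
apply: (@eq_prob_on _ _ _ P (good X)).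
- exact: mgood sX.
- by apply: measurableI => //; exact: mvS.
- by apply: measurableI => //; exact: mvS.
- exact: Pgood sX.
apply/seteqP; split => w [[/= Aw Bw] Dw]; split => //=; split => //=.
  by move: Bw; rewrite -(v_iter n Dw).
by rewrite -(v_iter n Dw).
Qed.
Let pos_sum_near (x z : path) (N : nat) (delta : R) :
  (forall i, window N i -> kabs ((x i : K) - z i) <= delta) -> 0 <= delta ->
  rnorm (pos_sum u x N + neg_sum u x N - (pos_sum u z N + neg_sum u z N)) <=
  delta * (\sum_(0 <= i < N) rnorm (u i%:Z) + \sum_(0 <= i < N) rnorm (u (- i.+1%:Z))).
Proof.
move=> H d0; rewrite opprD addrACA; apply: le_trans (rnormD _ _) _; rewrite mulrDr lerD //.
  rewrite /pos_sum -sumrB mulr_sumr; apply: le_trans (rnorm_sum _ _) _.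
  rewrite big_nat_cond [leRHS]big_nat_cond; apply: ler_sum => i /andP[/andP[_ iN] _].
  by rewrite rnorm_scalelB ler_wpM2r ?rnorm_ge0 // H // /window /=; lia.
rewrite /neg_sum -sumrB mulr_sumr; apply: le_trans (rnorm_sum _ _) _.
rewrite big_nat_cond [leRHS]big_nat_cond; apply: ler_sum => i /andP[/andP[_ iN] _].
by rewrite rnorm_scalelB ler_wpM2r ?rnorm_ge0 // H // /window /=; lia.
Qed.

Let tail N : Omega -> path := path_of (block_out X (window N) (0 : borel K)).

Let tail_path (N : nat) (w : Omega) :
  tail N w = (fun i => if window N i then 0 else path_of X w i) :> path.
Proof. by apply/funext => i; rewrite /tail /path_of /block_out; case: ifP. Qed.

(** On the convergence set the tails tend to 0, so the events for [N >= N0] cover it and one of them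
    is charged. Positive probability is enough, since independence will multiply it by that of the
    head. *)
Let tail_small (e : R) (N0 : nat) : 0 < e -> exists2 N, (N0 <= N)%N &
  (0 < P (tail N @^-1` [set x : path | (rnorm (series_map u x) < e)%R]))%E.
Proof.
move=> e0; have [iX saX] := sX; have mX i := measurable_sas_sequence i sX.
have mA : measurable [set x : path | rnorm (series_map u x) < e].
  rewrite (_ : mkset _ = (fun x => rnorm (series_map u x)) @^-1` `]-oo, e[%classic); last first.
    by apply/seteqP; split => w /=; rewrite in_itv.
  apply: measurable_preim => //.
  exact: (@measurable_rnorm R k E _ path (series_map u) (measurable_series_map sepE u)).
have [|||n Pn] := @positive_cover _ _ _ P (good X) (fun n => tail (N0 + n) @^-1`
    [set x : path | rnorm (series_map u x) < e]) (mgood sX).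
- move=> n; apply: measurable_preim => //; apply: measurable_path_of.
  by move=> i; exact: measurable_block_out.
- move=> w Dw; have /cvg_rnormP/(_ e e0)[n _ Hn] := cvg_series_map Dw.
  exists n => //; rewrite /= tail_path.
  have [_ E0] := series_map_tail (N0 + n) Dw.
  have := Hn (N0 + n)%N (leq_addl _ _); rewrite /= {1}E0 addrAC subrr add0r.
  by [].
- by rewrite (Pgood kappa_gt0 sX).
by exists (N0 + n)%N => //; exact: leq_addr.
Qed.

Let near_set (N : nat) (z : path) (delta : R) (i : int) : set (borel K) :=
  if window N i then [set c : K | kabs (c - z i) < delta] else setT.

(* Full support of [v]: the finitely many head coefficients come close to
   prescribed values independently of the tail of the series being small. *)
Let head_close (N : nat) (z : path) (delta : R) : 0 < delta ->
  measurable [set x : path | forall i, near_set N z delta i (x i)] /\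
  (0 < P (path_of X @^-1` [set x : path | forall i, near_set N z delta i (x i)]))%E.
Proof.
move=> d0; set B := near_set N z delta; have [iX saX] := sX; have mX i := measurable_sas_sequence i sX.
have mball (x : K) : measurable ([set y : K | kabs (y - x) < delta] : set (borel K)).
  by apply: sub_sigma_algebra; exact: (@open_rnorm_lt R k (K^o)).
have mB i : measurable (B i) by rewrite /B /near_set; case: ifP.
(* The [N + N] indices of the window, from [- N] to [N - 1]. *)
pose s : seq int := map (fun j : nat => j%:Z - N%:Z) (iota 0 (N + N)).
have us : uniq s by rewrite map_inj_uniq ?iota_uniq // => i j; lia.
have sB i : i \notin s -> B i = setT.
  rewrite /B /near_set; case: ifPn => // /andP[h1 h2] /negP[]; apply/mapP.
  exists (absz (i + N%:Z)); last by lia.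
  by rewrite mem_iota; lia.
split; first by apply: sub_sigma_algebra; exists s, B.
rewrite [X in (_ < P X)%E](_ : _ = [set w | forall i, B i (X i w)]) //.
rewrite (independent_forall iX us mB sB).
elim/big_ind : _ => // [x y|i _]; first exact: mule_gt0.
rewrite /B /near_set; case: ifP => _; last by rewrite preimage_setT probability_setT.
(* The neighbour [X (i + 1)] serves as the independent copy of [X i] on the same probability
   space. *)
apply: (sas_full_support alpha_gt0 kappa_gt0 (saX i) (saX (i + 1)) _ _ d0).
have ne : i != i + 1 by lia.
move=> A A' mA mA'.
have := iX [:: i; i + 1] (fun j => if j == i then A else A') _ _.
rewrite !big_cons big_nil eqxx eq_sym (negbTE ne) mule1 => <-.
- congr (P _); apply/seteqP; split => w /=.
    by move=> [Aw Bw] j /=; rewrite !inE => /orP[/eqP->|/eqP->]; rewrite ?eqxx // eq_sym (negbTE ne).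
  move=> H; split; first by have := H i; rewrite /= !inE !eqxx; apply.
  by have := H (i + 1); rewrite /= !inE eq_sym (negbTE ne) eqxx; apply.
- by rewrite /= inE ne.
- by move=> j; case: ifP.
Qed.

Lemma stable_sum_full_support : dense (lspan (range u)) ->
  forall U : set E, open U -> U !=set0 -> (0 < P (v @^-1` U))%E.
Proof.
move=> u_dense U oU U0; have [iX saX] := sX; have mX i := measurable_sas_sequence i sX.
have [x [Ux /lspan_paths[z [N0 zE]]]] := u_dense _ U0 oU.
have /nbhs_rnormP[e e0 eU] : nbhs x U by exact: open_nbhs_nbhs.
have e2 : 0 < e / 2 by rewrite divr_gt0.
have [N N0N tailP] := tail_small N0 e2.
pose S := \sum_(0 <= i < N) rnorm (u i%:Z) + \sum_(0 <= i < N) rnorm (u (- i.+1%:Z)).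
have S0 : 0 <= S by rewrite addr_ge0 // sumr_ge0 // => i _; exact: rnorm_ge0.
(* [S] bounds the effect of unit errors in the head; [1 + S] is positive even if [S = 0] and makes
   [delta * S < e / 2] strict. *)
pose delta := e / 2 / (1 + S).
have S1 : 0 < 1 + S by rewrite ltr_wpDr.
have d0 : 0 < delta by rewrite divr_gt0.
have dS : delta * S < e / 2.
  by rewrite /delta -mulrA gtr_pMr // mulrC ltr_pdivrMr // mul1r ltrDr.
have [mH PH] := head_close N z d0.
set B := near_set N z delta in mH PH.
set H := [set x : path | forall i, B i (x i)] in mH PH.
set L := [set x : path | rnorm (series_map u x) < e / 2] in tailP.
have mL : measurable L.
  rewrite (_ : L = (fun x => rnorm (series_map u x)) @^-1` `]-oo, (e / 2)[%classic); last first.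
    by apply/seteqP; split => w /=; rewrite in_itv.
  apply: measurable_preim => //.
  exact: (@measurable_rnorm R k E _ path (series_map u) (measurable_series_map sepE u)).
(* [H] constrains only coordinates in the window, so freezing the others leaves the event
   unchanged. *)
have HE : path_of (block_in X (window N) (0 : borel K)) @^-1` H = path_of X @^-1` H.
  have aux w i : B i (block_in X (window N) 0 i w) <-> B i (X i w).
    by rewrite /block_in /B /near_set; case: ifP.
  by apply/seteqP; split => w h i; apply/aux; exact: h.
have := independent_blocks (window N) (0 : borel K) mX iX mH mL.
rewrite HE => PHL.
have mHX : measurable (path_of X @^-1` H).
  by apply: measurable_preim mH; exact: measurable_sas_path sX.
have mLX : measurable (path_of (block_out X (window N) (0 : borel K)) @^-1` L).
  apply: measurable_preim mL; apply: measurable_path_of => i; exact: measurable_block_out.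
have mHL := measurableI _ _ mHX mLX.
(* Restricting to convergent paths costs no probability and allows splitting [v] into head and
   tail. *)
have pos : (0 < P ((path_of X @^-1` H `&` tail N @^-1` L) `&` good X))%E.
  rewrite (@eq_prob_on _ _ _ P (good X) _ (path_of X @^-1` H `&` tail N @^-1` L)) //.
  - by rewrite PHL mule_gt0.
  - exact: mgood sX.
  - by apply: measurableI => //; exact: mgood sX.
  - exact: Pgood sX.
  - by rewrite -setIA setIid.
apply: lt_le_trans pos _; apply: le_measure; rewrite ?inE.
- by apply: measurableI => //; exact: mgood sX.
- by apply: measurable_preim => //; exact: sub_sigma_algebra.
move=> w [[Hw Lw] Dw]; apply: eU; rewrite rnormB.
have [_ vE] := series_map_tail N Dw.
rewrite /v /stable_sum vE -(zE N N0N) addrAC; apply: le_lt_trans (rnormD _ _) _.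
rewrite [ltRHS]splitr; apply: ltrD; last by move: Lw; rewrite /L /= tail_path.
apply: le_lt_trans dS; apply: pos_sum_near; last exact: ltW.
by move=> i Ni; have := Hw i; rewrite /B /near_set Ni /= => /ltW.
Qed.
End stable_sum_properties.

Theorem theorem4p1 (R : realType) (k : scalar_kind)
    (E : completeNormedModType (scalars R k)) (alpha : R)
    (alpha_gt0 : 0 < alpha) (alpha_le2 : alpha <= 2)
    (E_infdim : infinite_dimensional E) (E_sep : separable E)
    (E_type : stable_type E alpha)
    (T : {linear E -> E}) (T_bounded : bounded_operator T)
    (u : int -> E)
    (u_sum : (\esum_(n in [set: int]) (rnorm (u n) `^ alpha)%:E < +oo)%E)
    (Tu : forall n : int, T (u n) = u (n - 1))
    (d : measure_display) (Omega : measurableType d) (P : probability Omega R)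
    (M : set int -> Omega -> scalars R k)
    (M_stable : stable_random_measure (@counting int R) P alpha M)
    (u_dense : dense (lspan (range u))) :
  let X := fun n : int => M [set n] in
  exists v : {RV P >-> borel E},
    [/\ {ae P, forall w, bilateral_series_to (fun n => X n w *: u n) (v w)},
        invariant_measure (distribution P v) T,
        strongly_mixing (distribution P v) T,
        full_support (distribution P v)
      & symmetric_stable_vector alpha v].
Proof.
move=> X; have [C TC] := T_bounded.
have [iX [kappa kappa_gt0 saX]] := stable_measure_sas alpha_gt0 alpha_le2 M_stable.
have sX : sas_sequence alpha P kappa X by [].
pose v : {RV P >-> borel E} := mfun_of (measurable_stable_sum E_sep u sX).
exists v; split.
- exact: (stable_sum_bilateral alpha_gt0 E_sep E_type u_sum kappa_gt0 sX).
- move=> A mA.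
  exact: (stable_sum_invariant alpha_gt0 E_sep E_type u_sum kappa_gt0 sX TC Tu mA).
- move=> A B mA mB.
  exact: (stable_sum_mixing alpha_gt0 E_sep E_type u_sum kappa_gt0 sX TC Tu mA mB).
- move=> U oU U0.
  exact: (stable_sum_full_support alpha_gt0 E_sep E_type u_sum kappa_gt0 sX).
- split; last exact: (stable_sum_opp_law alpha_gt0 E_sep E_type u_sum kappa_gt0 sX).
  (* The translation vector is 0: the combination has exactly the law of a multiple of [v]. *)
  move=> a b a0 b0; exists 0 => d' Omega' P' X1 X2 X1v X2v iX12.
  under [X in same_law _ _ _ X]eq_fun do rewrite add0r.
  by apply: (stable_sum_combination alpha_gt0 E_sep E_type u_sum kappa_gt0 sX a0 b0).
Qed.
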